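(* Let $m,n\geq 2$ be integers and let $k\geq 1$. Meromorphic solutions $f$ and $g$ in $\mathbf{C}^k$ to the functional equation $f^m(z)+g^n(z)=1$ are constant if and only if $\mathcal{Z}(f)=\mathcal{Z}(g)$ ignoring multiplicity when $\max\{m,n\}=2$, $\mathcal{Z}(f)\subseteq\mathcal{Z}(g)$ ignoring multiplicity when $n\geq 3$, and $\mathcal{Z}(f)\supseteq\mathcal{Z}(g)$ ignoring multiplicity when $m\geq 3$.
   Context: For a meromorphic function $h$ on $\mathbf{C}^k$, $\mathcal{Z}(h)$ denotes the zero set of $h$. ''Ignoring multiplicity'' means that the zero sets are compared simply as sets of points.
   Formalization: In the ''only if'' direction, f (when n≥3), g (when m≥3), or both (when max{m,n}=2) are assumed not identically zero; otherwise the constants f=0, g=1 have Z(f)=C^k and Z(g) empty, contradicting the claim. *)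

(* Defs.v *)
From HB Require Import structures.
From mathcomp Require Import all_boot all_order all_algebra.
From mathcomp Require Import all_classical all_reals all_analysis.
From mathcomp Require Import complex.
Set Implicit Arguments.
Unset Strict Implicit.
Unset Printing Implicit Defensive.
Import Order.TTheory GRing.Theory Num.Theory.
Import numFieldNormedType.Exports.
Local Open Scope classical_set_scope.
Local Open Scope ring_scope.

(* R[i] packed as a numClosedFieldType, so that the norm and topology instances
   of numFieldNormedType apply to it and to row vectors over it. *)
Definition Cplx (R : realType) : numClosedFieldType := R[i].

(* The base field of [differentiable] is Cplx R here, so this is complex
   (Frechet) differentiability at every point of a neighbourhood of z. *)
Definition holomorphic_at (R : realType) (k : nat)
    (f : 'rV[Cplx R]_k -> Cplx R) (z : 'rV[Cplx R]_k) : Prop :=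
  \forall w \near z, differentiable f w.

(* A meromorphic function is represented by a total function: near each point
   it is a quotient p / q of holomorphic functions, the germ of q being nonzero,
   and its values on the (nowhere dense) zero set of q are arbitrary. Every
   notion below reads f only at points w with [holomorphic_at f w], which form
   a dense open set, so none of them depends on the arbitrary values. *)
Definition meromorphic (R : realType) (k : nat)
    (f : 'rV[Cplx R]_k -> Cplx R) : Prop :=
  forall z : 'rV[Cplx R]_k, exists p q : 'rV[Cplx R]_k -> Cplx R,
    [/\ holomorphic_at p z, holomorphic_at q z,
        ~ (\forall w \near z, q w = 0) &
        \forall w \near z, q w != 0 -> f w = p w / q w].

(* The points near which f extends holomorphically (through removable
   singularities of the representative) with value 0. *)
Definition zero_set (R : realType) (k : nat)
    (f : 'rV[Cplx R]_k -> Cplx R) : set 'rV[Cplx R]_k :=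
  [set z | exists h : 'rV[Cplx R]_k -> Cplx R,
    [/\ holomorphic_at h z,
        \forall w \near z, holomorphic_at f w -> f w = h w &
        h z = 0]].

Definition mero_eq_cst (R : realType) (k : nat)
    (f : 'rV[Cplx R]_k -> Cplx R) (c : Cplx R) : Prop :=
  forall z, holomorphic_at f z -> f z = c.

Definition mero_constant (R : realType) (k : nat)
    (f : 'rV[Cplx R]_k -> Cplx R) : Prop :=
  exists c : Cplx R, mero_eq_cst f c.

Definition fermat_solution (R : realType) (k m n : nat)
    (f g : 'rV[Cplx R]_k -> Cplx R) : Prop :=
  forall z, holomorphic_at f z -> holomorphic_at g z ->
    f z ^+ m + g z ^+ n = 1.

(* Main.v *)
Require Import Defs.
From HB Require Import structures.
From mathcomp Require Import all_boot all_order all_algebra.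
From mathcomp Require Import all_classical all_reals all_analysis.
From mathcomp Require Import complex.
From mathcomp Require Import ring lra.
From mathcomp Require separable cyclotomic.
Set Implicit Arguments.
Unset Strict Implicit.
Unset Printing Implicit Defensive.
Import Order.TTheory GRing.Theory Num.Theory.
Import numFieldNormedType.Exports.
Local Open Scope classical_set_scope.
Local Open Scope ring_scope.

(* If Z(f) is contained in Z(g), a common zero would give 0 + 0 = 1, so Z(f) is
   empty. Then F = 1/f extends to an entire function: at a point of
   indeterminacy of f = p/q, nearby lines carry points where p vanishes to
   higher order than q, and at a point where the order of q is least f would
   extend holomorphically with value 0. For s^n = 1 the identity
   F^m (1 - g^n) = 1 shows that g - s has no zero either, so G_s = 1/(g - s) is
   entire. For three distinct roots of unity a, b, c, G_a omits 1/(b - a) and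
   1/(c - a), hence is constant along lines by Picard's little theorem; so g is
   constant, and then F^m is. For m = n = 2 both F and G = 1/g are entire and
   F^2 + G^2 = F^2 G^2, so each of them omits 1 and -1.

   Picard's theorem is proved by comparison of metrics. An entire h omitting 0
   and 1 gives entire s, q with s^6 = h, q^6 = h - 1, that is, a map to the
   Fermat sextic s^6 - q^6 = 1. With the holomorphic form
   th dz = ds / q^5 = dq / s^5, the metric |th|^2 (1 + |s|^2) (1 + |q|^2) has
   curvature bounded above by a negative constant, so the Ahlfors-Schwarz
   argument bounds |th(0)| by a multiple of 1/r for every r. *)

(** Two obstacles shape the proof. In several variables the zeros of [p] and [q] can meet, so an
    empty [zero_set] does not say at once that q / p is bounded. No common factor is cancelled in a
    ring of germs: everything is read on parallel complex lines in one direction [v], where zeros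
    have orders, and a function found on each line is recovered as a mean over a circle of fixed
    radius, which depends holomorphically on the line. Minimality of the order of [q] keeps its
    zeros together when the line is displaced.

    For Picard, write S = |s|^2 and T = |q|^2. Where th is nonzero, log |th|^2 is harmonic, and the
    Laplacian of log (1 + |s|^2) is 4 |s'|^2 / (1 + |s|^2)^2; so the curvature bound amounts to (1 +
    S)(1 + T) being at most a constant times T^5 / (1 + S)^2 + S^5 / (1 + T)^2. On a Fermat curve of
    degree n the exponent 5 becomes n - 1, and S, T large of the same size require n - 3 >= 2. The
    even degree 6 moreover makes |s|^6 the polynomial S^3. *)

Notation "x %:C" := (real_complex _ x : Cplx _) : ring_scope.

(** The norm of a space over [Cplx R] takes its values in [Cplx R], whose order is only partial.
    [nrm] is the same number as an element of [R], where the order is total and [lra] and [nra]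
    apply. *)
Definition nrm (R : realType) (V : normedModType (Cplx R)) (v : V) : R :=
  complex.Re `|v|.

(** * Real-valued norms on complex spaces *)

Section RealEmbedding.
Variable R : realType.
Implicit Types x y : R.

Lemma leCR x y : ((x%:C : Cplx R) <= y%:C) = (x <= y).
Proof. exact: lecR. Qed.

Lemma ltCR x y : ((x%:C : Cplx R) < y%:C) = (x < y).
Proof. exact: ltcR. Qed.

Lemma CR_inj : injective (fun x => x%:C : Cplx R).
Proof. by move=> x y []. Qed.

Lemma CRD x y : (x + y)%:C = x%:C + y%:C :> Cplx R.
Proof. exact: (rmorphD (real_complex R)). Qed.

Lemma CRN x : (- x)%:C = - x%:C :> Cplx R.
Proof. exact: (rmorphN (real_complex R)). Qed.

Lemma CRM x y : (x * y)%:C = x%:C * y%:C :> Cplx R.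
Proof. exact: (rmorphM (real_complex R)). Qed.

Lemma CRV x : (x^-1)%:C = (x%:C)^-1 :> Cplx R.
Proof. exact: (fmorphV (real_complex R)). Qed.

Lemma CR_nat n : (n%:R)%:C = n%:R :> Cplx R.
Proof. exact: (rmorph_nat (real_complex R)). Qed.

Lemma CR0 : 0%:C = 0 :> Cplx R. Proof. by []. Qed.

Lemma CR1 : 1%:C = 1 :> Cplx R. Proof. by []. Qed.

End RealEmbedding.

Section Modulus.
Variable R : realType.
Local Notation C := (Cplx R).
Variable V : normedModType C.
Implicit Types (r e : R) (u v w : V).

Lemma normE v : `|v| = (nrm v)%:C.
Proof. by rewrite /nrm; apply/esym/RRe_real; rewrite realE normr_ge0. Qed.

Lemma nrm_ge0 v : 0 <= nrm v.
Proof. by rewrite -leCR -normE normr_ge0. Qed.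

Lemma nrm0 : nrm (0 : V) = 0.
Proof. by rewrite /nrm normr0. Qed.

Lemma nrm_eq0 v : (nrm v == 0) = (v == 0).
Proof.
rewrite -(normr_eq0 v) normE; apply/eqP/eqP => [-> //|].
by move/CR_inj.
Qed.

Lemma nrm_gt0 v : (0 < nrm v) = (v != 0).
Proof. by rewrite lt0r nrm_eq0 nrm_ge0 andbT. Qed.

Lemma nrmN v : nrm (- v) = nrm v.
Proof. by rewrite /nrm normrN. Qed.

Lemma nrmBC u v : nrm (u - v) = nrm (v - u).
Proof. by rewrite -nrmN opprB. Qed.

Lemma nrmD u v : nrm (u + v) <= nrm u + nrm v.
Proof. by rewrite -leCR CRD -!normE ler_normD. Qed.

Lemma nrmB u v : nrm (u - v) <= nrm u + nrm v.
Proof. by rewrite -[nrm v]nrmN nrmD. Qed.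

Lemma nrm_triangle u v (w : V) : nrm (u - w) <= nrm (u - v) + nrm (v - w).
Proof. by apply: le_trans (nrmD _ _); rewrite addrA subrK. Qed.

Lemma nrm_sub u v : nrm u - nrm v <= nrm (u - v).
Proof. by rewrite lerBlDr -{1}[u](subrK v) nrmD. Qed.

Lemma nrmZ (a : C) v : nrm (a *: v) = nrm (a : C) * nrm v.
Proof. by apply/CR_inj; rewrite CRM -!normE normrZ. Qed.

Lemma near_nrmP v (P : V -> Prop) :
  (\forall w \near v, P w) <->
  exists2 d : R, 0 < d & forall w, nrm (w - v) < d -> P w.
Proof.
split.
  move=> /nbhs_ballP [e /= e0 He]; exists (complex.Re e).
    by move: e0; rewrite ltcE => /andP[].
  move=> w Hw; apply: He; rewrite -ball_normE /= distrC normE.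
  move: e0 Hw; rewrite !ltcE /= => /andP[/eqP -> _] ->.
  by rewrite eqxx.
move=> [d d0 Hd]; apply/nbhs_ballP; exists d%:C => /=; first by rewrite ltCR.
by move=> w; rewrite -ball_normE /= distrC normE ltCR => /Hd.
Qed.

Lemma near0_nrmP (v : V) (P : V -> Prop) :
  (\forall w \near v, P w) <->
  exists2 d : R, 0 < d & forall h, nrm h < d -> P (v + h).
Proof.
rewrite near_nrmP; split=> -[d d0 Hd]; exists d => // h Hh.
  by apply: Hd; rewrite addrC addKr.
by rewrite -[h](subrK v) addrC; apply: Hd.
Qed.

End Modulus.

Section ComplexModulus.
Variable R : realType.
Local Notation C := (Cplx R).
Implicit Types (z w a : C) (r e : R).

Lemma nrmE z : nrm z = Normc.normc z.
Proof. by rewrite /nrm normc_def; case: z. Qed.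

Lemma nrmM z w : nrm (z * w) = nrm z * nrm w.
Proof. by rewrite !nrmE Normc.normcM. Qed.

Lemma nrm1 : nrm (1 : C) = 1.
Proof. by rewrite nrmE Normc.normc1. Qed.

Lemma nrmV z : nrm z^-1 = (nrm z)^-1.
Proof. by rewrite !nrmE Normc.normcV. Qed.

Lemma nrmX z n : nrm (z ^+ n) = nrm z ^+ n.
Proof. by elim: n => [|n IH]; rewrite ?expr0 ?nrm1 // !exprS nrmM IH. Qed.

Lemma nrmR r : nrm (r%:C : C) = `|r|.
Proof. by rewrite nrmE /= expr0n /= addr0 sqrtr_sqr. Qed.

Lemma nrm_nat n : nrm (n%:R : C) = n%:R.
Proof.
by rewrite -CR_nat nrmR ger0_norm.
Qed.

Lemma nrm_sqr z : nrm z ^+ 2 = complex.Re z ^+ 2 + complex.Im z ^+ 2.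
Proof. by rewrite nrmE; case: z => x y /=; rewrite sqr_sqrtr ?addr_ge0 ?sqr_ge0. Qed.

Lemma nrm_Re z : `|complex.Re z| <= nrm z.
Proof.
rewrite -(@ler_pXn2r _ 2) // ?nnegrE ?nrm_ge0 // nrm_sqr real_normK ?num_real //.
by rewrite lerDl sqr_ge0.
Qed.

Lemma nrm_Im z : `|complex.Im z| <= nrm z.
Proof.
rewrite -(@ler_pXn2r _ 2) // ?nnegrE ?nrm_ge0 // nrm_sqr real_normK ?num_real //.
by rewrite lerDr sqr_ge0.
Qed.

Lemma nrm_ReIm z : nrm z <= `|complex.Re z| + `|complex.Im z|.
Proof.
rewrite -(@ler_pXn2r _ 2) // ?nnegrE ?addr_ge0 ?nrm_ge0 // nrm_sqr.
rewrite -[X in X + _]real_normK ?num_real // -[X in _ + X]real_normK ?num_real //.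
by rewrite sqrrD -addrA lerD2l lerDr mulrn_wge0 // mulr_ge0.
Qed.

End ComplexModulus.

(** * Integration over the unit interval *)

Section DyadicIntegral.
Variable R : realType.
Local Notation C := (Cplx R).
Implicit Types (phi psi : R -> C) (c : C) (e d : R).

(* Cousin's covering lemma, with compactness packaged as an induction on
   intervals. *)
Lemma cousin (P : R -> R -> Prop) :
    (forall a m b, a <= m <= b -> P a m -> P m b -> P a b) ->
    (forall c : R, 0 <= c <= 1 -> exists2 d, 0 < d & forall a b,
       0 <= a <= c -> c <= b <= 1 -> b - a < d -> P a b) ->
  P 0 1.
Proof.
move=> Padd Ploc.
pose S := [set x : R | 0 <= x <= 1 /\ P 0 x].
have S0 : S 0.
  have [d d0 Hd] := Ploc 0 (introT andP (conj (lexx _) ler01)).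
  by split; [rewrite lexx ler01|apply: Hd; rewrite ?lexx ?ler01 // subrr].
have Sb : has_ubound S by exists 1 => x [/andP[]].
have hS : has_sup S by split => //; exists 0.
have s0 : 0 <= sup S by apply: ub_le_sup.
have s1 : sup S <= 1 by apply: ge_sup; [exists 0|move=> x [/andP[]]].
have s01 : 0 <= sup S <= 1 by rewrite s0.
have [d d0 Hd] := Ploc _ s01.
have [x [/andP[x0 x1] Px] xs] := sup_adherent (divr_gt0 d0 (ltr0Sn R 2)) hS.
have xs' : x <= sup S by apply: ub_le_sup => //; split; rewrite ?x0.
pose y := Num.min (sup S + d / 3) 1.
have sy : sup S <= y by rewrite /y le_min s1 andbT lerDl divr_ge0 // ltW.
have Py : P 0 y.
  apply: (Padd _ x); [by rewrite x0 (le_trans xs')|by []|apply: Hd].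
  - by rewrite x0.
  - by rewrite sy /y ge_min lexx orbT.
  - have : y <= sup S + d / 3 by rewrite /y ge_min lexx.
    lra.
have : y <= sup S.
  apply: ub_le_sup => //; split => //.
  by rewrite (le_trans s0 sy) /y ge_min lexx orbT.
rewrite {1}/y ge_min => /orP[|s1']; first lra.
suff <- : y = 1 by [].
by rewrite /y; apply/min_idPr; lra.
Qed.

Definition unif_cont phi := forall e, 0 < e -> exists2 d, 0 < d &
  forall s t, 0 <= s <= 1 -> 0 <= t <= 1 -> `|s - t| < d -> nrm (phi s - phi t) <= e.

Definition ptw_cont phi := forall s, 0 <= s <= 1 -> forall e, 0 < e -> exists2 d, 0 < d &
  forall t, 0 <= t <= 1 -> `|t - s| < d -> nrm (phi t - phi s) <= e.

(** By [cousin]. The property is additive over adjacent intervals because a pair straddling the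
    joint [m] is compared through [phi m], using continuity at [m]. On a short interval around [c]
    the oscillation is already at most [e], so any modulus, here 1, will do. *)
Lemma heine_cantor phi : ptw_cont phi -> unif_cont phi.
Proof.
move=> Hphi e e0.
pose P a b := 0 <= a -> b <= 1 -> exists2 d, 0 < d &
  forall s t, a <= s <= b -> a <= t <= b -> `|s - t| < d -> nrm (phi s - phi t) <= e.
suff : P 0 1.
  move=> /(_ (lexx _) (lexx _)) [d d0 Hd]; exists d => //.
apply: cousin => [a m b /andP[am mb] P1 P2 a0 b1|c c01].
  have m0 : 0 <= m by exact: le_trans am.
  have m1 : m <= 1 by exact: le_trans b1.
  have [d1 d10 Hd1] := P1 a0 m1.
  have [d2 d20 Hd2] := P2 m0 b1.
  have e20 : 0 < e / 2 by rewrite divr_gt0.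
  have m01 : 0 <= m <= 1 by rewrite m0.
  have [d3 d30 Hd3] := Hphi _ m01 _ e20.
  exists (Num.min d1 (Num.min d2 d3)); first by rewrite !lt_min d10 d20.
  have cross s t : a <= s <= m -> m <= t <= b -> `|s - t| < d3 -> nrm (phi s - phi t) <= e.
    move=> /andP[as_ sm] /andP[mt tb] st.
    apply: le_trans (nrm_triangle _ (phi m) _) _.
    rewrite [e]splitr lerD //; last rewrite nrmBC.
      apply: Hd3; first by rewrite (le_trans a0) //= (le_trans sm).
      by move: st; rewrite !ltr_norml => /andP[? ?]; apply/andP; split; lra.
    apply: Hd3; first by rewrite (le_trans m0) //= (le_trans tb).
    by move: st; rewrite !ltr_norml => /andP[? ?]; apply/andP; split; lra.
  move=> s t /andP[as_ sb] /andP[at_ tb]; rewrite !lt_min => /andP[l1 /andP[l2 l3]].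
  have [sm|/ltW ms] := leP s m; have [tm|/ltW mt] := leP t m.
  - by apply: Hd1; rewrite ?as_ ?at_.
  - by apply: cross; rewrite ?as_ ?mt.
  - by rewrite nrmBC; apply: cross; rewrite ?ms ?at_ ?sb // distrC.
  - by apply: Hd2; rewrite ?ms ?mt.
have e20 : 0 < e / 2 by rewrite divr_gt0.
have [d d0 Hd] := Hphi _ c01 _ e20.
exists d => // a b /andP[a0 ac] /andP[cb b1] ab _ _; exists 1 => // s t /andP[as_ sb] /andP[at_ tb] _.
apply: le_trans (nrm_triangle _ (phi c) _) _.
rewrite [e]splitr lerD //; last rewrite nrmBC.
  apply: Hd; first by rewrite (le_trans a0) //= (le_trans sb).
  by rewrite ltr_norml; apply/andP; split; lra.
apply: Hd; first by rewrite (le_trans a0) //= (le_trans tb).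
by rewrite ltr_norml; apply/andP; split; lra.
Qed.

Definition lo phi := fun t : R => phi (t / 2).
Definition hi phi := fun t : R => phi ((1 + t) / 2).

(* The left Riemann sum of [phi] over the 2^n dyadic subintervals of [0, 1]. *)
Fixpoint dyad n phi : C :=
  if n is n'.+1 then (dyad n' (lo phi) + dyad n' (hi phi)) / 2 else phi 0.

Lemma half01 (t : R) : 0 <= t <= 1 -> 0 <= t / 2 <= 1 /\ 0 <= (1 + t) / 2 <= 1.
Proof. by move=> /andP[? ?]; split; apply/andP; split; lra. Qed.

Lemma nrm_avg (z w : C) e : nrm z <= e -> nrm w <= e -> nrm ((z + w) / 2) <= e.
Proof.
move=> Hz Hw; rewrite nrmM nrmV nrm_nat ler_pdivrMr ?ltr0n // mulr_natr mulr2n.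
by rewrite (le_trans (nrmD _ _)) // lerD.
Qed.

Lemma dyad_bound n phi e :
  (forall t, 0 <= t <= 1 -> nrm (phi t) <= e) -> nrm (dyad n phi) <= e.
Proof.
elim: n phi => [|n IH] phi H /=; first by apply: H; rewrite lexx ler01.
by apply: nrm_avg; apply: IH => t /half01[h1 h2]; apply: H.
Qed.

Lemma dyadD n phi psi : dyad n (fun t => phi t + psi t) = dyad n phi + dyad n psi.
Proof.
elim: n phi psi => [|n IH] phi psi //=.
by rewrite -mulrDl addrACA -(IH (lo phi)) -(IH (hi phi)).
Qed.

Lemma dyadZ n phi c : dyad n (fun t => c * phi t) = c * dyad n phi.
Proof.
elim: n phi => [|n IH] phi //=.
by rewrite mulrA mulrDr -(IH (lo phi)) -(IH (hi phi)).
Qed.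

Lemma dyadB n phi psi : dyad n (fun t => phi t - psi t) = dyad n phi - dyad n psi.
Proof.
rewrite -[X in _ + X]mulN1r -dyadZ -dyadD; congr dyad.
by apply/funext => t; rewrite mulN1r.
Qed.

Lemma dyad_cst n c : dyad n (fun=> c) = c.
Proof.
elim: n => [|n IH] //=.
by rewrite /lo /hi IH -mulr2n -[c *+ 2]mulr_natr mulfK // pnatr_eq0.
Qed.

(** Stretching a half of [phi] to the unit interval doubles distances, so both halves satisfy the
    hypothesis one level lower. At level 0 a single value is compared with a mean of values. *)
Lemma dyad_osc n k phi e :
  (forall s t, 0 <= s <= 1 -> 0 <= t <= 1 -> `|s - t| <= 2 ^- n -> nrm (phi s - phi t) <= e) ->
  nrm (dyad n phi - dyad (n + k) phi) <= e.
Proof.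
elim: n phi => [|n IH] phi H.
  rewrite add0n /= -[phi 0](dyad_cst k) -dyadB; apply: dyad_bound => t t01.
  apply: H; rewrite ?lexx ?ler01 // expr0 invr1 sub0r normrN.
  by case/andP: t01 => t0 t1; rewrite ger0_norm.
rewrite addSn /= -mulrBl opprD addrACA; apply: nrm_avg.
  apply: IH => s t s01 t01 st; apply: H; rewrite ?(half01 s01).1 ?(half01 t01).1 //.
  rewrite -mulrBl normrM [X in _ * X]ger0_norm ?invr_ge0 // exprS invfM mulrC.
  by rewrite ler_pM2l ?invr_gt0.
apply: IH => s t s01 t01 st; apply: H; rewrite ?(half01 s01).2 ?(half01 t01).2 //.
rewrite -mulrBl [1 + s]addrC addrKA.
rewrite normrM [X in _ * X]ger0_norm ?invr_ge0 // exprS invfM mulrC.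
by rewrite ler_pM2l ?invr_gt0.
Qed.

Lemma exp2_small d : 0 < d -> exists N, forall n, (N <= n)%N -> (2 ^- n : R) < d.
Proof.
move=> d0; have := @near_infty_natSinv_expn_lt R (PosNum d0).
move=> [N _ HN]; exists N => n Nn; have := HN n Nn; rewrite /= div1r; exact.
Qed.

Lemma dyad_cauchy phi : unif_cont phi -> forall e, 0 < e ->
  exists N, forall n m, (N <= n)%N -> (N <= m)%N -> nrm (dyad n phi - dyad m phi) <= e.
Proof.
move=> U e e0; have e20 : 0 < e / 2 by rewrite divr_gt0.
have [d d0 Hd] := U _ e20; have [N HN] := exp2_small d0.
have H n : (N <= n)%N -> nrm (dyad N phi - dyad n phi) <= e / 2.
  move=> /subnKC <-; apply: dyad_osc => s t s01 t01 st; apply: Hd => //.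
  by apply: le_lt_trans st (HN _ _).
exists N => n m /H h1 /H h2.
apply: le_trans (nrm_triangle _ (dyad N phi) _) _.
by rewrite [e]splitr lerD // nrmBC.
Qed.

(** The limit is taken coordinatewise in the complete field [R]; it is meaningful under the Cauchy
    hypothesis of [clim_spec]. *)
Definition clim (u : nat -> C) : C :=
  Complex (lim (complex.Re (u n) @[n --> \oo])) (lim (complex.Im (u n) @[n --> \oo])).

Lemma clim_spec (u : nat -> C) :
    (forall e, 0 < e -> exists N, forall n m, (N <= n)%N -> (N <= m)%N -> nrm (u n - u m) <= e) ->
  forall e, 0 < e -> exists N, forall n, (N <= n)%N -> nrm (u n - clim u) <= e.
Proof.
move=> Hu e e0.
have cv (p : C -> R) : (forall z w, `|p z - p w| <= nrm (z - w)) ->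
    cvgn (fun n => p (u n)).
  move=> Hp; apply: cauchy_cvg; apply: cauchy_exP => e' /= e'0.
  have e'20 : 0 < e' / 2 by rewrite divr_gt0.
  have [N HN] := Hu _ e'20.
  exists (p (u N)); exists N => // n /= Nn; apply: le_lt_trans (Hp _ _) _.
  by apply: le_lt_trans (HN _ _ (leqnn _) Nn) _; lra.
have hre z w : `|complex.Re z - complex.Re w| <= nrm (z - w :> C).
  by have := nrm_Re (z - w); rewrite raddfB.
have him z w : `|complex.Im z - complex.Im w| <= nrm (z - w :> C).
  by have := nrm_Im (z - w); rewrite raddfB.
have e20 : 0 < e / 2 by rewrite divr_gt0.
have /cvgrPdist_le/(_ _ e20)[N1 _ H1] := cv _ hre.
have /cvgrPdist_le/(_ _ e20)[N2 _ H2] := cv _ him.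
exists (maxn N1 N2) => n; rewrite geq_max => /andP[h1 h2].
apply: le_trans (nrm_ReIm _) _; rewrite [e]splitr !raddfB /= lerD //.
  by rewrite distrC; apply: H1.
by rewrite distrC; apply: H2.
Qed.

(* This is the integral over [0, 1] when [phi] is uniformly continuous. *)
Definition integ phi : C := clim (dyad ^~ phi).

Lemma integ_spec phi : unif_cont phi -> forall e, 0 < e ->
  exists N, forall n, (N <= n)%N -> nrm (dyad n phi - integ phi) <= e.
Proof. by move=> /dyad_cauchy/clim_spec. Qed.

Lemma nrm_le_eps (z : C) : (forall e, 0 < e -> nrm z <= e) -> z = 0.
Proof.
move=> H; apply/eqP; rewrite -nrm_eq0; apply/eqP/le_anti; rewrite nrm_ge0 andbT.
by apply/ler_addgt0Pl => e e0; rewrite addr0; apply: H.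
Qed.

Lemma integ_unique phi (l : C) :
  unif_cont phi ->
  (forall e, 0 < e -> exists N, forall n, (N <= n)%N -> nrm (dyad n phi - l) <= e) ->
  integ phi = l.
Proof.
move=> U H; apply/eqP; rewrite -subr_eq0; apply/eqP/nrm_le_eps => e e0.
have e20 : 0 < e / 2 by rewrite divr_gt0.
have [N1 H1] := integ_spec U e20; have [N2 H2] := H _ e20.
apply: le_trans (nrm_triangle _ (dyad (maxn N1 N2) phi) _) _.
rewrite [e]splitr lerD //; first by rewrite nrmBC H1 // leq_maxl.
by rewrite H2 // leq_maxr.
Qed.

Lemma unif_contD phi psi : unif_cont phi -> unif_cont psi ->
  unif_cont (fun t => phi t + psi t).
Proof.
move=> U1 U2 e e0; have e20 : 0 < e / 2 by rewrite divr_gt0.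
have [d1 d10 H1] := U1 _ e20; have [d2 d20 H2] := U2 _ e20.
exists (Num.min d1 d2); first by rewrite lt_min d10.
move=> s t s01 t01; rewrite lt_min => /andP[h1 h2].
by rewrite opprD addrACA (le_trans (nrmD _ _)) // [e]splitr lerD ?H1 ?H2.
Qed.

Lemma unif_contZ phi c : unif_cont phi -> unif_cont (fun t => c * phi t).
Proof.
move=> U e e0; have e20 : 0 < e / (nrm c + 1) by rewrite divr_gt0 // ltr_wpDl ?nrm_ge0.
have [d d0 H] := U _ e20; exists d => // s t s01 t01 st.
rewrite -mulrBr nrmM.
apply: le_trans (_ : nrm c * (e / (nrm c + 1)) <= _).
  by rewrite ler_wpM2l ?nrm_ge0 // H.
have c1 : 0 < nrm c + 1 by rewrite ltr_wpDl ?nrm_ge0.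
by rewrite mulrCA ler_piMr ?(ltW e0) // ler_pdivrMr // mul1r lerDl.
Qed.

Lemma unif_contB phi psi : unif_cont phi -> unif_cont psi ->
  unif_cont (fun t => phi t - psi t).
Proof.
move=> U1 U2; have := unif_contD U1 (unif_contZ (-1) U2).
by congr unif_cont; apply/funext => t; rewrite mulN1r.
Qed.

Lemma unif_cont_cst c : unif_cont (fun=> c).
Proof. by move=> e e0; exists 1 => // s t _ _ _; rewrite subrr nrm0 ltW. Qed.

Lemma unif_cont_lo phi : unif_cont phi -> unif_cont (lo phi).
Proof.
move=> U e /U[d d0 H]; exists d => // s t s01 t01 st.
apply: H; rewrite ?(half01 s01).1 ?(half01 t01).1 //.
by rewrite -mulrBl normrM [X in _ * X]ger0_norm ?invr_ge0 //; have := normr_ge0 (s - t); lra.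
Qed.

Lemma unif_cont_hi phi : unif_cont phi -> unif_cont (hi phi).
Proof.
move=> U e /U[d d0 H]; exists d => // s t s01 t01 st.
apply: H; rewrite ?(half01 s01).2 ?(half01 t01).2 //.
rewrite -mulrBl [1 + s]addrC addrKA.
by rewrite normrM [X in _ * X]ger0_norm ?invr_ge0 //; have := normr_ge0 (s - t); lra.
Qed.

Lemma integD phi psi : unif_cont phi -> unif_cont psi ->
  integ (fun t => phi t + psi t) = integ phi + integ psi.
Proof.
move=> U1 U2; apply: integ_unique => [|e e0]; first exact: unif_contD.
have e20 : 0 < e / 2 by rewrite divr_gt0.
have [N1 H1] := integ_spec U1 e20; have [N2 H2] := integ_spec U2 e20.
exists (maxn N1 N2) => n; rewrite geq_max => /andP[h1 h2].
by rewrite dyadD opprD addrACA (le_trans (nrmD _ _)) // [e]splitr lerD ?H1 ?H2.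
Qed.

Lemma integZ phi c : unif_cont phi -> integ (fun t => c * phi t) = c * integ phi.
Proof.
move=> U; apply: integ_unique => [|e e0]; first exact: unif_contZ.
have c1 : 0 < nrm c + 1 by rewrite ltr_wpDl ?nrm_ge0.
have e20 : 0 < e / (nrm c + 1) by rewrite divr_gt0.
have [N H] := integ_spec U e20; exists N => n /H Hn.
rewrite dyadZ -mulrBr nrmM.
apply: le_trans (_ : nrm c * (e / (nrm c + 1)) <= _).
  by rewrite ler_wpM2l ?nrm_ge0.
by rewrite mulrCA ler_piMr ?(ltW e0) // ler_pdivrMr // mul1r lerDl.
Qed.

Lemma integB phi psi : unif_cont phi -> unif_cont psi ->
  integ (fun t => phi t - psi t) = integ phi - integ psi.
Proof.
move=> U1 U2; rewrite -[X in _ = _ + X]mulN1r -integZ // -integD //; last exact: unif_contZ.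
by congr integ; apply/funext => t; rewrite mulN1r.
Qed.

Lemma integ_cst c : integ (fun=> c) = c.
Proof.
apply: integ_unique => [|e e0]; first exact: unif_cont_cst.
by exists 0%N => n _; rewrite dyad_cst subrr nrm0 ltW.
Qed.

Lemma integ_half phi : unif_cont phi -> integ phi = (integ (lo phi) + integ (hi phi)) / 2.
Proof.
move=> U; apply: integ_unique => // e e0.
have [N1 H1] := integ_spec (unif_cont_lo U) e0.
have [N2 H2] := integ_spec (unif_cont_hi U) e0.
exists (maxn N1 N2).+1 => -[//|n]; rewrite ltnS geq_max => /andP[h1 h2] /=.
by rewrite -mulrBl opprD addrACA; apply: nrm_avg; [apply: H1|apply: H2].
Qed.

Lemma integ_bound phi e : unif_cont phi ->
  (forall t, 0 <= t <= 1 -> nrm (phi t) <= e) -> nrm (integ phi) <= e.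
Proof.
move=> U H; apply/ler_addgt0Pl => d d0.
have [N HN] := integ_spec U d0.
rewrite -[integ phi](subrK (dyad N phi)) (le_trans (nrmD _ _)) //.
by rewrite lerD ?dyad_bound // nrmBC HN.
Qed.

Lemma dyad_ext n phi psi : (forall t, 0 <= t <= 1 -> phi t = psi t) ->
  dyad n phi = dyad n psi.
Proof.
elim: n phi psi => [|n IH] phi psi H /=; first by apply: H; rewrite lexx ler01.
by congr ((_ + _) / 2); apply: IH => t /half01[h1 h2]; apply: H.
Qed.

Lemma integ_ext phi psi : (forall t, 0 <= t <= 1 -> phi t = psi t) ->
  integ phi = integ psi.
Proof.
by move=> E; congr clim; apply/funext => n; apply: dyad_ext.
Qed.

Lemma unif_cont_id : unif_cont (fun t => t%:C).
Proof.
move=> e e0; exists e => // s t _ _ st; rewrite -CRN -CRD nrmR.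
exact: ltW.
Qed.

(** By self-similarity: halving the interval shows that the integral x satisfies x = (x / 2 + (1 / 2
    + x / 2)) / 2, which has the only solution 1 / 2. *)
Lemma integ_id : integ (fun t => t%:C) = 2^-1.
Proof.
have U := unif_cont_id.
have := integ_half U.
have -> : integ (lo (fun t => t%:C)) = 2^-1 * integ (fun t => t%:C).
  by rewrite -integZ //; congr integ; apply/funext => t; rewrite /lo CRM CRV CR_nat mulrC.
have -> : integ (hi (fun t => t%:C)) = 2^-1 + 2^-1 * integ (fun t => t%:C).
  rewrite -[X in X + _](integ_cst) -integZ // -integD; [|exact: unif_cont_cst|exact: unif_contZ].
  by congr integ; apply/funext => t; rewrite /hi CRM CRV CR_nat CRD CR1 mulrDl mul1r mulrC.
move: (integ _) => x Hx.
have n2 : (2 : C) != 0 by rewrite pnatr_eq0.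
have : 2 * x - 2 * ((2^-1 * x + (2^-1 + 2^-1 * x)) / 2) = 0 by rewrite -Hx subrr.
have -> : 2 * x - 2 * ((2^-1 * x + (2^-1 + 2^-1 * x)) / 2) = x - 2^-1 by field.
by move/eqP; rewrite subr_eq0 => /eqP.
Qed.

End DyadicIntegral.

(** * Complex differentiation and the exponential *)

Section Derivatives.
Variable R : realType.
Local Notation C := (Cplx R).
Implicit Types (z w a b l : C) (f g : C -> C).

(** With the denominator cleared the estimate also holds at h = 0, so that punctured neighbourhoods
    disappear from all later arguments. *)
Lemma is_derive_epsP (K : numFieldType) (f : K -> K) (z l : K) :
  is_derive z 1 f l <-> forall e : K, 0 < e ->
    \forall h \near (0 : K), `|f (z + h) - f z - l * h| <= e * `|h|.
Proof.
have key : is_derive z 1 f l <->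
    (fun h => h^-1 *: ((f \o shift z) (h *: (1 : K)) - f z)) @ 0^' --> l.
  split=> [[H1 <-]|H]; first exact: H1.
  by apply: DeriveDef; [apply/cvg_ex; exists l|apply/cvg_lim].
rewrite key; split.
  move=> /cvgrPdist_le H e e0; have := H _ e0.
  rewrite near_withinE; apply: filterS => h Hh.
  have [->|h0] := eqVneq h 0; first by rewrite addr0 mulr0 normr0 mulr0 subrr subr0 normr0.
  have := Hh h0; rewrite -(ler_pM2r (_ : 0 < `|h|)) ?normr_gt0 //; apply: le_trans.
  rewrite -normrM /= distrC mulrBl [_ *: (_ - _)]mulrC mulrVK ?unitfE //.
  by rewrite [_ *: 1]mulr1 [h + z]addrC.
move=> H; apply/cvgrPdist_le => e e0; have := H e e0.
rewrite near_withinE; apply: filterS => h Hh h0.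
rewrite -(ler_pM2r (_ : 0 < `|h|)) ?normr_gt0 //; apply: le_trans Hh.
rewrite -normrM /= distrC mulrBl [_ *: (_ - _)]mulrC mulrVK ?unitfE //.
by rewrite [_ *: 1]mulr1 [h + z]addrC.
Qed.

Lemma is_deriveCP f z l : is_derive z (1 : C) f l <-> forall e : R, 0 < e ->
  exists2 d : R, 0 < d & forall h : C, nrm h < d -> nrm (f (z + h) - f z - l * h) <= e * nrm h.
Proof.
rewrite is_derive_epsP; split=> H e e0.
  have e0' : 0 < (e%:C : C) by rewrite -CR0 ltCR.
  have [d d0 Hd] := (near0_nrmP (0 : C) _).1 (H _ e0'); exists d => // h /Hd.
  by rewrite add0r !normE -CRM leCR.
move: e0; rewrite ltcE => /andP[/eqP /= ei e0].
have [d d0 Hd] := H _ e0; apply: (near0_nrmP (0 : C) _).2; exists d => // h /Hd.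
rewrite add0r !normE -leCR CRM.
suff -> : (complex.Re e)%:C = e by [].
by case: e ei {e0 Hd} => x y /= ->.
Qed.

Lemma is_derive_realP (f : R -> R) (x l : R) : is_derive x (1 : R) f l -> forall e : R, 0 < e ->
  exists2 d : R, 0 < d & forall h, `|h| < d -> `|f (x + h) - f x - l * h| <= e * `|h|.
Proof.
move=> /is_derive_epsP H e e0; have /nbhs_ballP[d d0 Hd] := H e e0.
by exists d => // h Hh; apply: Hd; rewrite -ball_normE /= sub0r normrN.
Qed.

Lemma derivable_derive f z : derivable f z 1 -> is_derive z 1 f ('D_1 f z).
Proof. exact: derivableP. Qed.

Lemma is_derive_derivable f z l : is_derive z 1 f l -> derivable f z 1.
Proof. by case. Qed.

Lemma is_derive_val f z l : is_derive z 1 f l -> 'D_1 f z = l.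
Proof. by case. Qed.

Definition ctn f z := forall e : R, 0 < e ->
  exists2 d : R, 0 < d & forall h : C, nrm h < d -> nrm (f (z + h) - f z) <= e.

Lemma derivable_ctn f z : derivable f z 1 -> ctn f z.
Proof.
move=> /derivable_derive/is_deriveCP H e e0.
have [d d0 Hd] := H 1 ltr01.
set l := 'D_1 f z in Hd; have l0 : 0 < 1 + nrm l by rewrite ltr_pwDl ?nrm_ge0.
exists (Num.min d (e / (1 + nrm l))); first by rewrite lt_min d0 divr_gt0.
move=> h; rewrite lt_min ltr_pdivlMr // => /andP[/Hd h1 h2].
rewrite -[_ - _](subrK (l * h)) (le_trans (nrmD _ _)) // nrmM.
by apply: le_trans (ltW h2); rewrite mulrDr mulr1 [nrm h * _]mulrC lerD // -[nrm h]mul1r.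
Qed.

Lemma is_derive_compC f g z a b :
  is_derive z 1 g a -> is_derive (g z) 1 f b -> is_derive z 1 (fun x => f (g x)) (b * a).
Proof.
move=> Hg Hf; apply/is_deriveCP => e e0.
have cg : ctn g z by apply: derivable_ctn; apply: is_derive_derivable Hg.
move/is_deriveCP in Hg; move/is_deriveCP in Hf.
pose K := 1 + nrm a + nrm b.
have K1 : 1 <= K by rewrite /K -addrA lerDl addr_ge0 ?nrm_ge0.
have K0 : 0 < K by apply: lt_le_trans K1.
pose e1 := Num.min 1 (e / (2 * K)).
have e10 : 0 < e1 by rewrite lt_min ltr01 divr_gt0 // mulr_gt0.
have [d1 d10 H1] := Hf _ e10; have [d2 d20 H2] := Hg _ e10.
have d12 : 0 < d1 / 2 by rewrite divr_gt0.
have [d3 d30 H3] := cg _ d12.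
exists (Num.min d2 d3); first by rewrite lt_min d20.
move=> h; rewrite lt_min => /andP[h2 h3].
have G2 := H2 _ h2; have G3 := H3 _ h3.
have G1 : nrm (g (z + h) - g z) < d1 by apply: le_lt_trans G3 _; lra.
have {}G1 := H1 _ G1; rewrite [g z + _]addrC subrK in G1.
have -> : f (g (z + h)) - f (g z) - b * a * h =
  (f (g (z + h)) - f (g z) - b * (g (z + h) - g z)) + b * (g (z + h) - g z - a * h) by ring.
apply: le_trans (nrmD _ _) _; rewrite nrmM.
have G4 : nrm (g (z + h) - g z) <= K * nrm h.
  rewrite -[_ - _](subrK (a * h)) (le_trans (nrmD _ _)) // nrmM /K.
  have : e1 <= 1 by rewrite ge_min lexx.
  have := nrm_ge0 h; have := nrm_ge0 b; nra.
have Ke : e1 * (2 * K) <= e.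
  by rewrite -ler_pdivlMr ?mulr_gt0 // ge_min lexx orbT.
have bK : nrm b <= K by rewrite /K lerDr addr_ge0 ?nrm_ge0.
apply: (@le_trans _ _ (e1 * (K * nrm h) + K * (e1 * nrm h))).
  apply: lerD; first by apply: le_trans G1 _; rewrite ler_pM2l.
  by apply: ler_pM; rewrite ?nrm_ge0.
have -> : e1 * (K * nrm h) + K * (e1 * nrm h) = e1 * (2 * K) * nrm h by ring.
by rewrite ler_wpM2r ?nrm_ge0.
Qed.

Lemma is_deriveDC f g z a b : is_derive z 1 f a -> is_derive z 1 g b ->
  is_derive z 1 (fun x => f x + g x) (a + b).
Proof. by move=> Hf Hg; exact: (is_deriveD Hf Hg). Qed.

Lemma is_deriveBC f g z a b : is_derive z 1 f a -> is_derive z 1 g b ->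
  is_derive z 1 (fun x => f x - g x) (a - b).
Proof. by move=> Hf Hg; exact: (is_deriveB Hf Hg). Qed.

Lemma is_deriveMC f g z a b : is_derive z 1 f a -> is_derive z 1 g b ->
  is_derive z 1 (fun x => f x * g x) (a * g z + f z * b).
Proof.
move=> Hf Hg; apply: is_derive_eq (is_deriveM Hf Hg) _.
by rewrite /GRing.scale /= addrC [g z * a]mulrC.
Qed.

Lemma is_derive_cstC (c z : C) : is_derive z 1 (fun=> c) 0.
Proof. exact: is_derive_cst. Qed.

Lemma is_derive_idC z : is_derive z 1 (fun x : C => x) 1.
Proof. exact: is_derive_id. Qed.

Lemma is_derive_invC f z a : f z != 0 -> is_derive z 1 f a ->
  is_derive z 1 (fun x => (f x)^-1) (- a / f z ^+ 2).
Proof.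
move=> f0 [Hf Ha]; apply: DeriveDef; first exact: derivableV.
by rewrite deriveV // Ha /GRing.scale /=; field.
Qed.

Lemma is_derive_divC f g z a b : g z != 0 -> is_derive z 1 f a -> is_derive z 1 g b ->
  is_derive z 1 (fun x => f x / g x) ((a * g z - f z * b) / g z ^+ 2).
Proof.
move=> g0 Hf /(is_derive_invC g0) Hg.
by apply: is_derive_eq (is_deriveMC Hf Hg) _; field.
Qed.

Lemma derivableBC f g z : derivable f z 1 -> derivable g z 1 ->
  derivable (fun x => f x - g x) z 1.
Proof.
by move=> /derivable_derive Hf /derivable_derive Hg; exact: is_derive_derivable (is_deriveBC Hf Hg).
Qed.

Lemma derivableMC f g z : derivable f z 1 -> derivable g z 1 ->
  derivable (fun x => f x * g x) z 1.
Proof.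
by move=> /derivable_derive Hf /derivable_derive Hg; exact: is_derive_derivable (is_deriveMC Hf Hg).
Qed.

Lemma derivable_divC f g z : g z != 0 -> derivable f z 1 -> derivable g z 1 ->
  derivable (fun x => f x / g x) z 1.
Proof.
move=> g0 /derivable_derive Hf /derivable_derive Hg.
exact: is_derive_derivable (is_derive_divC g0 Hf Hg).
Qed.

Lemma derivable_cstC (c z : C) : derivable (fun=> c) z 1.
Proof. exact: is_derive_derivable (is_derive_cstC c z). Qed.

Lemma derivable_subC (c z : C) : derivable (fun x => x - c) z 1.
Proof. exact: is_derive_derivable (is_deriveBC (is_derive_idC z) (is_derive_cstC c z)). Qed.

Lemma derivable_difference_quotient f (c a z : C) : z != a -> derivable f z 1 ->
  derivable (fun x => (f x - c) / (x - a)) z 1.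
Proof.
rewrite -subr_eq0 => za Hf.
exact: (@derivable_divC (fun x => f x - c) (fun x => x - a) z za
  (derivableBC Hf (@derivable_cstC c z)) (@derivable_subC a z)).
Qed.

Lemma derivable_near f g z : (\forall w \near z, f w = g w) -> derivable f z 1 -> derivable g z 1.
Proof. by move=> H; apply: near_eq_derivable. Qed.

Lemma is_derive_affine (c d z : C) : is_derive z 1 (fun x : C => c * x + d) c.
Proof.
apply/is_deriveCP => e e0; exists 1 => // h _.
have -> : c * (z + h) + d - (c * z + d) - c * h = 0 by ring.
by rewrite nrm0 mulr_ge0 ?nrm_ge0 // ltW.
Qed.

End Derivatives.

Section ComplexExp.
Variable R : realType.
Local Notation C := (Cplx R).
Implicit Types z w : C.

Definition cexp z : C :=
  Complex (expR (complex.Re z) * cos (complex.Im z)) (expR (complex.Re z) * sin (complex.Im z)).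

Lemma cexpD z w : cexp (z + w) = cexp z * cexp w.
Proof.
case: z => x y; case: w => u v; rewrite /cexp /= expRD sinD cosD.
by apply/eqP; rewrite eq_complex /=; apply/andP; split; apply/eqP; ring.
Qed.

Lemma cexp0 : cexp 0 = 1.
Proof. by rewrite /cexp /= expR0 cos0 sin0 mulr1 mulr0. Qed.

Lemma cexp_neq0 z : cexp z != 0.
Proof.
apply/eqP => H; have : cexp (z - z) = 0 by rewrite cexpD H mul0r.
by rewrite subrr cexp0 => /eqP; rewrite oner_eq0.
Qed.

Lemma cexpN z : cexp (- z) = (cexp z)^-1.
Proof.
apply: (mulfI (cexp_neq0 z)).
by rewrite -cexpD subrr cexp0 divff // cexp_neq0.
Qed.

Lemma cexpMn z n : cexp (n%:R * z) = cexp z ^+ n.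
Proof.
elim: n => [|n IH]; first by rewrite mul0r cexp0.
by rewrite exprS -IH -cexpD -natr1 mulrDl mul1r addrC.
Qed.

Lemma nrm_cexp z : nrm (cexp z) = expR (complex.Re z).
Proof.
apply/eqP; rewrite -(@eqrXn2 _ 2) ?nrm_ge0 ?expR_ge0 // nrm_sqr /=.
by rewrite !exprMn -mulrDr cos2Dsin2 mulr1.
Qed.

Lemma cexp_2pi : cexp (Complex 0 (2 * pi)) = 1.
Proof.
rewrite /cexp /= expR0 !mul1r; have -> : 2 * pi = pi *+ 2 :> R by rewrite mulr_natl.
by rewrite cos2pi sin2pi.
Qed.

Lemma is_derive_cexp0 : is_derive (0 : C) 1 cexp 1.
Proof.
apply/is_deriveCP => e e0.
(* The nine is 1 + 3 + 2 + 3: the multiples of [e1 * N] that bound the real part (the first two) and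
   the imaginary part (the last two) of the remainder. *)
pose e1 := Num.min 1 (e / 9).
have e10 : 0 < e1 by rewrite lt_min ltr01 divr_gt0.
have e11 : e1 <= 1 by rewrite ge_min lexx.
have e18 : 9 * e1 <= e by rewrite mulrC -ler_pdivlMr // ge_min lexx orbT.
clearbody e1.
have [d1 d10 H1] := is_derive_realP (is_derive_expR (0 : R)) e10.
have [d2 d20 H2] := is_derive_realP (is_derive_cos (0 : R)) e10.
have [d3 d30 H3] := is_derive_realP (is_derive_sin (0 : R)) e10.
exists (Num.min e1 (Num.min d1 (Num.min d2 d3))); first by rewrite !lt_min e10 d10 d20.
move=> h; rewrite !lt_min => /andP[he /andP[h1 /andP[h2 h3]]].
have hr := nrm_Re h; have hi := nrm_Im h.
have {}H1 := H1 _ (le_lt_trans hr h1).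
have {}H2 := H2 _ (le_lt_trans hi h2).
have {}H3 := H3 _ (le_lt_trans hi h3).
move: H1 H2 H3; rewrite !add0r expR0 cos0 sin0 mul1r oppr0 mul0r !subr0 ?addr0 mul1r => H1 H2 H3.
rewrite mul1r cexp0.
apply: le_trans (nrm_ReIm _) _.
move: hr hi H1 H2 H3 he; move: (nrm h) => N; case: h {h1 h2 h3} => x y /= hr hi.
have E : (expR x : R) = 1 + x + (expR x - 1 - x) by ring.
set A := expR x - 1 - x in E *; set B := cos y - 1; set D := sin y - y => H1 H2 H3 he.
have Ec : cos y = 1 + B by rewrite /B; ring.
have Es : sin y = y + D by rewrite /D; ring.
rewrite E Ec Es.
have -> : (1 + x + A) * (1 + B) - 1 - x = A + (1 + x + A) * B by ring.
have -> : (1 + x + A) * (y + D) - 0 - y = (x + A) * y + (1 + x + A) * D by ring.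
have N0 : 0 <= N by apply: le_trans hr.
have A1 : `|A| <= e1 * N by apply: le_trans H1 _; rewrite ler_pM2l.
have B1 : `|B| <= e1 * N by apply: le_trans H2 _; rewrite ler_pM2l.
have D1 : `|D| <= e1 * N by apply: le_trans H3 _; rewrite ler_pM2l.
have M1 : `|1 + x + A| <= 3.
  apply: le_trans (ler_normD _ _) _; have := ler_normD 1 x; rewrite normr1.
  nra.
have M2 : `|x + A| <= 2 * e1.
  apply: le_trans (ler_normD _ _) _; nra.
apply: (@le_trans _ _ (e1 * N + 3 * (e1 * N) + (2 * e1 * N + 3 * (e1 * N)))).
  apply: lerD; apply: le_trans (ler_normD _ _) _; rewrite !normrM.
    by apply: lerD => //; apply: ler_pM.
  by apply: lerD; apply: ler_pM.
have -> : e1 * N + 3 * (e1 * N) + (2 * e1 * N + 3 * (e1 * N)) = 9 * e1 * N by ring.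
by rewrite ler_wpM2r //; lra.
Qed.

Lemma is_derive_cexp z : is_derive z 1 cexp (cexp z).
Proof.
apply/is_deriveCP => e e0.
have E0 : 0 < nrm (cexp z) by rewrite nrm_gt0 cexp_neq0.
have [d d0 Hd] := (is_deriveCP _ _ _).1 is_derive_cexp0 _ (divr_gt0 e0 E0).
exists d => // h /Hd; rewrite add0r cexp0 mul1r cexpD.
have -> : cexp z * cexp h - cexp z - cexp z * h = cexp z * (cexp h - 1 - h) by ring.
by rewrite nrmM -(ler_pM2l E0) mulrA mulrCA divff ?gt_eqF // mulr1.
Qed.

End ComplexExp.

(** * Goursat's theorem *)

Section Goursat.
Variable R : realType.
Local Notation C := (Cplx R).
Implicit Types (z w a u l : C) (f g : C -> C).

Lemma ptw_cont_comp f (gam : R -> C) : ptw_cont gam ->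
  (forall t, 0 <= t <= 1 -> ctn f (gam t)) -> unif_cont (fun t => f (gam t)).
Proof.
move=> Hg Hf; apply: heine_cantor => s s01 e e0.
have [d d0 Hd] := Hf _ s01 _ e0.
have d20 : 0 < d / 2 by rewrite divr_gt0.
have [d' d'0 Hd'] := Hg _ s01 _ d20; exists d' => // t t01 ts.
have := Hd (gam t - gam s); rewrite [gam s + _]addrC subrK; apply.
by apply: le_lt_trans (Hd' _ t01 ts) _; lra.
Qed.

Lemma ptw_cont_line a u : ptw_cont (fun t => a + t%:C * u).
Proof.
move=> s s01 e e0; have u0 : 0 < nrm u + 1 by rewrite ltr_wpDl ?nrm_ge0.
exists (e / (nrm u + 1)) => [|t t01]; first by rewrite divr_gt0.
rewrite ltr_pdivlMr // => H.
have -> : a + t%:C * u - (a + s%:C * u) = (t - s)%:C * u by rewrite CRD CRN; ring.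
rewrite nrmM nrmR; apply: le_trans (ltW H).
by rewrite ler_wpM2l // lerDl.
Qed.

Lemma unif_cont_line f a u : (forall t, 0 <= t <= 1 -> ctn f (a + t%:C * u)) ->
  unif_cont (fun t => f (a + t%:C * u)).
Proof. exact/ptw_cont_comp/ptw_cont_line. Qed.

(* The integral of [f] along the segment from [a] to [a + u]. *)
Definition seg f a u : C := u * integ (fun t => f (a + t%:C * u)).

Lemma seg_half f a u : (forall t, 0 <= t <= 1 -> ctn f (a + t%:C * u)) ->
  seg f a u = seg f a (u / 2) + seg f (a + u / 2) (u / 2).
Proof.
move=> /unif_cont_line U; rewrite /seg integ_half // -mulrDr [u / 2 * _]mulrAC -mulrA.
congr (_ * ((_ + _) / 2)); congr integ; apply/funext => t; rewrite /lo /hi; congr f.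
  by rewrite CRM CRV CR_nat; ring.
by rewrite CRM CRV CR_nat CRD CR1; ring.
Qed.

Lemma segB f g a u : (forall t, 0 <= t <= 1 -> ctn f (a + t%:C * u)) ->
  (forall t, 0 <= t <= 1 -> ctn g (a + t%:C * u)) ->
  seg (fun z => f z - g z) a u = seg f a u - seg g a u.
Proof. by move=> /unif_cont_line U1 /unif_cont_line U2; rewrite /seg integB // mulrBr. Qed.

Lemma seg_affine (p l a u : C) : seg (fun z => p + l * z) a u = u * (p + l * (a + u / 2)).
Proof.
rewrite /seg; congr (_ * _).
have -> : (fun t : R => p + l * (a + t%:C * u)) = (fun t => (p + l * a) + l * u * t%:C).
  by apply/funext => t; ring.
rewrite integD ?integZ ?integ_id ?integ_cst; first by field.
- exact: unif_cont_id.
- exact: unif_cont_cst.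
- exact/unif_contZ/unif_cont_id.
Qed.

Lemma seg_bound f a u e : (forall t, 0 <= t <= 1 -> ctn f (a + t%:C * u)) ->
  (forall t, 0 <= t <= 1 -> nrm (f (a + t%:C * u)) <= e) -> nrm (seg f a u) <= nrm u * e.
Proof.
move=> /unif_cont_line U H; rewrite /seg nrmM ler_wpM2l ?nrm_ge0 //.
exact: integ_bound.
Qed.

Definition tri f a u w : C := seg f a u + seg f (a + u) w - seg f a (u + w).

Definition cvx (D : set C) := forall a u (t : R), D a -> D (a + u) -> 0 <= t <= 1 -> D (a + t%:C * u).

Lemma cvx_half D a u : cvx D -> D a -> D (a + u) -> D (a + u / 2).
Proof.
move=> cD Da Du; have -> : u / 2 = (2^-1 : R)%:C * u by rewrite CRV CR_nat mulrC.
by apply: cD => //; apply/andP; split; lra.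
Qed.

(* The inner triangle is written with its two edges exchanged, hence with the
   opposite orientation. *)
Lemma tri_split (D : set C) f a u w : cvx D -> (forall z, D z -> ctn f z) ->
  D a -> D (a + u) -> D (a + u + w) ->
  tri f a u w = tri f a (u / 2) (w / 2) + tri f (a + u / 2) (u / 2) (w / 2)
    + tri f (a + (u + w) / 2) (u / 2) (w / 2) - tri f (a + u / 2) (w / 2) (u / 2).
Proof.
move=> cD fD Da Du Dw; rewrite /tri.
have D1 x y t : D x -> D (x + y) -> 0 <= t <= 1 -> ctn f (x + t%:C * y).
  by move=> *; apply/fD/cD.
rewrite (seg_half (fun t => D1 a u t Da Du)) (seg_half (fun t => D1 (a + u) w t Du Dw)).
have Dw' : D (a + (u + w)) by rewrite addrA.
rewrite (seg_half (fun t => D1 a (u + w) t Da Dw')).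
have -> : a + u / 2 + u / 2 = a + u by field.
have -> : a + (u + w) / 2 + u / 2 = a + u + w / 2 by field.
have -> : a + u / 2 + w / 2 = a + (u + w) / 2 by field.
have -> : w / 2 + u / 2 = (u + w) / 2 by field.
have -> : u / 2 + w / 2 = (u + w) / 2 by field.
ring.
Qed.

Definition lim_closed (D : set C) :=
  forall c, (forall e : R, 0 < e -> exists2 z, D z & nrm (z - c) <= e) -> D c.

Section GoursatProof.
Variables (D : set C) (f : C -> C).
Hypotheses (cD : cvx D) (lD : lim_closed D) (fD : forall z, D z -> derivable f z 1).

Let goodt (x : C * C * C) := [/\ D x.1.1, D (x.1.1 + x.1.2) & D (x.1.1 + x.1.2 + x.2)].
Let trit (x : C * C * C) := tri f x.1.1 x.1.2 x.2.
Let siz (x : C * C * C) := nrm x.1.2 + nrm x.2.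

Let fctn z : D z -> ctn f z. Proof. by move=> /fD/derivable_ctn. Qed.

(** One of the four half-size triangles carries at least a quarter of the integral. The implication
    stands under the existential so that [choice] yields a total refinement map; a triple outside
    [goodt] is sent to the dummy 0. *)
Let goursat_step (x : C * C * C) : exists y, goodt x ->
  [/\ goodt y, siz y = siz x / 2, nrm (trit x) <= 4 * nrm (trit y) &
      nrm (y.1.1 - x.1.1) <= siz x].
Proof.
case: x => [[a u] w]; have [[/= Da Du Dw]|] := pselect (goodt (a, u, w)); last by exists 0.
have Dm1 : D (a + u / 2) by exact: cvx_half.
have Dm2 : D (a + u + w / 2) by exact: cvx_half.
have Dm3 : D (a + (u + w) / 2) by apply: cvx_half => //; rewrite addrA.
have E1 : a + u / 2 + u / 2 = a + u by field.
have E2 : a + (u + w) / 2 + u / 2 = a + u + w / 2 by field.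
have E3 : a + u / 2 + w / 2 = a + (u + w) / 2 by field.
have E4 : a + u + w / 2 + w / 2 = a + u + w by field.
have h2 z : nrm (z / 2) = nrm z / 2 :> R by rewrite nrmM nrmV nrm_nat.
have S := tri_split cD fctn Da Du Dw.
have u0 := nrm_ge0 u; have w0 := nrm_ge0 w.
have n1 : nrm (a - a) <= nrm u + nrm w by rewrite subrr nrm0 addr_ge0.
have n2 : nrm (a + u / 2 - a) <= nrm u + nrm w by rewrite addrC addKr h2; lra.
have n3 : nrm (a + (u + w) / 2 - a) <= nrm u + nrm w.
  by rewrite addrC addKr h2; have := nrmD u w; lra.
set T1 := tri f a (u / 2) _ in S; set T2 := tri f (a + u / 2) (u / 2) _ in S.
set T3 := tri f (a + (u + w) / 2) _ _ in S; set T4 := tri f _ (w / 2) _ in S.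
have HT : nrm (trit (a, u, w)) <= nrm T1 + nrm T2 + nrm T3 + nrm T4.
  rewrite /trit /= S; apply: le_trans (nrmB _ _) _; rewrite lerD2r.
  by apply: le_trans (nrmD _ _) _; rewrite lerD2r nrmD.
have [c1|c1] := leP (nrm (trit (a, u, w))) (4 * nrm T1).
  exists (a, u / 2, w / 2) => _; split=> //.
    by split=> //=; rewrite E3.
  by rewrite /siz /= !h2 mulrDl.
have [c2|c2] := leP (nrm (trit (a, u, w))) (4 * nrm T2).
  exists (a + u / 2, u / 2, w / 2) => _; split=> //.
    by split=> //=; rewrite E1.
  by rewrite /siz /= !h2 mulrDl.
have [c3|c3] := leP (nrm (trit (a, u, w))) (4 * nrm T3).
  exists (a + (u + w) / 2, u / 2, w / 2) => _; split=> //.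
    by split=> //=; rewrite E2 ?E4.
  by rewrite /siz /= !h2 mulrDl.
exists (a + u / 2, w / 2, u / 2) => _; split=> //.
- by split=> //=; rewrite E3 ?E2.
- by rewrite /siz /= !h2 mulrDl addrC.
- by rewrite -[trit (_, w / 2, _)]/T4; lra.
Qed.

Lemma goursat a u w : D a -> D (a + u) -> D (a + u + w) -> tri f a u w = 0.
Proof.
move=> Da Du Dw; have [nx Hnx] := choice goursat_step.
pose x n := iter n nx (a, u, w).
have gx n : goodt (x n) by elim: n => [|n /Hnx[]].
pose m := siz (a, u, w).
have m0 : 0 <= m by rewrite addr_ge0 ?nrm_ge0.
have sx n : siz (x n) = m * 2 ^- n.
  elim: n => [|n IH]; first by rewrite expr0 invr1 mulr1.
  by have [_ -> _ _] := Hnx _ (gx n); rewrite IH -mulrA exprSr invfM.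
have tx n : nrm (tri f a u w) <= 4 ^+ n * nrm (trit (x n)).
  elim: n => [|n IH]; first by rewrite expr0 mul1r.
  apply: le_trans IH _; have [_ _ H _] := Hnx _ (gx n).
  by rewrite exprSr -mulrA ler_wpM2l // exprn_ge0.
(* The bound is the exact partial sum of the geometric series of displacements, which lets the
   induction on [k] close; only its first term is kept afterwards. *)
have ax n k : nrm ((x (n + k)%N).1.1 - (x n).1.1) <= 2 * (m * 2 ^- n) - m * 2 ^- (n + k) * 2.
  elim: k => [|k IH]; first by rewrite addn0 subrr nrm0 mulrC subrr.
  apply: le_trans (nrm_triangle _ (x (n + k)%N).1.1 _) _.
  rewrite addnS; have [_ _ _] := Hnx _ (gx (n + k)%N).
  rewrite sx exprSr invfM -[nx _]/(x (n + k).+1) => H.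
  have -> : m * (2 ^- (n + k) / 2) * 2 = m * 2 ^- (n + k) by rewrite -!mulrA mulVf ?mulr1.
  move: (m * 2 ^- (n + k)) H IH => q H IH; lra.
have ax' n k : (n <= k)%N -> nrm ((x k).1.1 - (x n).1.1) <= 2 * (m * 2 ^- n).
  move=> /subnKC <-; apply: le_trans (ax _ _) _.
  by rewrite gerDl oppr_le0 !mulr_ge0 // invr_ge0 exprn_ge0.
have small e : 0 < e -> exists N, forall n, (N <= n)%N -> 2 * (m * 2 ^- n) <= e.
  move=> e0; have m1 : 0 < 2 * (m + 1) by rewrite mulr_gt0 // ltr_wpDl.
  have [N HN] := exp2_small (divr_gt0 e0 m1); exists N => n /HN.
  rewrite ltr_pdivlMr // => H.
  apply: le_trans (ltW H); rewrite mulrA mulrC ler_wpM2l ?invr_ge0 ?exprn_ge0 //.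
  by rewrite ler_pM2l // lerDl.
have lim_x : forall e, 0 < e -> exists N, forall n, (N <= n)%N ->
    nrm ((x n).1.1 - clim (fun n => (x n).1.1)) <= e.
  apply: clim_spec => e e0; have e20 : 0 < e / 2 by rewrite divr_gt0.
  have [N HN] := small _ e20; exists N => n k Nn Nk.
  apply: le_trans (nrm_triangle _ (x N).1.1 _) _.
  rewrite [e]splitr lerD // ?[nrm (_ - (x k).1.1)]nrmBC.
    by apply: le_trans (ax' _ _ Nn) (HN _ _).
  by apply: le_trans (ax' _ _ Nk) (HN _ _).
set c := clim _ in lim_x.
have ac n : nrm ((x n).1.1 - c) <= 2 * (m * 2 ^- n).
  apply/ler_addgt0Pl => e e0; have [N HN] := lim_x _ e0.
  apply: le_trans (nrm_triangle _ (x (maxn n N)).1.1 _) _.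
  by rewrite addrC lerD ?HN ?leq_maxr // nrmBC ax' // leq_maxl.
have Dc : D c.
  apply: lD => e e0; have [N HN] := lim_x _ e0; exists (x N).1.1; last exact: HN.
  by have [] := gx N.
(* In the N-th triangle [f] is replaced by its affine approximation [h] at [c], which integrates to
   0. With q = m / 2^N every point of the sides is within 3 q of [c] and the sides have total length
   at most 2 q, so the remainder contributes at most 6 e q^2; the factor 4^N turns q^2 into m^2. *)
have H e : 0 < e -> nrm (tri f a u w) <= 6 * e * m ^+ 2.
  move=> e0; have [d d0 Hd] := (is_deriveCP _ _ _).1 (derivable_derive (fD Dc)) _ e0.
  have d20 : 0 < d / 2 by rewrite divr_gt0.
  have [N HN] := small _ d20; have {}HN := HN N (leqnn _).
  set l := 'D_1 f c in Hd; pose h z := (f c - l * c) + l * z.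
  apply: le_trans (tx N) _.
  have [] := gx N; have := ac N; have := sx N; rewrite /trit /siz.
  case: (x N) => -[a' u'] w' /= Es An Da' Du' Dw'.
  set q := m * 2 ^- N in Es An HN.
  have u'0 := nrm_ge0 u'; have w'0 := nrm_ge0 w'.
  have q0 : 0 <= q by rewrite -Es addr_ge0.
  have hc z : ctn h z.
    apply: derivable_ctn; apply: (@is_derive_derivable _ _ _ l).
    have -> : h = (fun z => l * z + (f c - l * c)) by apply/funext => ?; rewrite /h addrC.
    exact: is_derive_affine.
  have key z y t : D z -> D (z + y) -> 0 <= t <= 1 -> ctn f (z + t%:C * y).
    by move=> *; apply/fctn/cD.
  have rc z y : D z -> D (z + y) -> forall t : R, 0 <= t <= 1 ->
      ctn (fun x => f x - h x) (z + t%:C * y).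
    move=> Dz Dy t t01 e' e'0; have e'20 : 0 < e' / 2 by rewrite divr_gt0.
    have [d1 d10 H1] := key _ _ _ Dz Dy t01 _ e'20.
    have [d2 d20' H2] := hc (z + t%:C * y) _ e'20.
    exists (Num.min d1 d2); first by rewrite lt_min d10.
    move=> k; rewrite lt_min => /andP[/H1 k1 /H2 k2].
    have -> : forall p q r s : C, p - q - (r - s) = (p - r) - (q - s) by move=> *; ring.
    by rewrite (le_trans (nrmB _ _)) // [e']splitr lerD.
  have bnd z y : D z -> D (z + y) -> nrm (z - c) <= 2 * q + nrm u' -> nrm y <= nrm u' + nrm w' ->
      nrm (z - c) + nrm y <= 3 * q ->
      nrm (seg f z y - seg h z y) <= nrm y * (e * (3 * q)).
    move=> Dz Dy _ _ Hzy; rewrite -segB; [|by move=> t; apply: key|by move=> t _; apply: hc].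
    apply: seg_bound; first exact: rc.
    move=> t t01; set zt := z + _.
    have Hzt : nrm (zt - c) <= 3 * q.
      have -> : zt - c = z - c + t%:C * y by rewrite /zt; ring.
      apply: le_trans (nrmD _ _) _; apply: le_trans Hzy.
      rewrite lerD2l nrmM nrmR; case/andP: t01 => t0 t1.
      by rewrite ger0_norm // ler_piMl ?nrm_ge0.
    have := Hd (zt - c); rewrite [c + _]addrC subrK => Hd'.
    have -> : f zt - h zt = f zt - f c - l * (zt - c) by rewrite /h; ring.
    apply: le_trans (Hd' _) _; last by rewrite ler_pM2l.
    by apply: le_lt_trans Hzt _; lra.
  have tri_h : tri h a' u' w' = 0 by rewrite /tri !seg_affine; field.
  have -> : tri f a' u' w' = (seg f a' u' - seg h a' u') + (seg f (a' + u') w' - seg h (a' + u') w')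
      - (seg f a' (u' + w') - seg h a' (u' + w')).
    by rewrite -[LHS]subr0 -tri_h /tri; ring.
  have uw := nrmD u' w'.
  have au : nrm (a' + u' - c) <= nrm (a' - c) + nrm u'.
    by rewrite addrAC nrmD.
  apply: le_trans (_ : 4 ^+ N * (6 * e * q ^+ 2) <= _); last first.
    have E4 : 4 ^+ N * (2 ^- N) ^+ 2 = 1 :> R.
      by rewrite -exprVn -exprM mulnC exprM -exprMn (_ : 4 * 2^-1 ^+ 2 = 1) ?expr1n //; field.
    have -> : 4 ^+ N * (6 * e * q ^+ 2) = 6 * e * m ^+ 2 * (4 ^+ N * (2 ^- N) ^+ 2).
      by rewrite /q; ring.
    by rewrite E4 mulr1.
  rewrite ler_wpM2l ?exprn_ge0 //.
  have b1 := bnd a' u' Da' Du'; have b2 := bnd (a' + u') w' Du' Dw'.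
  have b3 := bnd a' (u' + w') Da'; rewrite addrA in b3; have {}b3 := b3 Dw'.
  apply: le_trans (nrmB _ _) _.
  apply: (@le_trans _ _ ((nrm u' * (e * (3 * q)) + nrm w' * (e * (3 * q)))
     + nrm (u' + w') * (e * (3 * q)))).
    apply: lerD; last by apply: b3; lra.
    by apply: le_trans (nrmD _ _) _; apply: lerD; [apply: b1|apply: b2]; lra.
  rewrite -!mulrDl.
  have -> : 6 * e * q ^+ 2 = (2 * q) * (e * (3 * q)) by ring.
  by rewrite ler_wpM2r ?mulr_ge0 // ?(ltW e0) //; lra.
apply: nrm_le_eps => e e0.
have m1 : 0 < 6 * (m ^+ 2 + 1) by rewrite mulr_gt0 // ltr_wpDl // sqr_ge0.
apply: le_trans (H _ (divr_gt0 e0 m1)) _.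
rewrite mulrAC mulrA ler_pdivrMr // [e * _]mulrC ler_wpM2r ?(ltW e0) //.
by rewrite ler_pM2l // lerDl.
Qed.

End GoursatProof.

(** A complex-valued function has no intermediate point realising the increment. Instead, the bound
    with constant [K + e1] holds on short subsegments by differentiability, is additive over
    adjacent ones, and is globalised by [cousin]; [e1] is chosen so that the total excess is at most
    [e]. *)
Lemma mean_value_ineq f a u K :
  (forall t : R, 0 <= t <= 1 -> exists2 l, is_derive (a + t%:C * u) 1 f l & nrm l <= K) ->
  nrm (f (a + u) - f a) <= K * nrm u.
Proof.
move=> Hf; apply/ler_addgt0Pl => e e0.
have u1 : 0 < nrm u + 1 by rewrite ltr_wpDl ?nrm_ge0.
pose e1 := e / (nrm u + 1); have e10 : 0 < e1 by rewrite divr_gt0.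
have K0 : 0 <= K.
  have [|l _] := Hf 0; first by rewrite lexx ler01.
  exact: le_trans (nrm_ge0 _).
pose P s t := nrm (f (a + t%:C * u) - f (a + s%:C * u)) <= (K + e1) * ((t - s) * nrm u).
suff : P 0 1.
  rewrite /P CR0 CR1 mul0r addr0 mul1r subr0 mul1r => /le_trans; apply.
  rewrite mulrDl addrC lerD2r /e1 mulrAC ler_pdivrMr // ler_wpM2l ?(ltW e0) //.
  by rewrite lerDl.
apply: (@cousin _ P) => [s m t _ P1 P2|c c01].
  rewrite /P; apply: le_trans (nrm_triangle _ (f (a + m%:C * u)) _) _.
  have -> : (t - s) * nrm u = (t - m) * nrm u + (m - s) * nrm u by ring.
  by rewrite mulrDr lerD.
have [l /is_deriveCP Hl lK] := Hf _ c01; have [d d0 Hd] := Hl _ e10.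
have loc x : `|x - c| * (nrm u + 1) < d ->
    nrm (f (a + x%:C * u) - f (a + c%:C * u)) <= (K + e1) * (`|x - c| * nrm u).
  move=> Hx.
  have E : nrm ((x - c)%:C * u) = `|x - c| * nrm u by rewrite nrmM nrmR.
  have := Hd ((x - c)%:C * u).
  have -> : a + c%:C * u + (x - c)%:C * u = a + x%:C * u by rewrite CRD CRN; ring.
  rewrite E; have L : `|x - c| * nrm u < d.
    by apply: le_lt_trans Hx; rewrite ler_wpM2l // lerDl.
  move=> /(_ L) H.
  rewrite -[X in nrm X](subrK (l * ((x - c)%:C * u))); apply: le_trans (nrmD _ _) _.
  rewrite mulrDl addrC lerD // nrmM E.
  by rewrite ler_wpM2r // mulr_ge0 // nrm_ge0.
exists (d / (nrm u + 1)); first by rewrite divr_gt0.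
move=> s t /andP[_ sc] /andP[ct _]; rewrite ltr_pdivlMr // => st.
rewrite /P; apply: le_trans (nrm_triangle _ (f (a + c%:C * u)) _) _.
have -> : (t - s) * nrm u = (t - c) * nrm u + (c - s) * nrm u by ring.
have tc : `|t - c| = t - c by rewrite ger0_norm // subr_ge0.
have cs : `|s - c| = c - s by rewrite distrC ger0_norm // subr_ge0.
rewrite mulrDr lerD //.
  by rewrite -tc; apply: loc; rewrite tc; nra.
by rewrite nrmBC -cs; apply: loc; rewrite cs; nra.
Qed.

End Goursat.

(** * Circle means and Cauchy estimates *)

Section Continuity.
Variable R : realType.
Local Notation C := (Cplx R).
Implicit Types (z c : C) (f g : C -> C).

Lemma continuous_epsP (K : numFieldType) (f : K -> K) (z : K) :
  {for z, continuous f} <-> forall e : K, 0 < e -> \forall w \near z, `|f z - f w| <= e.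
Proof.
split=> [/cvgrPdist_le H|H]; first exact: H.
suff : f @ z --> f z by [].
by apply: (iffRL (@cvgrPdist_le _ _ _ _ (nbhs_filter z) _ _)) => e e0; exact: H.
Qed.

Lemma ctnP f z : ctn f z <-> {for z, continuous f}.
Proof.
rewrite continuous_epsP; split=> H e.
  rewrite ltcE => /andP[/eqP /= ei e0].
  have [d d0 Hd] := H _ e0; apply: (near0_nrmP (z : C) _).2; exists d => // h /Hd.
  rewrite distrC normE -leCR.
  suff -> : (complex.Re e)%:C = e by [].
  by case: e ei {e0 Hd} => x y /= ->.
move=> e0; have e0' : 0 < (e%:C : C) by rewrite -CR0 ltCR.
have [d d0 Hd] := (near0_nrmP (z : C) _).1 (H _ e0').
by exists d => // h /Hd; rewrite distrC normE leCR.
Qed.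

Lemma ctn_cst c z : ctn (fun=> c) z.
Proof. by move=> e e0; exists 1 => // h _; rewrite subrr nrm0 ltW. Qed.

Lemma ctn_id z : ctn (fun x : C => x) z.
Proof. by move=> e e0; exists e => // h /ltW; rewrite addrC addKr. Qed.

Lemma ctnB f g z : ctn f z -> ctn g z -> ctn (fun x => f x - g x) z.
Proof. by move=> /ctnP Hf /ctnP Hg; apply/ctnP; apply: (cvgB Hf Hg). Qed.

Lemma ctnM f g z : ctn f z -> ctn g z -> ctn (fun x => f x * g x) z.
Proof. by move=> /ctnP Hf /ctnP Hg; apply/ctnP; apply: (cvgM Hf Hg). Qed.

Lemma ctn_div f g z : g z != 0 -> ctn f z -> ctn g z -> ctn (fun x => f x / g x) z.
Proof. by move=> g0 /ctnP Hf /ctnP Hg; apply/ctnP; apply: (cvgM Hf (cvgV g0 Hg)). Qed.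

End Continuity.

Section CircleMean.
Variable R : realType.
Local Notation C := (Cplx R).
Implicit Types (z w a h k : C) (f g : C -> C) (r t : R).

Definition twopii : C := Complex 0 (2 * pi).

Definition unitc t : C := cexp (t%:C * twopii).

Lemma nrm_unitc t : nrm (unitc t) = 1.
Proof. by rewrite nrm_cexp /= mulr0 mul0r subrr expR0. Qed.

Lemma cexp_twopii : cexp twopii = 1.
Proof. exact: cexp_2pi. Qed.

Lemma twopii_neq0 : twopii != 0.
Proof. by rewrite eq_complex /= eqxx /= mulf_neq0 // gt_eqF // pi_gt0. Qed.

Definition circ a r t : C := a + r%:C * unitc t.

Lemma nrm_circ a r t : 0 <= r -> nrm (circ a r t - a) = r.
Proof. by move=> r0; rewrite addrC addKr nrmM nrmR nrm_unitc mulr1 ger0_norm. Qed.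

Lemma ptw_cont_circ a r : ptw_cont (circ a r).
Proof.
move=> s s01 e e0.
have r1 : 0 < `|r| + 1 by rewrite ltr_wpDl.
have : unif_cont unitc.
  apply: (@ptw_cont_comp _ (@cexp R) (fun t => t%:C * twopii)) => [|t _].
    have := ptw_cont_line 0 twopii; congr ptw_cont.
    by apply/funext => t; rewrite add0r.
  by apply: derivable_ctn; apply: is_derive_derivable (is_derive_cexp _).
move=> /(_ _ (divr_gt0 e0 r1))[d d0 Hd]; exists d => // t t01 /(Hd _ _ t01 s01) H.
have -> : circ a r t - circ a r s = r%:C * (unitc t - unitc s) by rewrite /circ; ring.
rewrite nrmM nrmR; move: H; rewrite ler_pdivlMr //; apply: le_trans.
by rewrite mulrC ler_wpM2l ?nrm_ge0 // lerDl.
Qed.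

Lemma unif_cont_circ f a r : 0 <= r -> (forall z, nrm (z - a) = r -> ctn f z) ->
  unif_cont (fun t => f (circ a r t)).
Proof.
move=> r0 H; apply: (ptw_cont_comp (@ptw_cont_circ a r)) => t _.
by apply: H; rewrite nrm_circ.
Qed.

Definition cmean a r f : C := integ (fun t => f (circ a r t)).

Lemma cmean_bound f a r B : 0 <= r -> (forall z, nrm (z - a) = r -> ctn f z) ->
  (forall z, nrm (z - a) = r -> nrm (f z) <= B) -> nrm (cmean a r f) <= B.
Proof.
move=> r0 Hc Hb; apply: integ_bound; first exact: unif_cont_circ.
by move=> t _; apply: Hb; rewrite nrm_circ.
Qed.

Lemma eq_cmean f g a r : 0 <= r -> (forall z, nrm (z - a) = r -> f z = g z) ->
  cmean a r f = cmean a r g.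
Proof. by move=> r0 H; apply: integ_ext => t _; apply: H; rewrite nrm_circ. Qed.

(* Goursat's theorem for [w |-> f (a + cexp w)] on the rectangle with real part
   in [ln r1, ln r2] and imaginary part in [0, 2 pi], whose two horizontal sides
   cancel by periodicity. *)
Lemma cmean_annulus f a r1 r2 : 0 < r1 -> r1 <= r2 ->
  (forall z, r1 <= nrm (z - a) <= r2 -> derivable f z 1) -> cmean a r1 f = cmean a r2 f.
Proof.
move=> r10 r12 Hf; have r20 : 0 < r2 by apply: lt_le_trans r12.
pose F z := f (a + cexp z).
pose x1 : C := (ln r1)%:C; pose x2 : C := (ln r2)%:C; pose D := x2 - x1.
pose S := [set z : C | ln r1 <= complex.Re z <= ln r2].
have FS z : S z -> derivable F z 1.
  move=> /andP[h1 h2]; apply: is_derive_derivable.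
  apply: is_derive_compC; last first.
    apply: derivable_derive; apply: Hf; rewrite addrC addKr nrm_cexp.
    rewrite -[X in X <= _](lnK (r10 : r1 \is Num.pos)) -[X in _ <= X <= _]/(expR _).
    by rewrite ler_expR h1 -[X in _ <= X](lnK (r20 : r2 \is Num.pos)) ler_expR.
  by have := is_deriveDC (is_derive_cstC a z) (is_derive_cexp z); rewrite add0r; apply.
have cS : cvx S.
  move=> [x y] [u v] t; rewrite /S /= => /andP[h1 h2] /andP[h3 h4] /andP[t0 t1].
  rewrite mul0r subr0; apply/andP; split; nra.
have lS : lim_closed S.
  move=> c Hc; apply/andP; split; apply/ler_addgt0Pl => e e0; have [z /andP[h1 h2] hz] := Hc _ e0.
    have := nrm_Re (z - c); rewrite raddfB ler_norml => /andP[_ h]; lra.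
  have := nrm_Re (z - c); rewrite raddfB ler_norml => /andP[h _]; lra.
have l12 : ln r1 <= ln r2 by rewrite ler_ln.
have S1 : S x1 by rewrite /S /= lexx.
have S2 : S x2 by rewrite /S /= lexx andbT.
have S2' : S (x1 + D) by rewrite addrC subrK.
have St z : S z -> S (z + twopii) by case: z => x y; rewrite /S /= addr0.
have T1 : tri F x1 D twopii = 0 by apply: (goursat cS lS FS) => //; apply: St.
have T2 : tri F x1 twopii D = 0.
  by apply: (goursat cS lS FS) => //; [apply: St|rewrite addrAC; apply: St].
have P : seg F (x1 + twopii) D = seg F x1 D.
  rewrite /seg; congr (_ * integ _); apply/funext => t; rewrite /F.
  have -> : x1 + twopii + t%:C * D = twopii + (x1 + t%:C * D) by ring.
  by rewrite (cexpD twopii) cexp_twopii mul1r.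
move: T1 T2; rewrite /tri P [D + twopii]addrC => /eqP; rewrite subr_eq0 => /eqP <- /eqP.
rewrite subr_eq0 [_ + seg F x1 D]addrC (inj_eq (addrI _)) [x1 + D]addrC subrK.
rewrite /seg (inj_eq (mulfI twopii_neq0)).
have E r : 0 < r -> integ (fun t => F ((ln r)%:C + t%:C * twopii)) = cmean a r f.
  move=> r0; congr integ; apply/funext => t; rewrite /F cexpD /circ /unitc.
  by congr (f (_ + _ * _)); rewrite /cexp /= cos0 sin0 mulr0 mulr1 lnK.
by rewrite !E // => /eqP.
Qed.

(** The mean does not depend on the radius, and tends to [f a] for small radii. Only continuity is
    asked at [a] itself, so the lemma applies to [dq], which is not yet known to be differentiable
    there. *)
Lemma cmean_removable f a r : 0 < r -> (forall z, 0 < nrm (z - a) <= r -> derivable f z 1) ->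
  ctn f a -> cmean a r f = f a.
Proof.
move=> r0 Hf Hc; apply/eqP; rewrite -subr_eq0; apply/eqP/nrm_le_eps => e e0.
have [d d0 Hd] := Hc _ e0.
pose rho := Num.min r (d / 2).
have rho0 : 0 < rho by rewrite lt_min r0 divr_gt0.
have rhor : rho <= r by rewrite ge_min lexx.
have rhod : rho < d by rewrite gt_min; apply/orP; right; lra.
rewrite -(@cmean_annulus f a rho r) //; last first.
  by move=> z /andP[h1 h2]; apply: Hf; rewrite h2 (lt_le_trans rho0).
have cf z : nrm (z - a) = rho -> ctn f z.
  by move=> Hz; apply/derivable_ctn/Hf; rewrite Hz rho0.
rewrite -[f a]integ_cst -integB; [|exact/unif_cont_circ/cf/ltW|exact: unif_cont_cst].
apply: integ_bound.
  by apply: unif_contB; [exact/unif_cont_circ/cf/ltW|exact: unif_cont_cst].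
move=> t _; apply: Hd; rewrite nrmM nrmR nrm_unitc mulr1 ger0_norm //.
exact: ltW.
Qed.

Lemma cmean_center f a r : 0 < r -> (forall z, nrm (z - a) <= r -> derivable f z 1) ->
  cmean a r f = f a.
Proof.
move=> r0 Hf; apply: cmean_removable => // [z /andP[_ h]|]; first exact: Hf.
by apply/derivable_ctn/Hf; rewrite subrr nrm0 ltW.
Qed.

Definition dq f a z : C := if z == a then 'D_1 f a else (f z - f a) / (z - a).

Lemma dqE f a z : f z = f a + (z - a) * dq f a z.
Proof.
rewrite /dq; case: eqVneq => [->|za]; first by rewrite subrr mul0r addr0.
by rewrite mulrC mulrVK ?unitfE ?subr_eq0 // addrC subrK.
Qed.

Lemma dq_ctn f a : derivable f a 1 -> ctn (dq f a) a.
Proof.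
move=> /derivable_derive/is_deriveCP H e e0; have [d d0 Hd] := H _ e0; exists d => // h /Hd.
rewrite /dq eqxx; case: eqVneq => [E _|ha]; first by rewrite subrr nrm0 ltW.
have h0 : h != 0 by apply: contraNneq ha => ->; rewrite addr0.
move=> Hh; have -> : (f (a + h) - f a) / (a + h - a) - 'D_1 f a = (f (a + h) - f a - 'D_1 f a * h) / h.
  by rewrite [a + h - a]addrC addKr; field.
by rewrite nrmM nrmV ler_pdivrMr ?nrm_gt0.
Qed.

Lemma dq_derivable_neq f a z : z != a -> derivable f z 1 -> derivable (dq f a) z 1.
Proof.
move=> za Hf; apply: (@derivable_near _ (fun z => (f z - f a) / (z - a))).
  apply/near_nrmP; exists (nrm (z - a)); first by rewrite nrm_gt0 subr_eq0.
  move=> w Hw; rewrite /dq; case: eqVneq => // E.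
  by move: Hw; rewrite E nrmBC ltxx.
exact: derivable_difference_quotient.
Qed.

Lemma cmean_dq f a r : 0 < r -> (forall z, nrm (z - a) <= r -> derivable f z 1) ->
  cmean a r (fun z => (f z - f a) / (z - a)) = 'D_1 f a.
Proof.
move=> r0 Hf; rewrite -(@eq_cmean (dq f a)) ?(ltW r0) //.
  rewrite cmean_removable // /dq ?eqxx // => [z /andP[h1 h2]|].
    by apply: dq_derivable_neq (Hf _ h2); rewrite nrm_gt0 subr_eq0 in h1.
  by apply/dq_ctn/Hf; rewrite subrr nrm0 ltW.
move=> z Hz; rewrite /dq; case: eqVneq => // E.
by move: Hz r0; rewrite E subrr nrm0 => <-; rewrite ltxx.
Qed.

(** The derivative is the mean of the quotients (f z - f a) / (z - a); subtracting [f a] costs the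
    factor 2 over the sharp Cauchy bound. *)
Lemma cauchy_estimate f a r B : 0 < r -> (forall z, nrm (z - a) <= r -> derivable f z 1) ->
  (forall z, nrm (z - a) <= r -> nrm (f z) <= B) -> nrm ('D_1 f a) <= 2 * B / r.
Proof.
move=> r0 Hf HB; rewrite -(cmean_dq r0 Hf); apply: cmean_bound; first exact: ltW.
  move=> z Hz; apply: derivable_ctn; apply: derivable_difference_quotient.
    by rewrite -subr_eq0 -nrm_gt0 Hz.
  by apply: Hf; rewrite Hz.
move=> z Hz; rewrite nrmM nrmV Hz ler_wpM2r ?invr_ge0 ?(ltW r0) // mulr2n mulrDl mul1r.
by apply: le_trans (nrmB _ _) _; apply: lerD; apply: HB; rewrite ?Hz // subrr nrm0 ltW.
Qed.

Section QuadraticEstimate.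
Variables (f : C -> C) (a : C) (r B : R).
Hypotheses (r0 : 0 < r) (Hf : forall z, nrm (z - a) <= r -> derivable f z 1).
Hypothesis HB : forall z, nrm (z - a) <= r -> nrm (f z) <= B.

Let der_bound z : nrm (z - a) <= r / 2 -> nrm ('D_1 f z) <= 4 * B / r.
Proof.
move=> Hz; have r20 : 0 < r / 2 by rewrite divr_gt0.
have sub w : nrm (w - z) <= r / 2 -> nrm (w - a) <= r.
  by move=> Hw; apply: le_trans (nrm_triangle _ z _) _; lra.
have -> : 4 * B / r = 2 * B / (r / 2) by field; rewrite gt_eqF.
by apply: cauchy_estimate => // w /sub; [apply: Hf|apply: HB].
Qed.

(** The Cauchy estimate for the increment f (z + k) - f z, which is at most (4 B / r) |k| on the
    disc of radius r / 4; hence 2 * 4 * 4 = 32. No differentiability of the derivative is used,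
    since this lemma serves to prove it. *)
Lemma derive_lipschitz k : nrm k <= r / 4 ->
  nrm ('D_1 f (a + k) - 'D_1 f a) <= 32 * B / r ^+ 2 * nrm k.
Proof.
move=> Hk; have r40 : 0 < r / 4 by rewrite divr_gt0.
have Hsh z : nrm (z - a) <= r / 4 -> derivable (fun z => f (z + k)) z 1 /\
   'D_1 (fun z => f (z + k)) z = 'D_1 f (z + k).
  move=> Hz; have D : is_derive z 1 (fun z => f (z + k)) ('D_1 f (z + k) * 1).
    apply: is_derive_compC.
      by have := is_deriveDC (is_derive_idC z) (is_derive_cstC k z); rewrite addr0.
    apply/derivable_derive/Hf; rewrite addrAC (le_trans (nrmD _ _)) //; lra.
  by split; [apply: is_derive_derivable D|rewrite (is_derive_val D) mulr1].
have Hz0 : nrm (a - a) <= r / 4 by rewrite subrr nrm0 ltW.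
have Hdf z : nrm (z - a) <= r / 4 -> derivable f z 1 by move=> ?; apply: Hf; lra.
have [Da Ea] := Hsh _ Hz0.
pose g z := f (z + k) - f z.
have Dg : is_derive a 1 g ('D_1 f (a + k) - 'D_1 f a).
  by rewrite -Ea; apply: (is_deriveBC (derivable_derive Da) (derivable_derive (Hdf _ Hz0))).
rewrite -(is_derive_val Dg).
have -> : 32 * B / r ^+ 2 * nrm k = 2 * (4 * B / r * nrm k) / (r / 4).
  by field; rewrite gt_eqF.
apply: (@cauchy_estimate g a (r / 4) (4 * B / r * nrm k)); [exact: r40|move=> z Hz|move=> z Hz].
  exact: (derivableBC (Hsh _ Hz).1 (Hdf _ Hz)).
apply: mean_value_ineq => t /andP[t0 t1].
have Ht : nrm (z + t%:C * k - a) <= r / 2.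
  rewrite addrAC; apply: le_trans (nrmD _ _) _; rewrite nrmM nrmR ger0_norm //.
  have tk : t * nrm k <= nrm k by rewrite ler_piMl ?nrm_ge0.
  lra.
by exists ('D_1 f (z + t%:C * k)); [apply/derivable_derive/Hf; lra|apply: der_bound].
Qed.

Lemma quad_est h : nrm h <= r / 4 ->
  nrm (f (a + h) - f a - 'D_1 f a * h) <= 32 * B / r ^+ 2 * nrm h ^+ 2.
Proof.
move=> Hh; pose g z := f z - 'D_1 f a * z.
have -> : f (a + h) - f a - 'D_1 f a * h = g (a + h) - g a by rewrite /g; ring.
rewrite expr2 mulrA; apply: mean_value_ineq => t /andP[t0 t1].
have th : nrm (t%:C * h) <= nrm h by rewrite nrmM nrmR ger0_norm // ler_piMl ?nrm_ge0.
have B0 : 0 <= B.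
  by apply: le_trans (nrm_ge0 (f a)) (HB _); rewrite subrr nrm0 ltW.
exists ('D_1 f (a + t%:C * h) - 'D_1 f a).
  have D1 : is_derive (a + t%:C * h) 1 f ('D_1 f (a + t%:C * h)).
    apply/derivable_derive/Hf; rewrite addrC addKr.
    by apply: le_trans th _; apply: le_trans Hh _; move: r0; lra.
  have D2 := is_derive_affine ('D_1 f a) 0 (a + t%:C * h).
  by have := is_deriveBC D1 D2; congr is_derive; apply/funext => z; rewrite addr0.
apply: le_trans (derive_lipschitz (le_trans th Hh)) _.
by rewrite ler_wpM2l // divr_ge0 ?exprn_ge0 ?mulr_ge0 // ltW.
Qed.

End QuadraticEstimate.

Lemma near_disc (P : C -> Prop) a : (\forall w \near a, P w) <->
  exists2 r, 0 < r & forall z, nrm (z - a) <= r -> P z.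
Proof.
rewrite near_nrmP; split=> -[r r0 H].
  by exists (r / 2) => [|z Hz]; [rewrite divr_gt0|apply: H; lra].
by exists r => // z Hz; apply: H; apply: ltW.
Qed.

Lemma near_derivable_bounded f a : (\forall w \near a, derivable f w 1) ->
  exists2 r, 0 < r & forall z, nrm (z - a) <= r ->
    derivable f z 1 /\ nrm (f z) <= nrm (f a) + 1.
Proof.
move=> /near_disc[r r0 Hr].
have [d d0 Hd] := derivable_ctn (Hr a (ltac:(by rewrite subrr nrm0 ltW))) ltr01.
exists (Num.min r (d / 2)); first by rewrite lt_min r0 divr_gt0.
move=> z; rewrite le_min => /andP[h1 h2]; split; first exact: Hr.
have := Hd (z - a); rewrite [a + _]addrC subrK => H.
rewrite -[f z](subrK (f a)) addrC (le_trans (nrmD _ _)) // lerD2l.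
by apply: H; lra.
Qed.

(* [f'(x)] is the mean of the quotients [(f (x + s) - f x) / s] over the circle
   |s| = rho, and these can be differentiated in [x] under the integral. *)
Lemma derive_derivable f a : (\forall w \near a, derivable f w 1) -> derivable ('D_1 f) a 1.
Proof.
move=> /near_derivable_bounded[r r0 Hr].
set B := nrm (f a) + 1 in Hr; have B0 : 0 <= B by rewrite addr_ge0 ?nrm_ge0.
pose rho := r / 4; have rho0 : 0 < rho by rewrite divr_gt0.
have rE : r = 4 * rho by rewrite /rho; lra.
have Hr1 x : nrm (x - a) <= 2 * rho -> forall z, nrm (z - x) <= 2 * rho -> derivable f z 1 /\ nrm (f z) <= B.
  by move=> Hx z Hz; apply: Hr; apply: le_trans (nrm_triangle _ x _) _; lra.
pose K := 32 * B / (2 * rho) ^+ 2; have K0 : 0 <= K by rewrite divr_ge0 ?sqr_ge0 ?mulr_ge0.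
have rho2 : 0 < 2 * rho by lra.
have Q x h : nrm (x - a) <= rho -> nrm h <= rho / 2 ->
    nrm (f (x + h) - f x - 'D_1 f x * h) <= K * nrm h ^+ 2.
  move=> Hx Hh; apply: (quad_est rho2) => [z Hz|z Hz|]; last lra.
    by apply: (Hr1 x _ z Hz).1; lra.
  by apply: (Hr1 x _ z Hz).2; lra.
have Lp x k : nrm (x - a) <= rho -> nrm k <= rho / 2 ->
    nrm ('D_1 f (x + k) - 'D_1 f x) <= K * nrm k.
  move=> Hx Hk; apply: (derive_lipschitz rho2) => [z Hz|z Hz|]; last lra.
    by apply: (Hr1 x _ z Hz).1; lra.
  by apply: (Hr1 x _ z Hz).2; lra.
have cD x : nrm (x - a) <= rho -> ctn ('D_1 f) x.
  move=> Hx e e0; have K1 : 0 < K + 1 by rewrite ltr_wpDl.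
  exists (Num.min (rho / 2) (e / (K + 1))); first by rewrite lt_min !divr_gt0.
  move=> h; rewrite lt_min => /andP[/ltW h1]; rewrite ltr_pdivlMr // => h2.
  by apply: le_trans (Lp _ _ Hx h1) _; have := nrm_ge0 h; nra.
have df x : nrm (x - a) <= 2 * rho -> derivable f x 1 by move=> ?; apply: (Hr _ _).1; lra.
pose s t := rho%:C * unitc t.
have sn t : nrm (s t) = rho by rewrite nrmM nrmR nrm_unitc mulr1 gtr0_norm.
have s0 t : s t != 0 by rewrite -nrm_gt0 sn.
have Ux x : nrm (x - a) <= rho -> unif_cont (fun t => (f (x + s t) - f x) / s t) /\
    'D_1 f x = integ (fun t => (f (x + s t) - f x) / s t).
  move=> Hx.
  have dd z : nrm (z - x) <= rho -> derivable f z 1.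
    by move=> Hz; apply: (Hr1 x _ z _).1; lra.
  have E : (fun t => (f (x + s t) - f x) / s t) = (fun t => (fun z => (f z - f x) / (z - x)) (circ x rho t)).
    by apply/funext => t; rewrite /circ -/(s t) [x + s t]addrC addrK.
  rewrite E; split; last exact: (esym (cmean_dq rho0 dd)).
  apply: (@unif_cont_circ (fun z => (f z - f x) / (z - x)) x rho (ltW rho0)) => z Hz.
  apply: derivable_ctn; apply: derivable_difference_quotient.
    by rewrite -subr_eq0 -nrm_gt0 Hz.
  by apply: dd; rewrite Hz.
have Ha : nrm (a - a) <= rho by rewrite subrr nrm0 ltW.
pose phi t := ('D_1 f (a + s t) - 'D_1 f a) / s t.
have Uphi : unif_cont phi.
  have -> : phi = (fun t => (fun z => ('D_1 f z - 'D_1 f a) / (z - a)) (circ a rho t)).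
    by apply/funext => t; rewrite /phi /circ -/(s t) [a + s t]addrC addrK.
  apply: (@unif_cont_circ (fun z => ('D_1 f z - 'D_1 f a) / (z - a)) a rho (ltW rho0)) => z Hz.
  apply: ctn_div; first by rewrite -nrm_gt0 Hz.
    by apply: ctnB (ctn_cst _ _); apply: cD; rewrite Hz.
  exact: ctnB (ctn_id _) (ctn_cst _ _).
apply: (@is_derive_derivable _ _ _ (integ phi)); apply/is_deriveCP => e e0.
pose K2 := 2 * K / rho + 1; have K20 : 0 < K2.
  by apply: ltr_wpDl => //; apply: divr_ge0; [apply: mulr_ge0|apply: ltW].
exists (Num.min (rho / 2) (e / K2)); first by rewrite lt_min !divr_gt0.
move=> h; rewrite lt_min [_ < e / K2]ltr_pdivlMr // => /andP[/ltW h1 h2].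
have Hah : nrm (a + h - a) <= rho by rewrite [a + h]addrC addrK; lra.
have [U1 E1] := Ux _ Hah; have [U2 E2] := Ux _ Ha.
rewrite E1 E2 -integB // [integ phi * h]mulrC -integZ // -integB; first last.
- exact: unif_contZ.
- exact: unif_contB.
apply: (@le_trans _ _ (2 * K / rho * nrm h ^+ 2)); last first.
  rewrite expr2 mulrA ler_wpM2r ?nrm_ge0 //; apply: le_trans (ltW h2).
  by rewrite mulrC ler_wpM2l ?nrm_ge0 // /K2 lerDl.
apply: integ_bound; first by apply: unif_contB; [exact: unif_contB|exact: unif_contZ].
move=> t _; rewrite /phi.
(* The second difference is regrouped into the quadratic remainders of [f] at [a + s t] and at [a],
   each at most [K * nrm h ^+ 2]. *)
have -> : (f (a + h + s t) - f (a + h)) / s t - (f (a + s t) - f a) / s t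
      - h * (('D_1 f (a + s t) - 'D_1 f a) / s t) =
    ((f (a + s t + h) - f (a + s t) - 'D_1 f (a + s t) * h) - (f (a + h) - f a - 'D_1 f a * h)) / s t.
  have gen (A1 A2 A3 A4 u v k si : C) : (A1 - A2) * si - (A3 - A4) * si - k * ((u - v) * si) =
      ((A1 - A3 - u * k) - (A2 - A4 - v * k)) * si by ring.
  by rewrite [a + s t + h]addrAC gen.
rewrite nrmM nrmV sn.
have -> : 2 * K / rho * nrm h ^+ 2 = (2 * nrm h ^+ 2 * K) / rho by ring.
rewrite ler_pM2r ?invr_gt0 //.
apply: le_trans (nrmB _ _) _.
have -> : 2 * nrm h ^+ 2 * K = K * nrm h ^+ 2 + K * nrm h ^+ 2 by ring.
by apply: lerD; apply: Q => //; rewrite [a + s t]addrC addrK sn.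
Qed.

End CircleMean.

(** * Orders of vanishing *)

Section ZeroOrder.
Variable R : realType.
Local Notation C := (Cplx R).
Implicit Types (z w a h k : C) (f g : C -> C) (r t : R).

Lemma near_in_disc a r z : nrm (z - a) < r -> \forall w \near z, nrm (w - a) < r.
Proof.
move=> Hz; apply/near_nrmP; exists (r - nrm (z - a)); first by rewrite subr_gt0.
by move=> w Hw; apply: le_lt_trans (nrm_triangle _ z _) _; rewrite -ltrBrDr.
Qed.

Lemma open_disc_near (P : C -> Prop) a r z : (forall w, nrm (w - a) < r -> P w) ->
  nrm (z - a) < r -> \forall w \near z, P w.
Proof. by move=> H /near_in_disc; apply: filterS. Qed.

Lemma near_derive_derivable f a : (\forall w \near a, derivable f w 1) ->
  \forall w \near a, derivable ('D_1 f) w 1.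
Proof.
move=> /near_nrmP[r r0 Hr]; apply/near_nrmP; exists r; first exact: r0.
move=> w Hw; exact: (derive_derivable (open_disc_near Hr Hw)).
Qed.

(** The derivative of [dq f a] at [a] is half the second derivative of [f]. Indeed [G] is [f] minus
    its quadratic part, its derivative is O(h^2) by [quad_est] applied to ['D_1 f], so [G] itself
    varies by O(h^3) and the quotient by O(h^2). *)
Lemma dq_derivable_self f a : (\forall w \near a, derivable f w 1) -> derivable (dq f a) a 1.
Proof.
move=> Hf; have Hf' := near_derive_derivable Hf.
have [r1 r10 Hr1] := near_derivable_bounded Hf'.
have /near_disc[r2 r20 Hr2] := Hf.
pose r := Num.min r1 r2; have r0 : 0 < r by rewrite lt_min r10.
set B := nrm ('D_1 f a) + 1 in Hr1.
have d1 z : nrm (z - a) <= r -> derivable ('D_1 f) z 1.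
  by rewrite le_min => /andP[/Hr1[]].
have d2 z : nrm (z - a) <= r -> nrm ('D_1 f z) <= B.
  by rewrite le_min => /andP[/Hr1[]].
have d3 z : nrm (z - a) <= r -> derivable f z 1.
  by rewrite le_min => /andP[_ /Hr2].
clearbody r.
have Q := quad_est r0 d1 d2; set K := 32 * B / r ^+ 2 in Q.
have K0 : 0 <= K by rewrite /K divr_ge0 ?sqr_ge0 // mulr_ge0 // addr_ge0 ?nrm_ge0.
pose c := 'D_1 ('D_1 f) a.
pose G x := f x - ('D_1 f a * x + 0) - c / 2 * ((x - a) * (x - a)).
have HG h : nrm h <= r / 4 -> nrm (G (a + h) - G a) <= K * nrm h ^+ 2 * nrm h.
  move=> Hh; apply: mean_value_ineq => t /andP[t0 t1].
  have th : nrm (t%:C * h) <= nrm h by rewrite nrmM nrmR ger0_norm // ler_piMl ?nrm_ge0.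
  set x := a + t%:C * h.
  have xa : x - a = t%:C * h by rewrite /x [a + _]addrC addrK.
  exists ('D_1 f x - 'D_1 f a - (0 * ((x - a) * (x - a)) + c / 2 * (1 * (x - a) + (x - a) * 1))).
    have sx : is_derive x 1 (fun x : C => x - a) 1.
      by have := is_deriveBC (is_derive_idC x) (is_derive_cstC a x); rewrite subr0.
    apply: is_deriveBC.
      apply: is_deriveBC; last exact: is_derive_affine.
      apply/derivable_derive/d3; rewrite xa; apply: le_trans th _; apply: le_trans Hh _; lra.
    exact: is_deriveMC (is_derive_cstC _ _) (is_deriveMC sx sx).
  have gen (A1 A2 X c0 : C) : A1 - A2 - (0 * (X * X) + c0 / 2 * (1 * X + X * 1)) = A1 - A2 - c0 * X by field.
  rewrite gen xa.
  apply: le_trans (Q _ (le_trans th Hh)) _.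
  by rewrite ler_wpM2l // ler_pXn2r ?nnegrE ?nrm_ge0.
apply: (@is_derive_derivable _ _ _ (c / 2)); apply/is_deriveCP => e e0.
have K1 : 0 < K + 1 by rewrite ltr_wpDl.
exists (Num.min (r / 4) (e / (K + 1))); first by rewrite lt_min !divr_gt0.
move=> h; rewrite lt_min [_ < e / _]ltr_pdivlMr // => /andP[/ltW h1 h2].
rewrite /dq eqxx; case: eqVneq => [E|].
  have -> : h = 0 by rewrite -(addrK a h) [h + a]addrC E subrr.
  by rewrite subrr mulr0 subr0 !nrm0 mulr0.
rewrite -subr_eq0 [a + h]addrC addrK => h0.
have -> : (f (h + a) - f a) / h - 'D_1 f a - c / 2 * h = (G (a + h) - G a) / h.
  have gen (A1 A2 D c0 : C) : (A1 - A2) / h - D - c0 / 2 * h =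
      (A1 - (D * (h + a) + 0) - c0 / 2 * (h * h) - (A2 - (D * a + 0) - c0 / 2 * ((a - a) * (a - a)))) / h.
    by field.
  by rewrite /G [a + h]addrC addrK gen.
rewrite nrmM nrmV ler_pdivrMr ?nrm_gt0 //.
apply: le_trans (HG _ h1) _; rewrite ler_wpM2r ?nrm_ge0 // expr2 mulrA.
rewrite ler_wpM2r ?nrm_ge0 //; apply: le_trans (ltW h2).
by rewrite mulrC ler_wpM2l ?nrm_ge0 // lerDl.
Qed.

Lemma dq_derivable f a z : (\forall w \near z, derivable f w 1) -> derivable (dq f a) z 1.
Proof.
have [-> /dq_derivable_self|za Hf] := eqVneq z a; first by [].
by apply: dq_derivable_neq za _; apply: nbhs_singleton Hf.
Qed.

Lemma unif_cont_bounded (phi : R -> C) : unif_cont phi ->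
  exists2 B : R, 0 < B & forall t, 0 <= t <= 1 -> nrm (phi t) <= B.
Proof.
move=> U; have [d d0 Hd] := U 1 ltr01.
pose P s t := 0 <= s -> t <= 1 -> exists2 B : R, 0 < B & forall x, s <= x <= t -> nrm (phi x) <= B.
suff /(_ (lexx _) (lexx _))[B B0 HB] : P 0 1 by exists B.
apply: (@cousin _ P) => [s m t /andP[sm mt] P1 P2 s0 t1|c c01].
  have [B1 B10 H1] := P1 s0 (le_trans mt t1); have [B2 B20 H2] := P2 (le_trans s0 sm) t1.
  exists (B1 + B2) => [|x /andP[sx xt]]; first exact: addr_gt0.
  have [xm|/ltW mx] := leP x m.
    by apply: le_trans (H1 x _) _; rewrite ?sx // lerDl ltW.
  by apply: le_trans (H2 x _) _; rewrite ?mx // lerDr ltW.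
exists d => // s t /andP[s0 sc] /andP[ct t1] st _ _.
exists (nrm (phi c) + 1) => [|x /andP[sx xt]]; first by rewrite ltr_wpDl ?nrm_ge0.
rewrite -[phi x](subrK (phi c)) addrC (le_trans (nrmD _ _)) // lerD2l.
apply: Hd => //; first by rewrite (le_trans s0 sx) (le_trans xt t1).
by rewrite ltr_norml; apply/andP; split; lra.
Qed.

Lemma circle_bounded f a r : 0 <= r -> (forall z, nrm (z - a) = r -> ctn f z) ->
  exists2 B : R, 0 < B & forall t, 0 <= t <= 1 -> nrm (f (circ a r t)) <= B.
Proof. by move=> r0 Hf; apply: unif_cont_bounded; apply: unif_cont_circ. Qed.

Lemma cmean_bound_circ f a r B : 0 <= r -> (forall z, nrm (z - a) = r -> ctn f z) ->
  (forall t, 0 <= t <= 1 -> nrm (f (circ a r t)) <= B) -> nrm (cmean a r f) <= B.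
Proof. by move=> r0 Hc Hb; apply: integ_bound => //; exact: unif_cont_circ. Qed.

Fixpoint dqn f a n : C -> C := if n is n'.+1 then dq (dqn f a n') a else f.

Lemma dqn_derivable f a r n : (forall z, nrm (z - a) < r -> derivable f z 1) ->
  forall z, nrm (z - a) < r -> derivable (dqn f a n) z 1.
Proof.
move=> Hf; elim: n => [|n IH] z Hz; first exact: Hf.
exact: (@dq_derivable (dqn f a n) a z (open_disc_near IH Hz)).
Qed.

Lemma dqn_expand f a n : (forall j, (j < n)%N -> dqn f a j a = 0) ->
  forall z, f z = (z - a) ^+ n * dqn f a n z.
Proof.
elim: n => [|n IH] H z; first by rewrite expr0 mul1r.
rewrite IH => [|j jn]; last exact/H/ltnW.
by rewrite {1}(dqE _ a z) H // add0r exprSr mulrA.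
Qed.

(* If all iterated quotients vanish at [a], the maximum principle on a circle
   around [z] bounds |f z| by B ((r / 8) / (r / 4)) ^ n for every n; this is why
   the second alternative only holds on a smaller disc. *)
Lemma zero_order f a r : 0 < r -> (forall z, nrm (z - a) < r -> derivable f z 1) ->
  (exists n P, [/\ forall z, f z = (z - a) ^+ n * P z, P a != 0 &
     forall z, nrm (z - a) < r -> derivable P z 1]) \/
  (forall z, nrm (z - a) < r / 8 -> f z = 0).
Proof.
move=> r0 Hf; have Hd n := @dqn_derivable f a r n Hf.
have [ex|nex] := pselect (exists n, dqn f a n a != 0).
  left; exists (ex_minn ex), (dqn f a (ex_minn ex)); case: ex_minnP => n Hn Hmin; split; [|exact: Hn|exact: Hd].
  apply: dqn_expand => j jn; apply/eqP; apply: contraTT jn => /Hmin.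
  by rewrite -leqNgt.
right=> z Hz; have {nex}Hn n : dqn f a n a = 0.
  by apply: contrapT => /eqP H; apply: nex; exists n.
have E n : f z = (z - a) ^+ n * dqn f a n z by apply: dqn_expand.
have r20 : 0 < r / 2 by rewrite divr_gt0.
have sub w : nrm (w - z) <= r / 2 -> nrm (w - a) < r.
  by move=> Hw; apply: le_lt_trans (nrm_triangle _ z _) _; lra.
have cf w : nrm (w - z) = r / 2 -> ctn f w.
  by move=> Hw; apply/derivable_ctn/Hf/sub; rewrite Hw.
have [B B0 HB] := circle_bounded (ltW r20) cf.
have bnd n : nrm (dqn f a n z) <= B / (r / 4) ^+ n.
  rewrite -(@cmean_center _ (dqn f a n) z (r / 2) r20 (fun w Hw => Hd n w (sub w Hw))).
  apply: cmean_bound_circ => [|w Hw|t t01]; first exact: ltW.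
    by apply/derivable_ctn/Hd/sub; rewrite Hw.
  have r4 : 0 < (r / 4) ^+ n by rewrite exprn_gt0 // divr_gt0.
  have := HB _ t01; set w := circ _ _ _ => Hw.
  have wz : nrm (w - z) = r / 2 by rewrite nrm_circ // ltW.
  have wa : r / 4 <= nrm (w - a).
    have := nrm_sub (w - z) (a - z).
    have -> : w - z - (a - z) = w - a by ring.
    by rewrite wz [nrm (a - z)]nrmBC; lra.
  rewrite ler_pdivlMr // mulrC; apply: le_trans Hw.
  rewrite [X in _ <= nrm X](@dqn_expand f a n) => [|j _]; last exact: Hn.
  rewrite nrmM nrmX ler_wpM2r ?nrm_ge0 //.
  by apply: lerXn2r; rewrite ?nnegrE ?nrm_ge0 // ltW // divr_gt0.
apply: nrm_le_eps => e e0; have [N /(_ N (leqnn _)) HN] := exp2_small (divr_gt0 e0 B0).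
rewrite (E N) nrmM nrmX.
apply: (@le_trans _ _ ((r / 8) ^+ N * (B / (r / 4) ^+ N))).
  apply: ler_pM; rewrite ?exprn_ge0 ?nrm_ge0 //.
  by apply: lerXn2r; rewrite ?nnegrE ?nrm_ge0 // ltW // divr_gt0.
have -> : (r / 8) ^+ N * (B / (r / 4) ^+ N) = B * 2 ^- N.
  have r4 : (r / 4) ^+ N != 0 by rewrite expf_neq0 // gt_eqF // divr_gt0.
  rewrite mulrC -mulrA; congr (_ * _); apply: (mulfI r4); rewrite mulVKf //.
  by rewrite -exprVn -exprMn; congr (_ ^+ _); lra.
by rewrite mulrC -ler_pdivlMr // ltW.
Qed.

End ZeroOrder.

(** * Compactness of discs *)

Section Compactness.
Variable R : realType.
Local Notation C := (Cplx R).
Implicit Types (z a h : C) (r d e : R).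

(** Compactness of an arc, with a single parameter [d]. Since [P] carries [d] too and weakens as [d]
    decreases, one application can make both a radius and a bound of the form [<= d^-1] uniform. *)
Lemma segment_tube (V : normedModType C) (gam : R -> V) (P : R -> V -> Prop) :
    (forall s : R, 0 <= s <= 1 -> forall e, 0 < e -> exists2 d, 0 < d &
       forall t : R, 0 <= t <= 1 -> `|t - s| < d -> nrm (gam t - gam s) <= e) ->
    (forall d d' w, 0 < d' <= d -> P d w -> P d' w) ->
    (forall t : R, 0 <= t <= 1 -> exists2 d, 0 < d & forall w, nrm (w - gam t) < d -> P d w) ->
  exists2 d, 0 < d & forall t : R, 0 <= t <= 1 -> forall w, nrm (w - gam t) < d -> P d w.
Proof.
move=> Hg Pmon Hloc.
pose Q (s t : R) := 0 <= s -> t <= 1 -> exists2 d, 0 < d &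
  forall x, s <= x <= t -> forall w, nrm (w - gam x) < d -> P d w.
suff /(_ (lexx _) (lexx _)) : Q 0 1 by [].
apply: (@cousin _ Q) => [s m t /andP[sm mt] P1 P2 s0 t1|c c01].
  have [d1 d10 H1] := P1 s0 (le_trans mt t1); have [d2 d20 H2] := P2 (le_trans s0 sm) t1.
  have m12 : 0 < Num.min d1 d2 by rewrite lt_min d10.
  exists (Num.min d1 d2) => // x /andP[sx xt] w; rewrite lt_min => /andP[w1 w2].
  have [xm|/ltW mx] := leP x m.
    by apply: (Pmon d1); [rewrite m12 ge_min lexx|apply: (H1 x); rewrite ?sx].
  by apply: (Pmon d2); [rewrite m12 ge_min lexx orbT|apply: (H2 x); rewrite ?mx].
have [d d0 Hd] := Hloc _ c01.
have d20 : 0 < d / 2 by rewrite divr_gt0.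
have [d' d'0 Hd'] := Hg _ c01 _ d20.
exists d' => // s t /andP[s0 sc] /andP[ct t1] st _ _; exists (d / 2) => // x /andP[sx xt] w Hw.
have x01 : 0 <= x <= 1 by rewrite (le_trans s0 sx) (le_trans xt t1).
have xc : `|x - c| < d' by rewrite ltr_norml; apply/andP; split; lra.
apply: (Pmon d); first by rewrite d20 /=; lra.
apply: Hd; apply: le_lt_trans (nrm_triangle _ (gam x) _) _.
have := Hd' _ x01 xc; lra.
Qed.

(** The disc lies in a square. Each vertical segment of the square is treated by [segment_tube],
    whose tube covers the neighbouring vertical segments; [cousin] then runs over the horizontal
    coordinate. *)
Lemma square_tube r (P : R -> C -> Prop) : 0 < r ->
    (forall d d' w, 0 < d' <= d -> P d w -> P d' w) ->
    (forall z, exists2 d, 0 < d & forall w, nrm (w - z) < d -> P d w) ->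
  exists2 d, 0 < d & forall z, nrm z <= r -> P d z.
Proof.
move=> r0 Pmon Hloc.
pose A (s t : R) : C := Complex ((2 * s - 1) * r) ((2 * t - 1) * r).
have dA s t s' t' : nrm (A s t - A s' t') <= 2 * r * `|s - s'| + 2 * r * `|t - t'|.
  apply: le_trans (nrm_ReIm _) _; rewrite /=.
  have -> : (2 * s - 1) * r - (2 * s' - 1) * r = 2 * r * (s - s') by ring.
  have -> : (2 * t - 1) * r - (2 * t' - 1) * r = 2 * r * (t - t') by ring.
  by rewrite normrM [X in _ + X]normrM gtr0_norm ?mulr_gt0.
have r20 : 0 < 2 * r by rewrite mulr_gt0.
have H1 s : exists2 d, 0 < d & forall t, 0 <= t <= 1 -> forall w, nrm (w - A s t) < d -> P d w.
  apply: segment_tube => // t t01 e e0; exists (e / (2 * r)); first by rewrite divr_gt0.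
  move=> t' _; rewrite ltr_pdivlMr // => H; apply: le_trans (dA _ _ _ _) _.
  by rewrite subrr normr0 mulr0 add0r mulrC ltW.
pose Q (s s' : R) := exists2 d, 0 < d & forall x, s <= x <= s' -> forall t, 0 <= t <= 1 -> P d (A x t).
suff [d d0 Hd] : Q 0 1.
  exists d => // z Hz; have := le_trans (nrm_Re z) Hz; have := le_trans (nrm_Im z) Hz.
  case: z {Hz} => x y /=; rewrite !ler_norml => /andP[y1 y2] /andP[x1 x2].
  have -> : Complex x y = A ((x / r + 1) / 2) ((y / r + 1) / 2).
    by rewrite /A; congr Complex; field; rewrite gt_eqF.
  have b u : - r <= u -> u <= r -> 0 <= (u / r + 1) / 2 <= 1.
    move=> u1 u2; have : u / r <= 1 by rewrite ler_pdivrMr // mul1r.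
    have : -1 <= u / r by rewrite ler_pdivlMr // mulN1r.
    by move=> ? ?; apply/andP; split; lra.
  by apply: Hd; apply: b.
apply: (@cousin _ Q) => [s m t _ [d1 d10 P1] [d2 d20 P2]|c c01].
  have m12 : 0 < Num.min d1 d2 by rewrite lt_min d10.
  exists (Num.min d1 d2) => // x /andP[sx xt] y y01.
  have [xm|/ltW mx] := leP x m.
    by apply: (Pmon d1); [rewrite m12 ge_min lexx|apply: (P1 x); rewrite ?sx].
  by apply: (Pmon d2); [rewrite m12 ge_min lexx orbT|apply: (P2 x); rewrite ?mx].
have [d d0 Hd] := H1 c; exists (d / (2 * r)); first by rewrite divr_gt0.
move=> s t /andP[s0 sc] /andP[ct t1]; rewrite ltr_pdivlMr // => st; exists d => // x /andP[sx xt] y y01.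
apply: (Hd y y01); apply: le_lt_trans (dA _ _ _ _) _.
rewrite subrr normr0 mulr0 addr0 mulrC; apply: le_lt_trans st; rewrite ler_pM2r //.
by rewrite ler_norml; apply/andP; split; lra.
Qed.

Definition rctn (F : C -> R) z := forall e, 0 < e -> exists2 d, 0 < d &
  forall h, nrm h < d -> `|F (z + h) - F z| <= e.

Lemma rctnP F z : rctn F z <-> F @ z --> F z.
Proof.
split=> H.
  apply: (iffRL (@cvgrPdist_le _ _ _ _ (nbhs_filter z) _ _)) => e e0.
  have [d d0 Hd] := H _ e0; apply: (near0_nrmP (z : C) _).2; exists d => // h /Hd.
  by rewrite distrC.
move=> e e0; have [d d0 Hd] := (near0_nrmP (z : C) _).1
  (iffLR (@cvgrPdist_le _ _ _ _ (nbhs_filter z) _ _) H _ e0).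
by exists d => // h /Hd; rewrite distrC.
Qed.

Lemma rctn_cst (c : R) z : rctn (fun=> c) z.
Proof. by move=> e e0; exists 1 => // h _; rewrite subrr normr0 ltW. Qed.

Lemma rctnD F G z : rctn F z -> rctn G z -> rctn (fun x => F x + G x) z.
Proof. by move=> /rctnP HF /rctnP HG; apply/rctnP; apply: (cvgD HF HG). Qed.

Lemma rctnB F G z : rctn F z -> rctn G z -> rctn (fun x => F x - G x) z.
Proof. by move=> /rctnP HF /rctnP HG; apply/rctnP; apply: (cvgB HF HG). Qed.

Lemma rctnM F G z : rctn F z -> rctn G z -> rctn (fun x => F x * G x) z.
Proof. by move=> /rctnP HF /rctnP HG; apply/rctnP; apply: (cvgM HF HG). Qed.

Lemma rctn_nrm (f : C -> C) z : ctn f z -> rctn (fun x => nrm (f x)) z.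
Proof.
move=> Hf e /Hf[d d0 Hd]; exists d => // h /Hd; apply: le_trans.
rewrite ler_norml; have := nrm_sub (f (z + h)) (f z); have := nrm_sub (f z) (f (z + h)).
by rewrite [nrm (f z - _)]nrmBC => ? ?; apply/andP; split; lra.
Qed.

Lemma rctn_nrm2 (f : C -> C) z : ctn f z -> rctn (fun x => nrm (f x) ^+ 2) z.
Proof.
move=> /rctn_nrm Hf; have := rctnM Hf Hf; congr rctn.
Qed.

Lemma rctn_lt F G a : rctn F a -> rctn G a -> F a < G a ->
  exists2 d, 0 < d & forall h, nrm h < d -> F (a + h) < G (a + h).
Proof.
move=> HF HG FG; pose e := (G a - F a) / 3; have e0 : 0 < e by rewrite divr_gt0 // subr_gt0.
have [d1 d10 H1] := HF _ e0; have [d2 d20 H2] := HG _ e0.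
exists (Num.min d1 d2); first by rewrite lt_min d10.
move=> h; rewrite lt_min => /andP[/H1 h1 /H2]; move: h1.
by rewrite !ler_norml /e => /andP[? ?] /andP[? ?]; lra.
Qed.

(** [square_tube] is used twice: with [F z <= d^-1] for boundedness, and then, supposing that the
    supremum is not attained, with [F z <= sup S - d], which contradicts its being the supremum. *)
Lemma disc_max (F : C -> R) r : 0 < r -> (forall z, rctn F z) ->
  exists2 a, nrm a <= r & forall z, nrm z <= r -> F z <= F a.
Proof.
move=> r0 HF.
have loc z e : 0 < e -> exists2 d, 0 < d & forall w, nrm (w - z) < d -> `|F w - F z| <= e.
  move=> e0; have [d d0 Hd] := HF z _ e0; exists d => // w /Hd.
  by rewrite [z + _]addrC subrK.
have [d d0 Hd] : exists2 d, 0 < d & forall z, nrm z <= r -> F z <= d^-1.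
  apply: (@square_tube r (fun d z => F z <= d^-1)) => // [d d' w /andP[d'0 dd']|z].
    by move=> /le_trans; apply; rewrite lef_pV2 // posrE (lt_le_trans d'0).
  have [d d0 Hd] := loc z 1 ltr01.
  have c0 : 0 < (`|F z| + 1)^-1 by rewrite invr_gt0 ltr_wpDl.
  exists (Num.min d (`|F z| + 1)^-1); first by rewrite lt_min d0.
  move=> w; rewrite lt_min => /andP[/Hd + _].
  rewrite ler_norml => /andP[_ h1].
  apply: (@le_trans _ _ (`|F z| + 1)); first by have := ler_norm (F z); lra.
  by rewrite -[X in X <= _]invrK lef_pV2 ?posrE ?lt_min ?d0 // ge_min lexx orbT.
pose S := [set F z | z in [set z | nrm z <= r]].
have S0 : S (F 0) by exists 0 => //=; rewrite nrm0 ltW.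
have hS : has_sup S.
  by split; [exists (F 0)|exists d^-1 => _ [z Hz <-]; apply: Hd].
apply: contrapT => Hno.
have lt_sup z : nrm z <= r -> F z < sup S.
  move=> Hz; rewrite lt_neqAle; apply/andP; split; last by apply: ub_le_sup; [exact: hS.2|exists z].
  apply/eqP => E; apply: Hno; exists z => // w Hw; rewrite E.
  by apply: ub_le_sup; [exact: hS.2|exists w].
have [e e0 He] : exists2 d, 0 < d & forall z, nrm z <= r -> (nrm z <= r -> F z <= sup S - d).
  apply: (@square_tube r (fun d z => nrm z <= r -> F z <= sup S - d)) => // [d1 d' w /andP[_ dd'] H /H|z].
    by move=> /le_trans; apply; rewrite lerD2l lerN2.
  have [zr|rz] := leP (nrm z) r; last first.
    exists (nrm z - r); first by rewrite subr_gt0.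
    move=> w Hw wr; have := nrm_sub z w; rewrite [nrm (z - w)]nrmBC; lra.
  have s0 : 0 < (sup S - F z) / 2 by rewrite divr_gt0 // subr_gt0 lt_sup.
  have [d1 d10 H1] := loc z _ s0.
  exists (Num.min d1 ((sup S - F z) / 2)); first by rewrite lt_min d10.
  move=> w; rewrite lt_min => /andP[/H1]; rewrite ler_norml => /andP[_ h1] _ _.
  have : Num.min d1 ((sup S - F z) / 2) <= (sup S - F z) / 2 by rewrite ge_min lexx orbT.
  lra.
have [_ [z Hz <-]] := sup_adherent e0 hS.
by rewrite ltNge He.
Qed.

End Compactness.

(** * Picard's little theorem *)

Section FermatSextic.
Variable R : realType.
Local Notation C := (Cplx R).
Implicit Types (z w a h : C) (r d e : R).

Definition cj (c : C) : C := Complex (complex.Re c) (- complex.Im c).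

(** For fixed [c] the weight 1 + |s|^2 is, up to the constant 1 + |c|^2, the squared modulus of a
    function holomorphic in [s] plus a term vanishing to second order at s = c. The coefficient of
    that term carries the curvature. *)
Lemma fubini_study_identity (s c : C) :
  (1 + nrm s ^+ 2) * (1 + nrm c ^+ 2) = nrm (1 + cj c * s) ^+ 2 + nrm (s - c) ^+ 2.
Proof. by rewrite !nrm_sqr; case: s => x y; case: c => u v /=; ring. Qed.

(** The hyperbolic counterpart of the previous identity; the second-order term now comes with a
    minus sign. *)
Lemma poincare_identity (z a : C) r :
  (r ^+ 2 - nrm z ^+ 2) * (r ^+ 2 - nrm a ^+ 2) =
  nrm ((r ^+ 2)%:C - cj a * z) ^+ 2 - r ^+ 2 * nrm (z - a) ^+ 2.
Proof. by rewrite !nrm_sqr; case: z => x y; case: a => u v /=; ring. Qed.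

(* For S <= T the hypothesis gives 1/2 <= T, so 1 + T <= 3 T, and 162 = 2 * 3^4. *)
Lemma sextic_curvature (S T : R) : 0 <= S -> 0 <= T -> 1 <= S ^+ 3 + T ^+ 3 ->
  (1 + S) * (1 + T) <= 162 * (T ^+ 5 / (1 + S) ^+ 2 + S ^+ 5 / (1 + T) ^+ 2).
Proof.
wlog ST : S T / S <= T.
  move=> H S0 T0 ST1; have [|/ltW] := leP S T => ?; first exact: H.
  by rewrite [X in X <= _]mulrC [X in 162 * X]addrC; apply: H => //; rewrite addrC.
move=> S0 T0 ST1.
have T12 : 1 / 2 <= T.
  rewrite leNgt; apply/negP => T12.
  have T2 : T ^+ 2 <= 1 / 4 by rewrite expr2; nra.
  have T3 : T ^+ 3 <= 1 / 8 by rewrite exprS; nra.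
  have S3 : S ^+ 3 <= T ^+ 3 by apply: lerXn2r; rewrite ?nnegrE.
  lra.
have S5 : 0 <= S ^+ 5 / (1 + T) ^+ 2 by rewrite divr_ge0 ?exprn_ge0 ?addr_ge0.
have s1 : 0 < 1 + S by rewrite ltr_pwDl.
have t1 : 0 < 1 + T by rewrite ltr_pwDl.
suff H : (1 + S) * (1 + T) <= 162 * (T ^+ 5 / (1 + S) ^+ 2).
  by apply: le_trans H _; rewrite ler_pM2l // lerDl.
rewrite mulrA ler_pdivlMr ?exprn_gt0 //.
have ST' : 1 + S <= 1 + T by rewrite lerD2l.
have T3 : 1 + T <= 3 * T by lra.
have S4 : (1 + S) ^+ 3 <= (1 + T) ^+ 3 by apply: lerXn2r; rewrite ?nnegrE // ltW.
have T4 : (1 + T) ^+ 4 <= (3 * T) ^+ 4 by apply: lerXn2r; rewrite ?nnegrE ?mulr_ge0 // ltW.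
have -> : (1 + S) * (1 + T) * (1 + S) ^+ 2 = (1 + S) ^+ 3 * (1 + T) by ring.
apply: (@le_trans _ _ ((1 + T) ^+ 3 * (1 + T))); first by rewrite ler_pM2r.
rewrite -exprSr; apply: le_trans T4 _.
have -> : (3 * T) ^+ 4 = 81 * T ^+ 4 by ring.
have -> : 162 * T ^+ 5 = 81 * T ^+ 4 * (2 * T) by ring.
by rewrite ler_peMr ?mulr_ge0 ?exprn_ge0 //; lra.
Qed.

(** The square loses at most 2 om n and the last two factors gain at least m n. The cross term 2 om
    m n^2 is paid by half of the net gain (m - 2 om) n, which is what the hypothesis with the factor
    4 says. *)
Lemma product_expansion (om m n u x y : R) : 0 <= n -> 0 <= om -> 0 < u -> 0 <= x -> 0 <= y ->
    u <= om * n -> om * n <= 1 / 2 -> m * n <= x + y -> 0 <= m -> 4 * om * m * n <= m - 2 * om ->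
  1 + (m - 2 * om) / 2 * n <= (1 - u) ^+ 2 * ((1 + x) * (1 + y)).
Proof.
move=> n0 om0 u0 x0 y0 uo o2 mxy m0 H.
have h1 : 1 - 2 * (om * n) <= (1 - u) ^+ 2 by nra.
have h2 : 1 + m * n <= (1 + x) * (1 + y) by nra.
have h3 : 0 <= 1 - 2 * (om * n) by lra.
have h4 : 0 <= 1 + m * n by rewrite addr_ge0 // mulr_ge0.
have h5 := ler_pM h3 h4 h1 h2.
apply: le_trans h5.
have : 4 * om * m * n * n <= (m - 2 * om) * n by rewrite ler_wpM2r.
by move=> ?; lra.
Qed.

(* The Ahlfors-Schwarz inequality at an interior maximum. The two identities
   above turn the maximality of the weighted metric into an upper bound for the
   holomorphic function [Psi]; if the curvatures were in the wrong order, |Psi|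
   would be strictly smaller on a small circle than at its centre. *)
Lemma max_point_curvature (s q th : C -> C) (r : R) (a ls lq : C) :
    (forall z, derivable s z 1) -> (forall z, derivable q z 1) -> (forall z, derivable th z 1) ->
    dq s a a = ls -> dq q a a = lq -> nrm a < r -> th a != 0 ->
    (forall z, nrm z <= r ->
      (r ^+ 2 - nrm z ^+ 2) ^+ 2 * (nrm (th z) ^+ 2 * ((1 + nrm (s z) ^+ 2) * (1 + nrm (q z) ^+ 2))) <=
      (r ^+ 2 - nrm a ^+ 2) ^+ 2 * (nrm (th a) ^+ 2 * ((1 + nrm (s a) ^+ 2) * (1 + nrm (q a) ^+ 2)))) ->
  nrm ls ^+ 2 / (1 + nrm (s a) ^+ 2) ^+ 2 + nrm lq ^+ 2 / (1 + nrm (q a) ^+ 2) ^+ 2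
    <= 2 * (r ^+ 2 / (r ^+ 2 - nrm a ^+ 2) ^+ 2).
Proof.
move=> ds dq_ dth dsa dqa ar tha Hmax.
have r0 : 0 < r by apply: le_lt_trans ar; apply: nrm_ge0.
set s0 := s a in Hmax *; set q0 := q a in Hmax *.
pose G z := (r ^+ 2)%:C - cj a * z.
pose A z := 1 + cj s0 * s z.
pose B z := 1 + cj q0 * q z.
(* Each factor of the weighted metric is replaced by its holomorphic part from the two identities.
   At [a] the squared modulus of [Psi] is the maximum of the weighted metric times the constant
   [D ^+ 2 * (S0 * T0)]. *)
pose Psi z := (G z * G z) * (th z * (A z * B z)).
have dG z : derivable G z 1.
  exact: (@derivableBC _ (fun=> (r ^+ 2)%:C) (fun z => cj a * z) z (@derivable_cstC _ _ z)
   (@derivableMC _ (fun=> cj a) (fun z => z) z (@derivable_cstC _ _ z)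
      (is_derive_derivable (is_derive_idC z)))).
have dAB (c : C) (f : C -> C) z : derivable f z 1 -> derivable (fun z => 1 + cj c * f z) z 1.
  move=> df; have d1 : derivable (fun z => cj c * f z) z 1.
    exact: (@derivableMC _ (fun=> cj c) f z (@derivable_cstC _ _ z) df).
  exact: (is_derive_derivable (is_deriveDC (is_derive_cstC 1 z) (derivable_derive d1))).
have dA z : derivable A z 1 by apply: dAB; apply: ds.
have dB z : derivable B z 1 by apply: dAB; apply: dq_.
have dPsi z : derivable Psi z 1.
  exact: (derivableMC (derivableMC (dG z) (dG z)) (derivableMC (dth z) (derivableMC (dA z) (dB z)))).
set D := r ^+ 2 - nrm a ^+ 2 in Hmax *.
have D0 : 0 < D by rewrite subr_gt0 ltr_pXn2r ?nnegrE ?nrm_ge0 // ltW.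
set S0 := 1 + nrm s0 ^+ 2 in Hmax *; set T0 := 1 + nrm q0 ^+ 2 in Hmax *.
have S00 : 0 < S0 by rewrite ltr_pwDl // sqr_ge0.
have T00 : 0 < T0 by rewrite ltr_pwDl // sqr_ge0.
have Ga : nrm (G a) ^+ 2 = D ^+ 2.
  by have := poincare_identity a a r; rewrite subrr nrm0 expr0n mulr0 subr0 -expr2 => <-.
have Aa : nrm (A a) ^+ 2 = S0 ^+ 2.
  by have := fubini_study_identity s0 s0; rewrite subrr nrm0 expr0n addr0 -expr2 => <-.
have Ba : nrm (B a) ^+ 2 = T0 ^+ 2.
  by have := fubini_study_identity q0 q0; rewrite subrr nrm0 expr0n addr0 -expr2 => <-.
have PsiE z : nrm (Psi z) ^+ 2 =
    (nrm (G z) ^+ 2) ^+ 2 * (nrm (th z) ^+ 2 * (nrm (A z) ^+ 2 * nrm (B z) ^+ 2)).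
  by rewrite /Psi !nrmM; ring.
set om0 := r ^+ 2 / D ^+ 2.
set x0 := nrm ls ^+ 2 / S0 ^+ 2; set y0 := nrm lq ^+ 2 / T0 ^+ 2.
have om00 : 0 < om0 by rewrite divr_gt0 // exprn_gt0.
have x00 : 0 <= x0 by rewrite divr_ge0 // sqr_ge0.
have y00 : 0 <= y0 by rewrite divr_ge0 // sqr_ge0.
rewrite leNgt; apply/negP => Hlt.
(* [kap] measures the supposed failure of the inequality. Continuity near [a] costs [eta] in each of
   [om0], [x0] and [y0]; with [eta] an eighth of [kap], half of the failure survives as m - 2 om =
   kap / 2. *)
pose kap := x0 + y0 - 2 * om0; have kap0 : 0 < kap by rewrite subr_gt0.
pose eta := kap / 8; have eta0 : 0 < eta by rewrite divr_gt0.
pose om := om0 + eta; pose m := x0 + y0 - 2 * eta.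
have m0 : 0 < m by rewrite /m /eta; move: kap0 om00; rewrite /kap; lra.
have mom : m - 2 * om = kap / 2 by rewrite /m /om /eta /kap; lra.
have om_gt0 : 0 < om by rewrite addr_gt0.
have cG : rctn (fun z => nrm (G z) ^+ 2) a by apply: rctn_nrm2; apply: derivable_ctn; apply: dG.
have cA : rctn (fun z => nrm (A z) ^+ 2) a by apply: rctn_nrm2; apply: derivable_ctn; apply: dA.
have cB : rctn (fun z => nrm (B z) ^+ 2) a by apply: rctn_nrm2; apply: derivable_ctn; apply: dB.
have cs : rctn (fun z => nrm (dq s a z) ^+ 2) a by apply: rctn_nrm2; apply: dq_ctn; apply: ds.
have cq : rctn (fun z => nrm (dq q a z) ^+ 2) a by apply: rctn_nrm2; apply: dq_ctn; apply: dq_.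
have [d1 d10 H1] : exists2 d, 0 < d & forall h, nrm h < d -> r ^+ 2 < om * nrm (G (a + h)) ^+ 2.
  apply: (@rctn_lt _ (fun=> r ^+ 2) (fun z => om * nrm (G z) ^+ 2)); first exact: rctn_cst.
    by apply: rctnM cG; apply: rctn_cst.
  rewrite Ga -ltr_pdivrMr ?exprn_gt0 // -/om0 /om ltrDl; exact: eta0.
have [d2 d20 H2] : exists2 d, 0 < d & forall h, nrm h < d ->
    (x0 - eta) * nrm (A (a + h)) ^+ 2 < nrm (dq s a (a + h)) ^+ 2.
  apply: (@rctn_lt _ (fun z => (x0 - eta) * nrm (A z) ^+ 2) (fun z => nrm (dq s a z) ^+ 2)).
  - by apply: rctnM cA; apply: rctn_cst.
  - exact: cs.
  by rewrite dsa Aa -ltr_pdivlMr ?exprn_gt0 // -/x0 ltrBlDr ltrDl.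
have [d3 d30 H3] : exists2 d, 0 < d & forall h, nrm h < d ->
    (y0 - eta) * nrm (B (a + h)) ^+ 2 < nrm (dq q a (a + h)) ^+ 2.
  apply: (@rctn_lt _ (fun z => (y0 - eta) * nrm (B z) ^+ 2) (fun z => nrm (dq q a z) ^+ 2)).
  - by apply: rctnM cB; apply: rctn_cst.
  - exact: cq.
  by rewrite dqa Ba -ltr_pdivlMr ?exprn_gt0 // -/y0 ltrBlDr ltrDl.
have [d4 d40 H4] : exists2 d, 0 < d & forall h, nrm h < d -> 0 < nrm (A (a + h)) ^+ 2.
  apply: (@rctn_lt _ (fun=> 0) (fun z => nrm (A z) ^+ 2) a _ cA); first exact: rctn_cst.
  by rewrite Aa exprn_gt0.
have [d5 d50 H5] : exists2 d, 0 < d & forall h, nrm h < d -> 0 < nrm (B (a + h)) ^+ 2.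
  apply: (@rctn_lt _ (fun=> 0) (fun z => nrm (B z) ^+ 2) a _ cB); first exact: rctn_cst.
  by rewrite Ba exprn_gt0.
(* The first two entries give the smallness conditions of [product_expansion]; the entry 1 gives
   ep^2 <= ep, so that these conditions pass from [ep] to its square. *)
pose n0 := Num.min (1 / (2 * om)) (Num.min (kap / (8 * om * m)) 1).
have n00 : 0 < n0.
  by rewrite !lt_min ltr01 andbT; apply/andP; split; apply: divr_gt0 => //; do !apply: mulr_gt0 => //.
pose e0 := Num.min n0 (Num.min (r - nrm a) (Num.min d1 (Num.min d2 (Num.min d3 (Num.min d4 d5))))).
have e00 : 0 < e0 by rewrite lt_min n00 !lt_min subr_gt0 ar d10 d20 d30 d40.
pose ep := e0 / 2; have ep0 : 0 < ep by rewrite divr_gt0.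
have epe : ep < e0 by rewrite /ep; move: e00; clear -R; lra.
have Psi_lt z : nrm (z - a) = ep -> nrm (Psi z) ^+ 2 * (1 + kap / 4 * ep ^+ 2) <= nrm (Psi a) ^+ 2.
  move=> Hz; have : nrm (z - a) < e0 by rewrite Hz.
  rewrite !lt_min => /andP[hn /andP[hr /andP[h1 /andP[h2 /andP[h3 /andP[h4 h5]]]]]].
  have {}H1 := H1 _ h1; have {}H2 := H2 _ h2; have {}H3 := H3 _ h3.
  have {}H4 := H4 _ h4; have {}H5 := H5 _ h5.
  rewrite [a + _]addrC subrK in H1 H2 H3 H4 H5.
  have zr : nrm z <= r.
    by have := nrm_sub z a; move: hr; rewrite ltrBrDr; clear -R; lra.
  have nn : nrm (z - a) ^+ 2 = ep ^+ 2 by rewrite Hz.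
  set n := ep ^+ 2 in nn *.
  have n_gt0 : 0 < n by rewrite exprn_gt0.
  move: hn; rewrite Hz ?lt_min => /andP[n1 /andP[n2 n3]].
  have nep : n <= ep by rewrite /n expr2 ler_piMr // ltW.
  have Xs : nrm (s z - s0) ^+ 2 = n * nrm (dq s a z) ^+ 2.
    by rewrite {1}(dqE s a z) -/s0 addrAC subrr add0r nrmM exprMn nn.
  have Xq : nrm (q z - q0) ^+ 2 = n * nrm (dq q a z) ^+ 2.
    by rewrite {1}(dqE q a z) -/q0 addrAC subrr add0r nrmM exprMn nn.
  have G0 : 0 < nrm (G z) ^+ 2.
    by have := lt_trans (exprn_gt0 2 r0) H1; rewrite pmulr_rgt0.
  have P1 := poincare_identity z a r; rewrite -/D -/(G z) nn in P1.
  have P2 := fubini_study_identity (s z) s0; rewrite -/S0 -/(A z) Xs in P2.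
  have P3 := fubini_study_identity (q z) q0; rewrite -/T0 -/(B z) Xq in P3.
  have Hm := Hmax z zr.
  rewrite !PsiE Ga Aa Ba.
  move: H1 H2 H3 H4 H5 G0 P1 P2 P3 Hm.
  set g := nrm (G z) ^+ 2; set al := nrm (A z) ^+ 2; set be := nrm (B z) ^+ 2.
  set X := nrm (dq s a z) ^+ 2; set Y := nrm (dq q a z) ^+ 2.
  set t := nrm (th z) ^+ 2; set t0 := nrm (th a) ^+ 2.
  set Dz := r ^+ 2 - nrm z ^+ 2; set Sz := 1 + nrm (s z) ^+ 2; set Tz := 1 + nrm (q z) ^+ 2.
  move=> H1 H2 H3 H4 H5 G0 P1 P2 P3 Hm.
  have t_ge0 : 0 <= t by rewrite sqr_ge0.
  have key : 1 + (m - 2 * om) / 2 * n <=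
      (1 - r ^+ 2 * n / g) ^+ 2 * ((1 + n * X / al) * (1 + n * Y / be)).
    apply: product_expansion; rewrite ?(ltW n_gt0) ?(ltW om_gt0) ?(ltW m0) //.
    - by rewrite divr_gt0 // mulr_gt0 // exprn_gt0.
    - by rewrite divr_ge0 ?(ltW H4) // mulr_ge0 ?(ltW n_gt0) // sqr_ge0.
    - by rewrite divr_ge0 ?(ltW H5) // mulr_ge0 ?(ltW n_gt0) // sqr_ge0.
    - by rewrite ler_pdivrMr // [om * n * g]mulrAC ler_pM2r // ltW.
    - move: n1; rewrite ltr_pdivlMr ?mulr_gt0 // => n1.
      have : n * (2 * om) <= ep * (2 * om) by rewrite ler_pM2r // mulr_gt0.
      by move: n1; clear -R; lra.
    - have hx : (x0 - eta) * n <= n * X / al.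
        by rewrite ler_pdivlMr // [_ * n]mulrC -mulrA ler_pM2l // ltW.
      have hy : (y0 - eta) * n <= n * Y / be.
        by rewrite ler_pdivlMr // [_ * n]mulrC -mulrA ler_pM2l // ltW.
      by apply: le_trans (lerD hx hy); rewrite -mulrDl /m ler_pM2r //; clear -R; lra.
    - rewrite mom; move: n2; rewrite ltr_pdivlMr ?mulr_gt0 // => n2.
      have : n * (8 * om * m) <= ep * (8 * om * m) by rewrite ler_pM2r // !mulr_gt0.
      by move: n2; clear -R; lra.
  rewrite mom in key.
  have -> : kap / 4 = kap / 2 / 2 by clear -R; lra.
  have ga : g != 0 by rewrite gt_eqF.
  have aa : al != 0 by rewrite gt_eqF.
  have ba : be != 0 by rewrite gt_eqF.
  have w0 : 0 <= g ^+ 2 * (t * (al * be)).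
    by rewrite mulr_ge0 ?sqr_ge0 // mulr_ge0 // ltW // mulr_gt0.
  apply: le_trans (ler_wpM2l w0 key) _.
  have -> : g ^+ 2 * (t * (al * be)) * ((1 - r ^+ 2 * n / g) ^+ 2 * ((1 + n * X / al) * (1 + n * Y / be)))
      = (g - r ^+ 2 * n) ^+ 2 * (t * ((al + n * X) * (be + n * Y))).
    by field; rewrite ga aa ba.
  rewrite -P1 -P2 -P3.
  have -> : (Dz * D) ^+ 2 * (t * (Sz * S0 * (Tz * T0))) = (Dz ^+ 2 * (t * (Sz * Tz))) * (D ^+ 2 * (S0 * T0)) by ring.
  have -> : (D ^+ 2) ^+ 2 * (t0 * (S0 ^+ 2 * T0 ^+ 2)) = (D ^+ 2 * (t0 * (S0 * T0))) * (D ^+ 2 * (S0 * T0)) by ring.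
  by rewrite ler_pM2r // mulr_gt0 ?exprn_gt0 // mulr_gt0.
have Psia : 0 < nrm (Psi a).
  have : 0 < nrm (Psi a) ^+ 2.
    rewrite PsiE Ga Aa Ba mulr_gt0 ?exprn_gt0 //.
    by rewrite mulr_gt0 ?exprn_gt0 ?nrm_gt0 // mulr_gt0 ?exprn_gt0.
  move=> Hp; rewrite lt0r nrm_ge0 andbT; move: Hp.
  by apply: contraTneq => ->; rewrite expr0n ltxx.
pose c := 1 + kap / 4 * ep ^+ 2.
have c1 : 1 < c by rewrite ltrDl mulr_gt0 ?exprn_gt0 // divr_gt0.
have c0 : 0 < c by apply: lt_trans c1.
have sc1 : 1 < Num.sqrt c by rewrite -[X in X < _]sqrtr1 ltr_sqrt.
have sc0 : 0 < Num.sqrt c by apply: lt_trans sc1.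
have bnd z : nrm (z - a) = ep -> nrm (Psi z) <= nrm (Psi a) / Num.sqrt c.
  move=> /Psi_lt Hz; rewrite ler_pdivlMr //.
  rewrite -(@ler_pXn2r _ 2) ?nnegrE ?mulr_ge0 ?nrm_ge0 ?sqrtr_ge0 //.
  by rewrite exprMn sqr_sqrtr // ltW.
have : nrm (Psi a) <= nrm (Psi a) / Num.sqrt c.
  rewrite -{1}(@cmean_center _ Psi a ep ep0 (fun z _ => dPsi z)).
  by apply: cmean_bound; [exact: ltW|move=> z _; apply: derivable_ctn; apply: dPsi|exact: bnd].
by rewrite ler_pdivlMr // leNgt -[X in X < _]mulr1 ltr_pM2l // sc1.
Qed.

(** At a maximum point of [V r], the two curvature inequalities bound the maximum by 324 r^2, with
    324 = 2 * 162. The value at the centre is at least r^4 |th 0|^2, so r^2 |th 0|^2 <= 324 for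
    every r. *)
Lemma sextic_theta0 (s q th : C -> C) :
    (forall z, derivable s z 1) -> (forall z, derivable q z 1) -> (forall z, derivable th z 1) ->
    (forall z, s z ^+ 6 - q z ^+ 6 = 1) ->
    (forall z, 'D_1 s z = th z * q z ^+ 5) -> (forall z, 'D_1 q z = th z * s z ^+ 5) ->
  th 0 = 0.
Proof.
move=> ds dq_ dth sq s' q'.
apply/eqP; apply: contraT => th0.
pose V r z := (r ^+ 2 - nrm z ^+ 2) ^+ 2 *
  (nrm (th z) ^+ 2 * ((1 + nrm (s z) ^+ 2) * (1 + nrm (q z) ^+ 2))).
set t0 := nrm (th 0) ^+ 2; have t00 : 0 < t0 by rewrite exprn_gt0 // nrm_gt0.
have cn (f : C -> C) z : derivable f z 1 -> rctn (fun z => nrm (f z) ^+ 2) z.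
  by move=> df; apply: rctn_nrm2; apply: derivable_ctn.
have cV r z : rctn (V r) z.
  have c1 : rctn (fun z => r ^+ 2 - nrm z ^+ 2) z.
    by apply: rctnB; [exact: rctn_cst|apply: rctn_nrm2; exact: ctn_id].
  have cc := rctnM c1 c1.
  have cs1 : rctn (fun z => 1 + nrm (s z) ^+ 2) z by apply: rctnD; [exact: rctn_cst|exact: cn (ds z)].
  have cq1 : rctn (fun z => 1 + nrm (q z) ^+ 2) z by apply: rctnD; [exact: rctn_cst|exact: cn (dq_ z)].
  exact: (rctnM cc (rctnM (cn _ _ (dth z)) (rctnM cs1 cq1))).
have main r : 0 < r -> t0 * r ^+ 2 <= 324.
  move=> r0; have [a ar Ha] := disc_max r0 (cV r).
  have z0 : nrm (0 : C) <= r by rewrite nrm0 ltW.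
  have V0 : r ^+ 4 * t0 <= V r 0.
    rewrite /V nrm0 expr0n subr0 -exprM ler_pM2l ?exprn_gt0 // -/t0.
    rewrite ler_pMr // -[X in X <= _]mulr1; apply: ler_pM => //; by rewrite lerDl sqr_ge0.
  have Va : 0 < V r a.
    apply: lt_le_trans (Ha 0 z0); apply: lt_le_trans V0.
    by rewrite mulr_gt0 // exprn_gt0.
  have tha : th a != 0.
    by apply: contraTneq Va => E; rewrite /V E nrm0 expr0n mul0r mulr0 ltxx.
  have ar' : nrm a < r.
    rewrite lt_neqAle ar andbT; apply: contraTneq Va => E.
    by rewrite /V E subrr expr0n mul0r ltxx.
  have dsa : dq s a a = th a * q a ^+ 5 by rewrite /dq eqxx s'.
  have dqa : dq q a a = th a * s a ^+ 5 by rewrite /dq eqxx q'.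
  have := max_point_curvature ds dq_ dth dsa dqa ar' tha Ha.
  set D := r ^+ 2 - nrm a ^+ 2.
  have D0 : 0 < D by rewrite subr_gt0 ltr_pXn2r ?nnegrE ?nrm_ge0 // ltW.
  have E5 (x y : C) : nrm (x * y ^+ 5) ^+ 2 = nrm x ^+ 2 * (nrm y ^+ 2) ^+ 5.
    by rewrite (nrmM x) nrmX exprMn -!exprM mulnC.
  rewrite !E5.
  move: Va; rewrite /V -/D.
  have ST : 1 <= (nrm (s a) ^+ 2) ^+ 3 + (nrm (q a) ^+ 2) ^+ 3.
    rewrite -!exprM -!nrmX.
    by have := nrmB (s a ^+ 6) (q a ^+ 6); rewrite sq nrm1; apply.
  have Va : V r a = D ^+ 2 * (nrm (th a) ^+ 2 * ((1 + nrm (s a) ^+ 2) * (1 + nrm (q a) ^+ 2))) by [].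
  have := Ha 0 z0; rewrite Va; move: ST V0.
  set S := nrm (s a) ^+ 2; set T := nrm (q a) ^+ 2; set t := nrm (th a) ^+ 2.
  move=> ST V0 V0a Vpos Hc.
  have S0 : 0 <= S by rewrite sqr_ge0.
  have T0 : 0 <= T by rewrite sqr_ge0.
  have t_ge0 : 0 <= t by rewrite sqr_ge0.
  have := ler_wpM2l t_ge0 (sextic_curvature S0 T0 ST).
  have -> : t * (162 * (T ^+ 5 / (1 + S) ^+ 2 + S ^+ 5 / (1 + T) ^+ 2)) =
    162 * (t * T ^+ 5 / (1 + S) ^+ 2 + t * S ^+ 5 / (1 + T) ^+ 2) by ring.
  move=> Hs; have {}Hs := le_trans Hs (ler_wpM2l (ler0n R 162) Hc).
  have D20 : 0 < D ^+ 2 by rewrite exprn_gt0.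
  have := ler_wpM2l (ltW D20) Hs.
  have -> : D ^+ 2 * (162 * (2 * (r ^+ 2 / D ^+ 2))) = 324 * r ^+ 2 by field; rewrite gt_eqF.
  move=> Hf; have := le_trans V0 (le_trans V0a Hf).
  have -> : r ^+ 4 * t0 = t0 * r ^+ 2 * r ^+ 2 by ring.
  by rewrite ler_pM2r ?exprn_gt0.
(* This is the square of a radius with t0 r^2 = 324 + t0, too large for [main]. *)
have r2 : 0 < 324 / t0 + 1 by apply: addr_gt0 (divr_gt0 _ t00) ltr01; rewrite ltr0n.
have := main (Num.sqrt (324 / t0 + 1)); rewrite sqrtr_gt0 r2 sqr_sqrtr ?(ltW r2) // => /(_ isT).
by rewrite mulrDr mulr1 mulrC divfK ?gt_eqF // gerDl leNgt t00.
Qed.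

End FermatSextic.

(** * Entire functions omitting two values *)

Section Picard.
Variable R : realType.
Local Notation C := (Cplx R).
Implicit Types (z w a c : C) (f g h s q : C -> C).

Lemma primitive_exists f : (forall z, derivable f z 1) ->
  exists F : C -> C, forall z, is_derive z 1 F (f z).
Proof.
move=> df; exists (fun z => seg f 0 z) => z; apply/is_deriveCP => e e0.
have [d d0 Hd] := derivable_ctn (df z) e0; exists d => // h Hh.
have cT : cvx (@setT C) by [].
have lT : lim_closed (@setT C) by [].
have := @goursat _ setT f cT lT (fun z _ => df z) 0 z h I I I.
rewrite /tri add0r => /eqP; rewrite subr_eq0 => /eqP <-.
rewrite [_ + seg f z h]addrC addrK /seg [f z * h]mulrC -mulrBr nrmM mulrC ler_wpM2r ?nrm_ge0 //.
have U : unif_cont (fun t : R => f (z + t%:C * h)).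
  by apply: unif_cont_line => t _; apply: derivable_ctn.
rewrite -[f z]integ_cst -integB //; last exact: unif_cont_cst.
apply: integ_bound; first by apply: unif_contB => //; exact: unif_cont_cst.
move=> t /andP[t0 t1]; apply: Hd; rewrite nrmM nrmR ger0_norm //.
by apply: le_lt_trans Hh; rewrite ler_piMl ?nrm_ge0.
Qed.

Lemma derive0_constant f : (forall z, is_derive z 1 f 0) -> forall z, f z = f 0.
Proof.
move=> df z; apply/eqP; rewrite -subr_eq0 -nrm_eq0; apply/eqP/le_anti.
rewrite nrm_ge0 andbT -[X in f X]add0r -(mul0r (nrm z)).
by apply: mean_value_ineq => t _; exists 0; rewrite ?nrm0.
Qed.

Lemma is_derive_expC f n z a : is_derive z 1 f a ->
  is_derive z 1 (fun x => f x ^+ n.+1) (n.+1%:R * f z ^+ n * a).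
Proof.
move=> df; elim: n => [|n IH].
  apply: is_derive_eq (df) _; by rewrite expr0 !mul1r.
apply: is_derive_eq (is_deriveMC df IH) _.
by rewrite -[in RHS]natr1 !exprS; ring.
Qed.

(** With [F] a primitive of the logarithmic derivative, h exp(-F) has derivative 0. Hence h is a
    constant times exp F, and dividing [F] by [n] takes the root without a choice of branch; the
    constant has a root because the field is closed. *)
Lemma entire_root h n : (0 < n)%N -> (forall z, derivable h z 1) -> (forall z, h z != 0) ->
  exists2 s : C -> C, forall z, derivable s z 1 & forall z, s z ^+ n = h z.
Proof.
move=> n0 dh h0.
have dh' z : derivable ('D_1 h) z 1.
  by apply: derive_derivable; apply/near_nrmP; exists 1; [exact: ltr01|move=> w _; apply: dh].
have dl z : derivable (fun z => 'D_1 h z / h z) z 1 := derivable_divC (h0 z) (dh' z) (dh z).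
have [F dF] := primitive_exists dl.
pose G z := h z * cexp (- F z).
have dG z : is_derive z 1 G 0.
  have d1 : is_derive z 1 (fun z => - F z) (- ('D_1 h z / h z)).
    by have := is_deriveBC (is_derive_cstC 0 z) (dF z); rewrite sub0r; congr is_derive; apply/funext => x; rewrite sub0r.
  have d2 := is_derive_compC d1 (is_derive_cexp (- F z)).
  apply: is_derive_eq (is_deriveMC (derivable_derive (dh z)) d2) _.
  have gen (x y e : C) : y != 0 -> x * e + y * (e * - (x / y)) = 0 by move=> ?; field.
  exact: gen (h0 z).
have Gc := derive0_constant dG.
have hE z : h z = G 0 * cexp (F z).
  by rewrite -(Gc z) /G cexpN mulfVK // cexp_neq0.
exists (fun z => n.-root (G 0) * cexp (n%:R^-1 * F z)) => z.
  have d1 : is_derive z 1 (fun z => n%:R^-1 * F z) _ := is_deriveMC (is_derive_cstC _ z) (dF z).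
  have d2 := is_derive_compC d1 (is_derive_cexp _).
  exact: is_derive_derivable (is_deriveMC (is_derive_cstC _ z) d2).
rewrite exprMn rootCK // -cexpMn mulVKf ?hE //.
by rewrite pnatr_eq0 -lt0n.
Qed.

Lemma is_derive_shiftC f c z a : is_derive (z + c) 1 f a -> is_derive z 1 (fun x => f (x + c)) a.
Proof.
move=> df; have d1 := is_deriveDC (is_derive_idC z) (is_derive_cstC c z).
by apply: is_derive_eq (is_derive_compC d1 df) _; rewrite addr0 mulr1.
Qed.

Lemma picard01 h : (forall z, derivable h z 1) -> (forall z, h z != 0) -> (forall z, h z != 1) ->
  forall z, h z = h 0.
Proof.
move=> dh h0 h1.
have [s ds sE] := entire_root (isT : (0 < 6)%N) dh h0.
have dh1 z : derivable (fun z => h z - 1) z 1.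
  exact: (derivableBC (dh z) (@derivable_cstC _ 1 z)).
have h10 z : h z - 1 != 0 by rewrite subr_eq0.
have [q dq' qE] := entire_root (isT : (0 < 6)%N) dh1 h10.
have q0 z : q z != 0.
  by apply: contraNneq (h10 z) => E; rewrite -qE E expr0n.
have s0 z : s z != 0.
  by apply: contraNneq (h0 z) => E; rewrite -sE E expr0n.
have sq z : s z ^+ 6 - q z ^+ 6 = 1 by rewrite sE qE opprB addrC subrK.
have ds' z : derivable ('D_1 s) z 1.
  by apply: derive_derivable; apply/near_nrmP; exists 1; [exact: ltr01|move=> w _; apply: ds].
(* Differentiating s^6 - q^6 = 1 gives s^5 s' = q^5 q', so s' / q^5 and q' / s^5 are the same
   function. It is entire because [q] has no zero. *)
pose th z := 'D_1 s z / q z ^+ 5.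
have dth z : derivable th z 1.
  have d1 := is_derive_derivable (is_derive_expC 4 (derivable_derive (dq' z))).
  by apply: (derivable_divC _ (ds' z) d1); rewrite expf_neq0.
have sth z : 'D_1 s z = th z * q z ^+ 5 by rewrite /th divfK // expf_neq0.
have qth z : 'D_1 q z = th z * s z ^+ 5.
  have d1 := is_derive_expC 5 (derivable_derive (ds z)).
  have d2 := is_derive_expC 5 (derivable_derive (dq' z)).
  have := is_deriveBC d1 d2.
  have -> : (fun x => s x ^+ 6 - q x ^+ 6) = (fun=> 1) by apply/funext => x; exact: sq.
  move=> d3; have E := is_derive_val d3; rewrite (is_derive_val (is_derive_cstC 1 z)) in E.
  have n6 : (6 : C) != 0 by rewrite pnatr_eq0.
  have q5 : q z ^+ 5 != 0 by rewrite expf_neq0.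
  rewrite /th; move: ('D_1 s z) ('D_1 q z) E => x y E.
  apply: (mulfI q5); apply: (mulfI n6).
  rewrite mulrA -[LHS]add0r E; move: q5 n6; move: (q z ^+ 5) (s z ^+ 5) => b b'.
  by move=> b0 n6; field.
(* [sextic_theta0] speaks of the origin only; its hypotheses are invariant under translation. *)
have th0 c : th c = 0.
  rewrite -[c in th c]add0r.
  apply: (@sextic_theta0 _ (fun x => s (x + c)) (fun x => q (x + c)) (fun x => th (x + c))).
  - move=> z; exact: is_derive_derivable (@is_derive_shiftC s c z _ (derivable_derive (ds (z + c)))).
  - move=> z; exact: is_derive_derivable (@is_derive_shiftC q c z _ (derivable_derive (dq' (z + c)))).
  - move=> z; exact: is_derive_derivable (@is_derive_shiftC th c z _ (derivable_derive (dth (z + c)))).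
  - by move=> z; exact: sq.
  - by move=> z; rewrite (is_derive_val (@is_derive_shiftC s c z _ (derivable_derive (ds (z + c))))) sth.
  - by move=> z; rewrite (is_derive_val (@is_derive_shiftC q c z _ (derivable_derive (dq' (z + c))))) qth.
have ds0 z : is_derive z 1 s 0.
  by have := derivable_derive (ds z); rewrite sth th0 mul0r.
by move=> z; rewrite -!sE (derive0_constant ds0 z).
Qed.

Lemma little_picard h (c1 c2 : C) : (forall z, derivable h z 1) -> c1 != c2 ->
  (forall z, h z != c1) -> (forall z, h z != c2) -> forall z, h z = h 0.
Proof.
move=> dh c12 h1 h2 z; have c0 : c2 - c1 != 0 by rewrite subr_eq0 eq_sym.
have d1 x : derivable (fun z => (h z - c1) * (c2 - c1)^-1) x 1.
  by apply: (derivableMC (derivableBC (dh x) (@derivable_cstC _ c1 x)) (@derivable_cstC _ _ x)).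
have := @picard01 (fun z => (h z - c1) * (c2 - c1)^-1) d1.
move=> /(_ _ _ z) H; have /(mulIf _) : (h z - c1) * (c2 - c1)^-1 = (h 0 - c1) * (c2 - c1)^-1.
  apply: H => x; first by apply: mulf_neq0; [rewrite subr_eq0; exact: h1|exact: invr_neq0].
  apply: contraNneq (h2 x) => /(congr1 (fun y => y * (c2 - c1))).
  by rewrite divfK // mul1r => /(congr1 (+%R^~ c1)); rewrite !subrK => ->.
by move=> /(_ (invr_neq0 c0)) /(congr1 (+%R^~ c1)); rewrite !subrK.
Qed.

End Picard.

(** * Holomorphic functions of several variables *)

Section Frechet.
Variable R : realType.
Local Notation C := (Cplx R).
Variable V : normedModType C.
Implicit Types (x y z w v h k : V) (t s : C) (r d e B : R) (f psi : V -> C).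

Lemma differentiable_eps f x : differentiable f x -> forall e, 0 < e ->
  exists2 d, 0 < d & forall h, nrm h < d -> nrm (f (x + h) - f x - 'd f x h) <= e * nrm h.
Proof.
move=> /diff_locally/eqaddoP H e e0.
have e0' : 0 < (e%:C : C) by rewrite -CR0 ltCR.
have [d d0 Hd] := (near0_nrmP (0 : V) _).1 (H _ e0').
exists d => // h /Hd.
rewrite add0r -[X in `|X|]/(f (h + x) - (f x + 'd f x h)) !normE -CRM leCR.
by rewrite [h + x]addrC opprD addrA.
Qed.

(** A differential must be continuous, which linearity alone does not give on an arbitrary normed
    space; the bound by [K] supplies it. *)
Lemma differentiable_intro f x (L : {linear V -> C}) (K : R) :
    (forall h, nrm (L h) <= K * nrm h) ->
    (forall e, 0 < e -> exists2 d, 0 < d &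
       forall h, nrm h < d -> nrm (f (x + h) - f x - L h) <= e * nrm h) ->
  differentiable f x /\ 'd f x = L :> (V -> C).
Proof.
move=> LK H.
have Lc : continuous L.
  move=> y; apply: (iffRL (@cvgrPdist_le _ _ _ _ (nbhs_filter y) _ _)) => e.
  rewrite ltcE => /andP[/eqP /= ei e0].
  have K1 : 0 < `|K| + 1 by rewrite ltr_wpDl.
  apply: (near0_nrmP (y : V) _).2; exists (complex.Re e / (`|K| + 1)); first by rewrite divr_gt0.
  move=> h; rewrite ltr_pdivlMr // => Hh.
  have -> : L y - L (y + h) = - L h by rewrite linearD opprD addrA subrr add0r.
  rewrite normrN normE.
  have -> : e = (complex.Re e)%:C by case: e ei {e0 Hh} => u v /= ->.
  rewrite leCR; apply: le_trans (LK h) _; apply: le_trans (ltW Hh).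
  by rewrite mulrC ler_wpM2l ?nrm_ge0 //; have := ler_norm K; lra.
have Ho : f \o shift x = cst (f x) + L +o_ (0 : V) id.
  apply/eqaddoP => e; rewrite ltcE => /andP[/eqP /= ei e0].
  have [d d0 Hd] := H _ e0.
  apply: (near0_nrmP (0 : V) _).2; exists d => // h /Hd; rewrite add0r.
  rewrite -[X in _ -> `|X| <= _]/(f (h + x) - (f x + L h)) !normE.
  have -> : e = (complex.Re e)%:C by case: e ei {e0 Hd} => u v /= ->.
  by rewrite -CRM leCR [h + x]addrC opprD addrA.
have E := diff_unique Lc Ho; split; last exact: E.
by apply/diff_locallyP; rewrite E.
Qed.

Lemma differentiable_line f x v t : differentiable f (x + t *: v) ->
  is_derive t 1 (fun s : C => f (x + s *: v)) ('d f (x + t *: v) v).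
Proof.
move=> df; apply/is_deriveCP => e e0.
have v0 : 0 < nrm v + 1 by rewrite ltr_wpDl ?nrm_ge0.
have [d d0 Hd] := differentiable_eps df (divr_gt0 e0 v0).
exists (d / (nrm v + 1)); first by rewrite divr_gt0.
move=> h; rewrite ltr_pdivlMr // => Hh.
have Hv : nrm (h *: v) < d.
  by apply: le_lt_trans Hh; rewrite nrmZ ler_wpM2l ?nrm_ge0 // lerDl.
have E : x + t *: v + h *: v = x + (t + h) *: v by rewrite -addrA -scalerDl.
have := Hd _ Hv; rewrite linearZ E nrmZ /= => H.
rewrite [_ * h]mulrC; apply: le_trans H _.
have -> : e / (nrm v + 1) * (nrm h * nrm v) = e * nrm h * (nrm v / (nrm v + 1)) by ring.
by rewrite ler_piMr ?mulr_ge0 ?nrm_ge0 ?(ltW e0) // ler_pdivrMr // mul1r lerDl.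
Qed.

Lemma diff_val_line f x v : differentiable f x ->
  is_derive (0 : C) 1 (fun s : C => f (x + s *: v)) ('d f x v).
Proof.
move=> df; have := @differentiable_line f x v 0.
by rewrite scale0r addr0; apply.
Qed.

Section LocalEstimates.
Variables (psi : V -> C) (x : V) (rho B : R).
Hypotheses (rho0 : 0 < rho).
Hypothesis Hpsi : forall y, nrm (y - x) < rho -> differentiable psi y /\ nrm (psi y) <= B.

Let B0 : 0 <= B.
Proof.
have [] := Hpsi (y := x); first by rewrite subrr nrm0.
by move=> _; apply: le_trans (nrm_ge0 _).
Qed.

Let line_in h (T : R) t : 0 <= T -> T * nrm h <= rho / 2 -> nrm (t - 0) <= T -> nrm (x + t *: h - x) < rho.
Proof.
move=> T0 Th tT; rewrite [x + _]addrC addrK nrmZ.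
apply: (@le_lt_trans _ _ (rho / 2)); last by move: rho0; lra.
by apply: le_trans Th; rewrite ler_wpM2r ?nrm_ge0 //; rewrite subr0 in tT.
Qed.

(** The one-variable Cauchy estimate on the line through [x] in the direction [h]. The radius T =
    rho / (2 |h|) is chosen so that the parameter disc is sent into the ball of radius rho / 2. *)
Lemma frechet_bound h : nrm ('d psi x h) <= 4 * B / rho * nrm h.
Proof.
have [->|h0] := eqVneq h 0; first by rewrite linear0 !nrm0 mulr0.
have hn : 0 < nrm h by rewrite nrm_gt0.
pose T := rho / (2 * nrm h); have T0 : 0 < T by rewrite divr_gt0 // mulr_gt0.
have Th : T * nrm h <= rho / 2 by rewrite /T le_eqVlt; apply/orP; left; apply/eqP; field; rewrite gt_eqF.
have dx : differentiable psi x by have [] := Hpsi (y := x); first by rewrite subrr nrm0.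
rewrite -(is_derive_val (diff_val_line h dx)).
have -> : 4 * B / rho * nrm h = 2 * B / T.
  by rewrite /T; field; rewrite !gt_eqF.
apply: (@cauchy_estimate _ (fun s => psi (x + s *: h)) 0 T B T0) => t tT.
  apply: is_derive_derivable; apply: differentiable_line.
  by have [] := Hpsi (line_in (ltW T0) Th tT).
by have [] := Hpsi (line_in (ltW T0) Th tT).
Qed.

Lemma frechet_quad h : nrm h <= rho / 8 ->
  nrm (psi (x + h) - psi x - 'd psi x h) <= 128 * B / rho ^+ 2 * nrm h ^+ 2.
Proof.
move=> h8; have [->|h0] := eqVneq h 0.
  by rewrite linear0 addr0 subrr subrr !nrm0 expr0n mulr0.
have hn : 0 < nrm h by rewrite nrm_gt0.
pose T := rho / (2 * nrm h); have T0 : 0 < T by rewrite divr_gt0 // mulr_gt0.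
have Th : T * nrm h <= rho / 2 by rewrite /T le_eqVlt; apply/orP; left; apply/eqP; field; rewrite gt_eqF.
have dx : differentiable psi x by have [] := Hpsi (y := x); first by rewrite subrr nrm0.
have E := is_derive_val (diff_val_line h dx).
have d1 t : nrm (t - 0) <= T -> derivable (fun s : C => psi (x + s *: h)) t 1.
  move=> tT; apply: is_derive_derivable; apply: differentiable_line.
  by have [] := Hpsi (line_in (ltW T0) Th tT).
have d2 t : nrm (t - 0) <= T -> nrm (psi (x + t *: h)) <= B.
  by move=> tT; have [] := Hpsi (line_in (ltW T0) Th tT).
(* The increment of the parameter is 1, and [quad_est] wants it at most T / 4: this is the
   hypothesis [nrm h <= rho / 8]. *)
have := @quad_est _ _ 0 T B T0 d1 d2 1.
rewrite E add0r scale1r scale0r addr0 mulr1 nrm1 expr1n mulr1.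
have -> : 32 * B / T ^+ 2 = 128 * B / rho ^+ 2 * nrm h ^+ 2.
  by rewrite /T; field; rewrite !gt_eqF.
apply; rewrite /T ler_pdivlMr // mul1r ler_pdivlMr ?mulr_gt0 //.
by move: h8; lra.
Qed.

End LocalEstimates.

(** The Cauchy estimate for the difference [g] of [psi] on the parallel lines through [y] and [x].
    By the mean value inequality [g] is at most (8 B / rho) |y - x| on the disc of radius rho / (4
    |h|), hence the constant 64. *)
Lemma frechet_lipschitz psi x rho B y h : 0 < rho ->
    (forall y, nrm (y - x) < rho -> differentiable psi y /\ nrm (psi y) <= B) ->
  nrm (y - x) <= rho / 4 ->
  nrm ('d psi y h - 'd psi x h) <= 64 * B / rho ^+ 2 * nrm (y - x) * nrm h.
Proof.
move=> rho0 Hpsi yx.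
have [->|h0] := eqVneq h 0.
  have l0 z : 'd psi z 0 = 0 by rewrite linear0.
  by rewrite !l0 subr0 !nrm0 mulr0.
have hn : 0 < nrm h by rewrite nrm_gt0.
pose T := rho / (4 * nrm h); have T0 : 0 < T by rewrite divr_gt0 // mulr_gt0.
have Th : T * nrm h = rho / 4 by rewrite /T; field; rewrite gt_eqF.
have tin t : nrm (t - 0) <= T -> nrm (t *: h) <= rho / 4.
  by rewrite subr0 => tT; rewrite nrmZ -Th ler_wpM2r ?nrm_ge0.
have near_in z : nrm (z - x) <= rho / 2 -> nrm (z - x) < rho.
  by move=> H; apply: le_lt_trans H _; lra.
have ball2 z : nrm (z - x) <= rho / 2 -> forall w, nrm (w - z) < rho / 2 ->
    differentiable psi w /\ nrm (psi w) <= B.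
  move=> Hz w Hw; apply: Hpsi; apply: le_lt_trans (nrm_triangle _ z _) _; lra.
have rho2 : 0 < rho / 2 by rewrite divr_gt0.
have in1 t : nrm (t - 0) <= T -> nrm (x + t *: h - x) <= rho / 2.
  move=> /tin; rewrite [x + _]addrC addrK; lra.
have in2 t : nrm (t - 0) <= T -> nrm (y + t *: h - x) <= rho / 2.
  by move=> /tin tT; rewrite addrAC (le_trans (nrmD _ _)) //; lra.
have dd z : nrm (z - x) <= rho / 2 -> differentiable psi z by move=> /near_in/Hpsi[].
have dx : differentiable psi x by apply: dd; rewrite subrr nrm0 ltW.
have dy : differentiable psi y by apply: dd; lra.
pose g (t : C) := psi (y + t *: h) - psi (x + t *: h).
have Dg := is_deriveBC (diff_val_line h dy) (diff_val_line h dx).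
rewrite -(is_derive_val Dg).
have -> : 64 * B / rho ^+ 2 * nrm (y - x) * nrm h = 2 * (8 * B / rho * nrm (y - x)) / T.
  by rewrite /T; field; rewrite !gt_eqF.
apply: (@cauchy_estimate _ g 0 T _ T0) => t tT.
  apply: (derivableBC (f := fun t => psi (y + t *: h)) (g := fun t => psi (x + t *: h))).
    by apply: is_derive_derivable; apply: differentiable_line; apply: dd; apply: in2.
  by apply: is_derive_derivable; apply: differentiable_line; apply: dd; apply: in1.
pose k (s : C) := psi (x + t *: h + s *: (y - x)).
have -> : g t = k (0 + 1) - k 0.
  rewrite /g /k add0r scale1r scale0r addr0.
  by have -> : x + t *: h + (y - x) = y + t *: h by rewrite addrAC [x + (y - x)]addrC subrK.
apply: (@le_trans _ _ (8 * B / rho * nrm (y - x) * nrm (1 : C))); last by rewrite nrm1 mulr1.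
apply: mean_value_ineq => u /andP[u0 u1].
have Hu : nrm (x + t *: h + (0 + u%:C * 1) *: (y - x) - x) <= rho / 2.
  rewrite add0r mulr1; have -> : x + t *: h + u%:C *: (y - x) - x = t *: h + u%:C *: (y - x).
    by rewrite -[x + _ + _]addrA [x + _]addrC addrK.
  apply: le_trans (nrmD _ _) _; have := tin _ tT; rewrite [nrm (_ *: (y - x))]nrmZ nrmR ger0_norm //.
  have : u * nrm (y - x) <= nrm (y - x) by rewrite ler_piMl ?nrm_ge0.
  by move: yx; clear -V; lra.
exists ('d psi (x + t *: h + (0 + u%:C * 1) *: (y - x)) (y - x)).
  by apply: differentiable_line; apply: dd.
have := frechet_bound rho2 (ball2 _ Hu) (y - x).
have -> : 4 * B / (rho / 2) = 8 * B / rho by field; rewrite gt_eqF.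
exact.
Qed.

Lemma near_continuous_bounded psi x : (\forall w \near x, differentiable psi w) ->
  exists2 d, 0 < d & forall w, nrm (w - x) < d -> differentiable psi w /\ nrm (psi w) <= d^-1.
Proof.
move=> H; have [d1 d10 H1] := (near_nrmP x _).1 H.
have dx : differentiable psi x by apply: H1; rewrite subrr nrm0.
have c0 : 0 < (nrm (psi x) + 1)^-1 by rewrite invr_gt0 ltr_wpDl ?nrm_ge0.
have := differentiable_continuous dx => cx.
have [d2 d20 H2] := (near_nrmP x _).1
  (iffLR (@cvgrPdist_le _ _ _ _ (nbhs_filter x) _ _) cx 1 ltr01).
exists (Num.min d1 (Num.min d2 (nrm (psi x) + 1)^-1)); first by rewrite !lt_min d10 d20.
move=> w; rewrite !lt_min => /andP[/H1 w1 /andP[/H2 w2 _]]; split=> //.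
apply: (@le_trans _ _ (nrm (psi x) + 1)).
  move: w2; rewrite normE -CR1 leCR nrmBC => w2.
  by rewrite -[psi w](subrK (psi x)) addrC (le_trans (nrmD _ _)) // lerD2l.
by rewrite -[X in X <= _]invrK lef_pV2 ?posrE ?lt_min ?d10 ?d20 // !ge_min lexx !orbT.
Qed.

(** Differentiation under the integral: the differential is the mean [L] of the differentials of
    [psi] along the circle, and the quadratic remainder is uniform there. It turns functions
    constructed separately on parallel lines into holomorphic functions of all variables. *)
Lemma holomorphic_cmean psi y v r : 0 < r ->
    (forall s, nrm s = r -> \forall w \near (y + s *: v), differentiable psi w) ->
  \forall w \near y, differentiable (fun w => cmean 0 r (fun s => psi (w + s *: v))) w.
Proof.
move=> r0 H.
have v0 : 0 < nrm v + 1 by rewrite ltr_wpDl ?nrm_ge0.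
have cgam (s : R) : 0 <= s <= 1 -> forall e, 0 < e -> exists2 d, 0 < d & forall t : R, 0 <= t <= 1 ->
    `|t - s| < d -> nrm ((y + circ 0 r t *: v) - (y + circ 0 r s *: v)) <= e.
  move=> s01 e e0; have [d d0 Hd] := ptw_cont_circ 0 r s01 (divr_gt0 e0 v0).
  exists d => // t t01 /(Hd _ t01); rewrite ler_pdivlMr // => Hts.
  rewrite opprD addrACA subrr add0r -scalerBl nrmZ; apply: le_trans Hts.
  by rewrite ler_wpM2l ?nrm_ge0 // lerDl.
(* Radius and bound share the parameter [d], so the compactness lemma returns one [rho] that is a
   radius of differentiability and whose inverse bounds [psi] all along the circle. *)
pose P d (w : V) := forall w', nrm (w' - w) < d -> differentiable psi w' /\ nrm (psi w') <= d^-1.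
have [rho rho0 Hrho] : exists2 d, 0 < d & forall t : R, 0 <= t <= 1 -> forall w,
    nrm (w - (y + circ 0 r t *: v)) < d -> P d w.
  apply: (@segment_tube _ _ _ P cgam) => [d d' w /andP[d'0 dd'] Pd w' Hw'|t t01].
    have [|h1 h2] := Pd w'; first exact: lt_le_trans dd'.
    by split=> //; apply: le_trans h2 _; rewrite lef_pV2 // posrE (lt_le_trans d'0).
  have Hs : nrm (circ 0 r t) = r by rewrite -[circ 0 r t]subr0 nrm_circ // ltW.
  have [d d0 Hd] := near_continuous_bounded (H _ Hs).
  exists (d / 2); first by rewrite divr_gt0.
  move=> w Hw w' Hw'.
  have [|h1 h2] := Hd w'; first by apply: le_lt_trans (nrm_triangle _ w _) _; lra.
  split=> //; apply: le_trans h2 _; rewrite lef_pV2 ?posrE ?divr_gt0 //; lra.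
set B := rho^-1 in Hrho; have B0 : 0 < B by rewrite invr_gt0.
apply: (near_nrmP y _).2; exists rho => // w Hw.
have loc (t : R) : 0 <= t <= 1 -> forall x, nrm (x - (w + circ 0 r t *: v)) < rho ->
    differentiable psi x /\ nrm (psi x) <= B.
  move=> t01 x Hx; apply: (Hrho t t01 (w + circ 0 r t *: v)); last exact: Hx.
  by rewrite opprD addrACA subrr addr0.
pose X (t : R) := w + circ 0 r t *: v.
have cX (s : R) : 0 <= s <= 1 -> forall e, 0 < e -> exists2 d, 0 < d & forall t : R, 0 <= t <= 1 ->
    `|t - s| < d -> nrm (X t - X s) <= e.
  move=> s01 e e0; have [d d0 Hd] := cgam s s01 e e0; exists d => // t t01 /(Hd t t01).
  by rewrite /X opprD addrACA subrr add0r opprD addrACA subrr add0r.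
have dX (t : R) : 0 <= t <= 1 -> differentiable psi (X t).
  by move=> t01; have [] := loc t t01 (X t); first by rewrite subrr nrm0.
pose K := 64 * B / rho ^+ 2.
have K0 : 0 < K by rewrite divr_gt0 ?exprn_gt0 // mulr_gt0.
have UD h : unif_cont (fun t : R => 'd psi (X t) h).
  apply: heine_cantor => s s01 e e0.
  have h1 : 0 < K * (nrm h + 1) by rewrite mulr_gt0 // ltr_wpDl ?nrm_ge0.
  have e1 : 0 < Num.min (rho / 4) (e / (K * (nrm h + 1))) by rewrite lt_min !divr_gt0.
  have [d d0 Hd] := cX s s01 _ e1; exists d => // t t01 /(Hd t t01).
  rewrite le_min => /andP[t4]; rewrite ler_pdivlMr // => th.
  apply: le_trans (frechet_lipschitz h rho0 (loc s s01) t4) _.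
  apply: le_trans th; rewrite -/K [K * nrm _]mulrC -mulrA ler_wpM2l ?nrm_ge0 //.
  by rewrite ler_pM2l // lerDl.
have Upsi u : nrm u < rho -> unif_cont (fun t : R => psi (X t + u)).
  move=> Hu; apply: heine_cantor => s s01 e e0.
  have [|dxu _] := loc s s01 (X s + u); first by rewrite addrC addKr.
  have [d d0 Hd] := (near0_nrmP (X s + u) _).1
    (iffLR (@cvgrPdist_le _ _ _ _ (nbhs_filter (X s + u)) _ _)
       (differentiable_continuous dxu) (e%:C) (ltac:(by rewrite -CR0 ltCR))).
  have d2 : 0 < d / 2 by rewrite divr_gt0.
  have [d' d'0 Hd'] := cX s s01 _ d2; exists d' => // t t01 /(Hd' t t01) Ht.
  have Htd : nrm (X t - X s) < d by apply: le_lt_trans Ht _; rewrite ltr_pdivrMr // ltr_pMr // ltr1n.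
  have := Hd _ Htd; rewrite normE leCR nrmBC.
  by have -> : X s + u + (X t - X s) = X t + u by rewrite addrAC [X s + _]addrC subrK.
have ME u : nrm u < rho -> cmean 0 r (fun s => psi (w + u + s *: v)) = integ (fun t : R => psi (X t + u)).
  by move=> _; congr integ; apply/funext => t; rewrite addrAC.
pose L h := integ (fun t : R => 'd psi (X t) h).
have Llin : linear L.
  move=> a h k; rewrite -[RHS]/(a * L h + L k) /L -integZ // -integD //; last exact: unif_contZ.
  by congr integ; apply/funext => t; rewrite linearP.
pose HL := GRing.isLinear.Build C V C _ L Llin.
pose LL : {linear V -> C} := HB.pack L HL.
have LK h : nrm (LL h) <= 4 * B / rho * nrm h.
  by apply: integ_bound => // t t01; exact: (frechet_bound rho0 (loc t t01)).
apply: (differentiable_intro LK _).1 => e e0.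
pose K2 := 128 * B / rho ^+ 2.
have K20 : 0 < K2 by apply: divr_gt0; [apply: mulr_gt0 => //; rewrite ltr0n|exact: exprn_gt0].
exists (Num.min (rho / 8) (e / K2)); first by rewrite lt_min (divr_gt0 e0 K20) divr_gt0.
move=> h; rewrite lt_min => /andP[h8]; rewrite ltr_pdivlMr // => he.
have h1 : nrm h < rho by apply: lt_trans h8 _; lra.
have z1 : nrm (0 : V) < rho by rewrite nrm0.
rewrite ME // -{1}[w]addr0 ME // -integB; [|exact: Upsi|exact: Upsi].
rewrite -[LL h]/(integ (fun t : R => 'd psi (X t) h)) -integB //; last by apply: unif_contB; exact: Upsi.
apply: (@le_trans _ _ (K2 * nrm h ^+ 2)); last first.
  by rewrite expr2 mulrA ler_wpM2r ?nrm_ge0 // mulrC ltW.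
apply: integ_bound; first by apply: unif_contB => //; apply: unif_contB; exact: Upsi.
by move=> t t01; rewrite addr0; apply: (frechet_quad rho0 (loc t t01)); exact: ltW.
Qed.

End Frechet.

(** * Points of indeterminacy *)

Section ZerosOnLines.
Variable R : realType.
Local Notation C := (Cplx R).
Implicit Types (t s a b : C) (r d e B : R) (phi psi P Q chi : C -> C).

Lemma ctn_neq0 P a : ctn P a -> P a != 0 -> \forall t \near a, P t != 0.
Proof.
move=> cP; rewrite -nrm_gt0 => Pa.
have [d d0 Hd] := rctn_lt (@rctn_cst R 0 a) (rctn_nrm cP) Pa.
by apply/near0_nrmP; exists d => // h /Hd; rewrite nrm_gt0.
Qed.

Lemma derivable_expC phi n a : derivable phi a 1 -> derivable (fun t => phi t ^+ n) a 1.
Proof.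
case: n => [|n] dphi; first exact: derivable_cstC.
exact: is_derive_derivable (is_derive_expC n (derivable_derive dphi)).
Qed.

Lemma derivable_shiftC phi (c a : C) : derivable phi (a + c) 1 -> derivable (fun t => phi (t + c)) a 1.
Proof. by move=> dphi; exact: is_derive_derivable (@is_derive_shiftC _ phi c a _ (derivable_derive dphi)). Qed.

Lemma derivable_cofactor phi P n a : (forall t, phi t = t ^+ n * P t) ->
  derivable P 0 1 -> derivable phi a 1 -> derivable P a 1.
Proof.
move=> E dP dphi; have [->|a0] := eqVneq a 0; first exact: dP.
apply: (@derivable_near _ (fun t => phi t / t ^+ n)).
  have /near0_nrmP[d d0 Hd] := ctn_neq0 (@ctn_id _ a) a0.
  apply/near0_nrmP; exists d => // h /Hd h0.
  by rewrite E mulrC mulKf // expf_neq0.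
have an : a ^+ n != 0 by rewrite expf_neq0.
have dn := @derivable_expC (fun t => t) n a (is_derive_derivable (is_derive_idC a)).
exact: (@derivable_divC _ phi (fun t => t ^+ n) a an dphi dn).
Qed.

Lemma removable_quotient phi psi (D : C -> Prop) :
    (forall t0, D t0 -> exists chi, [/\ derivable chi t0 1,
       \forall t \near t0, psi t = phi t * chi t & \forall t \near t0, t != t0 -> phi t != 0]) ->
  exists chi, forall t0, D t0 -> derivable chi t0 1 /\ psi t0 = phi t0 * chi t0.
Proof.
move=> H.
have H' t0 : exists chi, D t0 -> [/\ derivable chi t0 1,
       \forall t \near t0, psi t = phi t * chi t & \forall t \near t0, t != t0 -> phi t != 0].
  have [/H[chi Hchi]|nD] := pselect (D t0); first by exists chi.
  by exists phi.
have [X HX] := choice H'.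
(* Away from the zeros of [phi] the quotient is forced. At a zero t the value comes from the local
   quotient attached to t itself; zeros being isolated, [chi] agrees near each point of [D] with the
   local quotient there. *)
pose chi t := if phi t == 0 then X t t else psi t / phi t.
exists chi => t0 D0; have [d1 d2 d3] := HX _ D0.
have E : \forall t \near t0, X t0 t = chi t.
  near=> t.
  have h2 : psi t = phi t * X t0 t by near: t.
  have h3 : t != t0 -> phi t != 0 by near: t.
  rewrite /chi; case: eqVneq => [E|p0]; last by rewrite h2 mulrC mulKf.
  have [-> //|tt0] := eqVneq t t0.
  by have := h3 tt0; rewrite E eqxx.
split; first exact: derivable_near E d1.
rewrite -(nbhs_singleton E); exact: nbhs_singleton d2.
Unshelve. all: by end_near.
Qed.

Variable V : normedModType C.
Implicit Types (w x y z : V) (f : V -> C).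

Lemma differentiable_ctn f x : differentiable f x -> forall e, 0 < e ->
  exists2 d, 0 < d & forall y, nrm (y - x) < d -> nrm (f y - f x) <= e.
Proof.
move=> /differentiable_continuous cf e e0.
have e0' : 0 < (e%:C : C) by rewrite -CR0 ltCR.
have [d d0 Hd] := (near_nrmP x _).1 (iffLR (@cvgrPdist_le _ _ _ _ (nbhs_filter x) _ _) cf _ e0').
by exists d => // y /Hd; rewrite normE leCR nrmBC.
Qed.

Lemma differentiable_neq0 f x : differentiable f x -> f x != 0 ->
  exists2 d, 0 < d & forall y, nrm (y - x) < d -> nrm (f x) / 2 <= nrm (f y).
Proof.
move=> df f0; have f20 : 0 < nrm (f x) / 2 by rewrite divr_gt0 // nrm_gt0.
have [d d0 Hd] := differentiable_ctn df f20; exists d => // y /Hd.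
by have := nrm_sub (f x) (f y); rewrite [nrm (f x - _)]nrmBC; lra.
Qed.

Lemma near_differentiable_div (p q : V -> C) x :
    (\forall w \near x, differentiable p w) -> (\forall w \near x, differentiable q w) ->
  q x != 0 -> \forall w \near x, differentiable (fun w => p w / q w) w.
Proof.
move=> dp dq' q0; have dqx := nbhs_singleton dq'.
have [d d0 Hd] := differentiable_neq0 dqx q0.
have nz : \forall w \near x, q w != 0.
  apply/near_nrmP; exists d => // w /Hd H; rewrite -nrm_gt0.
  by apply: lt_le_trans H; rewrite divr_gt0 // nrm_gt0.
move: dp dq' nz => /near_nrmP[d1 d10 H1] /near_nrmP[d2 d20 H2] /near_nrmP[d3 d30 H3].
apply/near_nrmP; exists (Num.min d1 (Num.min d2 d3)); first by rewrite !lt_min d10 d20.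
move=> w; rewrite !lt_min => /andP[/H1 w1 /andP[/H2 w2 /H3 w3]].
exact: differentiableM w1 (differentiableV w2 w3).
Qed.

Variable v : V.

(** Compactness of the parameter set [K], closed in the disc of radius [r]. Closedness makes the
    property vacuous near every parameter outside [K], so [square_tube] can be run over the whole
    disc. *)
Lemma tube_near y (K : C -> Prop) r (G : R -> V -> Prop) : 0 < r ->
    (forall t, K t -> nrm t <= r) ->
    (forall t, ~ K t -> exists2 d, 0 < d & forall s, nrm (s - t) < d -> ~ K s) ->
    (forall d d' x, 0 < d' <= d -> G d x -> G d' x) ->
    (forall t, K t -> exists2 d, 0 < d & forall x, nrm (x - (y + t *: v)) < d -> G d x) ->
  exists2 d, 0 < d & forall w, nrm (w - y) < d -> forall t, K t -> G d (w + t *: v).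
Proof.
move=> r0 Kr Kc Gm H.
have v0 : 0 < nrm v + 1 by rewrite ltr_wpDl ?nrm_ge0.
pose Q d t := K t -> forall w, nrm (w - y) < d -> G d (w + t *: v).
have [d d0 Hd] : exists2 d, 0 < d & forall t, nrm t <= r -> Q d t.
  apply: (@square_tube R r Q r0) => [d d' t /andP[d'0 dd'] Hd Kt w Hw|t].
    apply: (Gm d); first by rewrite d'0.
    by apply: Hd => //; apply: lt_le_trans dd'.
  have [Kt|nKt] := pselect (K t); last first.
    have [d d0 Hd] := Kc _ nKt; exists d => // s Hs Ks; by case: (Hd _ Hs).
  have [d d0 Hd] := H _ Kt.
  pose d' := d / (2 * (nrm v + 1)).
  have d'0 : 0 < d' by rewrite divr_gt0 // mulr_gt0.
  have dE : d = 2 * d' * (nrm v + 1) by rewrite /d'; field; rewrite gt_eqF.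
  have d'd : d' <= d / 2.
    rewrite dE ler_pdivlMr // mulrC -mulrA ler_pM2l // ler_peMr ?(ltW d'0) //.
    by rewrite lerDr nrm_ge0.
  exists d' => // s Hs Ks w Hw; apply: (Gm d); first by rewrite d'0 /=; move: d'd d0; clear -v; lra.
  apply: Hd.
  have -> : w + s *: v - (y + t *: v) = (w - y) + (s - t) *: v.
    by rewrite opprD addrACA scalerBl.
  apply: le_lt_trans (nrmD _ _) _; rewrite nrmZ.
  have h2 : nrm (s - t) * nrm v <= d' * nrm v by rewrite ler_wpM2r ?nrm_ge0 // ltW.
  move: Hw d'd h2; rewrite dE; clear -v d'0; have := nrm_ge0 v; nra.
by exists d => // w Hw t Kt; apply: (Hd _ (Kr _ Kt) Kt).
Qed.

Variables p q : V -> C.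

(* Along the line [x + t *: v], [p] vanishes at [x] to an order [e] larger than
   the order [d] of [q]. *)
Definition excess (d : nat) (x : V) := exists (e : nat) (P Q : C -> C),
  [/\ [/\ (d < e)%N, forall t, p (x + t *: v) = t ^+ e * P t & forall t, q (x + t *: v) = t ^+ d * Q t],
      P 0 != 0, Q 0 != 0, derivable P 0 1 & derivable Q 0 1].

Lemma line_add x t s : x + t *: v + s *: v = x + (t + s) *: v.
Proof. by rewrite -addrA -scalerDl. Qed.

(** Without excess the order of [q] is at least that of [p] at each point of the line, so q / p
    extends locally, and the local quotients patch. The point [t1] excludes that [p] vanishes
    identically. *)
Lemma quotient_of_no_excess w r : 0 < r ->
    (forall t, nrm t < 32 * r -> differentiable p (w + t *: v) /\ differentiable q (w + t *: v)) ->
    (exists2 t1 : C, nrm t1 <= r & p (w + t1 *: v) != 0) ->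
    (forall (t0 : C) (d : nat), nrm t0 <= r -> ~ excess d (w + t0 *: v)) ->
  exists chi, forall t0, nrm t0 <= r ->
    derivable chi t0 1 /\ q (w + t0 *: v) = p (w + t0 *: v) * chi t0.
Proof.
move=> r0 dpq [t1 t1r pt1] nS.
pose phi t := p (w + t *: v); pose psi t := q (w + t *: v).
have dphi t : nrm t < 32 * r -> derivable phi t 1.
  by move=> /dpq[dp _]; apply: is_derive_derivable (differentiable_line dp).
have dpsi t : nrm t < 32 * r -> derivable psi t 1.
  by move=> /dpq[_ dq']; apply: is_derive_derivable (differentiable_line dq').
apply: (@removable_quotient phi psi (fun t0 => nrm t0 <= r)) => t0 t0r.
(* The second alternative of [zero_order] reaches an eighth of the radius: 24 r / 8 = 3 r covers
   [t1], which is within 2 r of [t0], while the disc of radius 24 r around [t0] stays inside that of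
   radius 32 r. *)
have r24 : 0 < 24 * r by rewrite mulr_gt0.
have sub t : nrm (t - t0) < 24 * r -> nrm t < 32 * r.
  move=> Ht; have := nrm_sub t t0; move: Ht t0r r0; clear -v p q; lra.
have d1 t : nrm (t - t0) < 24 * r -> derivable phi t 1 by move=> /sub/dphi.
have d2 t : nrm (t - t0) < 24 * r -> derivable psi t 1 by move=> /sub/dpsi.
have t00 : nrm (t0 - t0) < 24 * r by rewrite subrr nrm0.
have [[e [P [PE P0 dP]]]|Z] := zero_order r24 d1; last first.
  have := pt1; rewrite -/(phi t1) Z ?eqxx //.
  by have := nrmB t1 t0; move: t1r t0r r0; clear -v p q; lra.
have nzP := ctn_neq0 (derivable_ctn (dP _ t00)) P0.
have nzphi : \forall t \near t0, t != t0 -> phi t != 0.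
  move: nzP; apply: filterS => t Pt tt0; rewrite PE mulf_neq0 // expf_neq0 //.
  by rewrite subr_eq0.
have [[d [Q [QE Q0 dQ]]]|Z] := zero_order r24 d2; last first.
  exists (fun=> 0); split; [exact: derivable_cstC| |exact: nzphi].
  apply/near_nrmP; exists (24 * r / 8); first by rewrite divr_gt0.
  by move=> t /Z ->; rewrite mulr0.
have [de|ed] := ltnP d e.
  exfalso; apply: (nS t0 d t0r); exists e, (fun t => P (t + t0)), (fun t => Q (t + t0)).
  split; rewrite ?add0r //.
  - split=> // t; rewrite line_add [t0 + t]addrC.
      by rewrite -/(phi (t + t0)) PE addrK.
    by rewrite -/(psi (t + t0)) QE addrK.
  - by apply: derivable_shiftC; rewrite add0r; apply: dP.
  - by apply: derivable_shiftC; rewrite add0r; apply: dQ.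
exists (fun t => (t - t0) ^+ (d - e) * (Q t / P t)); split; last exact: nzphi.
  have h1 := @derivable_expC (fun t => t - t0) (d - e) t0 (@derivable_subC _ t0 t0).
  exact: (derivableMC h1 (derivable_divC P0 (dQ _ t00) (dP _ t00))).
move: nzP; apply: filterS => t Pt; rewrite QE PE -{1}(subnKC ed) exprD.
by rewrite -!mulrA; congr (_ * _); rewrite mulrCA [P t * _]mulrC divfK.
Qed.

(* Otherwise q / p would extend to the disc |t| <= r of the line through [w],
   where the maximum principle bounds it by its values near |t| = r; but it is
   unbounded along the line through [y]. *)
Lemma excess_nearby y r (d : nat) : 0 < r -> excess d y ->
    (exists2 eta, 0 < eta & forall w, nrm (w - y) < eta -> forall t, nrm t < 32 * r ->
       differentiable p (w + t *: v) /\ differentiable q (w + t *: v)) ->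
    (forall t, 0 < nrm t <= r -> p (y + t *: v) != 0) ->
  exists2 rho, 0 < rho & forall w, nrm (w - y) < rho ->
    exists (t : C) (d' : nat), nrm t <= r /\ excess d' (w + t *: v).
Proof.
move=> r0 [e [P [Q [[de pE qE] P0 Q0 dP dQ]]]] [eta eta0 Heta] pnz.
have dy t : nrm t < 32 * r -> differentiable p (y + t *: v) /\ differentiable q (y + t *: v).
  by apply: Heta; rewrite subrr nrm0.
(* This annulus contains every circle of radius r / 2 whose centre has modulus at most r / 4, in
   particular the one around [z] used at the end. *)
pose K (t : C) := r / 4 <= nrm t <= 3 * r / 4.
pose G B (x : V) := p x != 0 /\ nrm (q x) <= B^-1 * nrm (p x).
have Kr t : K t -> nrm t <= r by move=> /andP[_ h]; move: h r0; clear -v p q; lra.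
have [rho1 rho10 H1] : exists2 d, 0 < d & forall w, nrm (w - y) < d -> forall t, K t -> G d (w + t *: v).
  apply: (@tube_near y K r G r0 Kr).
  - move=> t /negP; rewrite negb_and -!ltNge => /orP[h|h].
      exists (r / 4 - nrm t); first by rewrite subr_gt0.
      move=> s Hs /andP[h1 _]; have := nrm_sub s t; move: Hs h1; clear -v p q; lra.
    exists (nrm t - 3 * r / 4); first by rewrite subr_gt0.
    move=> s Hs /andP[_ h1]; have := nrm_sub t s; rewrite [nrm (t - s)]nrmBC; move: Hs h1; clear -v p q; lra.
  - move=> d1 d2 x /andP[d20 d21] [h1 h2]; split=> //; apply: le_trans h2 _.
    by rewrite ler_wpM2r ?nrm_ge0 // lef_pV2 // posrE (lt_le_trans d20).
  move=> t Kt; have [h1 h2] := andP Kt.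
  have t0 : 0 < nrm t <= r by rewrite (Kr _ Kt) andbT; move: h1 r0; clear -v p q; lra.
  have t32 : nrm t < 32 * r by case/andP: t0 => _; move: r0; clear -v p q; lra.
  have [dp dq'] := dy _ t32; have p0 := pnz _ t0.
  have [d1 d10 D1] := differentiable_neq0 dp p0.
  have [d2 d20 D2] := differentiable_ctn dq' ltr01.
  set pp := nrm (p _) in D1; have pp0 : 0 < pp by rewrite nrm_gt0.
  set qq := q (y + _) in D2; have qq0 : 0 < nrm qq + 1 by rewrite ltr_wpDl ?nrm_ge0.
  pose M := (nrm qq + 1) / (pp / 2); have M0 : 0 < M by rewrite divr_gt0 // divr_gt0.
  exists (Num.min d1 (Num.min d2 M^-1)); first by rewrite !lt_min d10 d20 invr_gt0.
  move=> x; rewrite !lt_min => /andP[/D1 x1 /andP[/D2 x2 _]]; split.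
    by rewrite -nrm_gt0; apply: lt_le_trans x1; rewrite divr_gt0.
  apply: (@le_trans _ _ (M * nrm (p x))); last first.
    rewrite ler_wpM2r ?nrm_ge0 // -[X in X <= _]invrK lef_pV2 ?posrE ?lt_min ?d10 ?d20 ?invr_gt0 //.
    by rewrite !ge_min lexx !orbT.
  apply: (@le_trans _ _ (nrm qq + 1)).
    by rewrite -[q x](subrK qq) addrC (le_trans (nrmD _ _)) // lerD2l.
  by rewrite /M -mulrA ler_peMr ?(ltW qq0) // mulrC ler_pdivlMr ?mul1r // divr_gt0.
set B := rho1^-1 in H1; have B0 : 0 < B by rewrite invr_gt0.
(* After removal of the common factor t^d, [p] still has the factor t^(e - d), which vanishes at 0,
   while [Q] does not; hence |q| > B |p| at all small nonzero parameters on the line through [y]. *)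
have [d1 d10 D1] : exists2 d1, 0 < d1 & forall h : C, nrm h < d1 ->
    B * nrm ((0 + h) ^+ (e - d) * P (0 + h)) < nrm (Q (0 + h)).
  apply: (@rctn_lt R (fun t => B * nrm (t ^+ (e - d) * P t)) (fun t => nrm (Q t))).
  - apply: (@rctnM _ (fun=> B) (fun t => nrm (t ^+ (e - d) * P t))); first exact: rctn_cst.
    apply: (@rctn_nrm _ (fun t => t ^+ (e - d) * P t)); apply: ctnM.
      exact: derivable_ctn (@derivable_expC (fun t => t) _ _ (is_derive_derivable (is_derive_idC 0))).
    exact: (derivable_ctn dP).
  - exact: rctn_nrm (derivable_ctn dQ).
  by rewrite expr0n subn_eq0 leqNgt de mul0r nrm0 mulr0 nrm_gt0.
pose z0 := Num.min (d1 / 2) (r / 4); have z00 : 0 < z0 by rewrite lt_min !divr_gt0.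
pose z : C := z0%:C; have nz : nrm z = z0 by rewrite nrmR gtr0_norm.
have zr : nrm z <= r / 4 by rewrite nz ge_min lexx orbT.
have zd : nrm z < d1.
  by rewrite nz; apply: (@le_lt_trans _ _ (d1 / 2)); [rewrite ge_min lexx|move: d10; clear -v p q; lra].
have z_neq0 : z != 0 by rewrite -nrm_gt0 nz.
have Hz : B * nrm (p (y + z *: v)) < nrm (q (y + z *: v)).
  rewrite pE qE -{1}(subnKC (ltnW de)) exprD -mulrA nrmM mulrCA [nrm (z ^+ d * _)]nrmM.
  by rewrite ltr_pM2l ?nrm_gt0 ?expf_neq0 //; have := D1 _ zd; rewrite add0r.
have z32 : nrm z < 32 * r by move: zr r0; clear -v p q; lra.
have [dpz dqz] := dy _ z32.
(* Passing from [y] to [w] changes |q| by at most [gap] and B |p| by at most B [gap], together half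
   of the strict difference, so the inequality at [z] survives. *)
pose gap := (nrm (q (y + z *: v)) - B * nrm (p (y + z *: v))) / (2 * (B + 1)).
have gap0 : 0 < gap by rewrite divr_gt0 ?subr_gt0 // mulr_gt0 // addr_gt0.
have [d2 d20 D2] := differentiable_ctn dpz gap0.
have [d3 d30 D3] := differentiable_ctn dqz gap0.
exists (Num.min eta (Num.min rho1 (Num.min d2 d3))); first by rewrite !lt_min eta0 rho10 d20.
move=> w; rewrite !lt_min => /andP[w1 /andP[w2 /andP[w3 w4]]].
apply: contrapT => Hno.
have nS t0 (d' : nat) : nrm t0 <= r -> ~ excess d' (w + t0 *: v) by move=> t0r Hex; apply: Hno; exists t0, d'.
have shift t : nrm (w + t *: v - (y + t *: v)) = nrm (w - y) by rewrite opprD addrACA subrr addr0.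
have ext1 : exists2 t1 : C, nrm t1 <= r & p (w + t1 *: v) != 0.
  have Kt : K (r / 2)%:C.
    by rewrite /K nrmR ger0_norm ?divr_ge0 ?(ltW r0) //; apply/andP; split; move: r0; clear -v p q; lra.
  by exists (r / 2)%:C; [exact: Kr|have [] := H1 w w2 _ Kt].
have [chi Hchi] := quotient_of_no_excess r0 (Heta w w1) ext1 nS.
have r20 : 0 < r / 2 by rewrite divr_gt0.
have in_r t : nrm (t - z) <= r / 2 -> nrm t <= r.
  by move=> Ht; have := nrm_sub t z; move: Ht zr r0; clear -v p q; lra.
have chiz : nrm (chi z) <= B.
  rewrite -(cmean_center r20 (fun t Ht => (Hchi t (in_r t Ht)).1)).
  apply: cmean_bound; [exact: ltW| |] => t Ht.
    by apply: derivable_ctn; apply: (Hchi t _).1; apply: in_r; rewrite Ht.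
  have Kt : K t.
    have := nrm_sub t z; have := nrm_sub (t - z) (- z); rewrite opprK subrK nrmN Ht.
    by rewrite /K; move: zr r0; clear -v p q => ? ? ? ?; apply/andP; split; lra.
  have [pt qt] := H1 w w2 _ Kt.
  have [_ E] := Hchi t (Kr _ Kt).
  by move: qt; rewrite E nrmM mulrC ler_pM2r // nrm_gt0.
have [_ Ez] := Hchi z (in_r z (ltac:(by rewrite subrr nrm0 ltW))).
have qw : nrm (q (w + z *: v)) <= B * nrm (p (w + z *: v)).
  by rewrite Ez nrmM mulrC ler_wpM2r ?nrm_ge0.
have h2 := D2 (w + z *: v); rewrite shift in h2; have {}h2 := h2 w3.
have h3 := D3 (w + z *: v); rewrite shift in h3; have {}h3 := h3 w4.
have k2 := nrm_sub (p (w + z *: v)) (p (y + z *: v)).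
have k3 := nrm_sub (q (y + z *: v)) (q (w + z *: v)).
rewrite nrmBC in k3.
have gE : nrm (q (y + z *: v)) - B * nrm (p (y + z *: v)) = gap * (2 * (B + 1)).
  by rewrite /gap divfK // gt_eqF // mulr_gt0 // addr_gt0.
have k4 : B * nrm (p (w + z *: v)) <= B * (nrm (p (y + z *: v)) + gap).
  rewrite ler_pM2l //; move: k2 h2; clear -v p q; lra.
clearbody gap.
move: qw k3 h3 k4 gE gap0 B0; clear -v p q.
move: (nrm (q (w + z *: v))) (nrm (q (y + z *: v))) (nrm (p (w + z *: v))) (nrm (p (y + z *: v))).
move: (nrm _) gap B => u g b q1 q2 p1 p2 *; nra.
Qed.

End ZerosOnLines.

(** * Extension across common zeros *)

Section Indeterminacy.
Variable R : realType.
Local Notation C := (Cplx R).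
Variable V : normedModType C.
Implicit Types (t s a b : C) (r B : R) (w x y z v : V) (p q : V -> C).

Lemma line_in_ball v x y r t : nrm t * (nrm v + 1) < r -> nrm (y - x) < r ->
  nrm (y + t *: v - x) < 2 * r.
Proof.
move=> tr yx; rewrite addrAC; apply: le_lt_trans (nrmD _ _) _; rewrite nrmZ.
have : nrm t * nrm v <= nrm t * (nrm v + 1) by rewrite ler_wpM2l ?nrm_ge0 // lerDl.
by move: tr yx; clear; lra.
Qed.

(* A zero [b] of [Q] would give [phi] the factor (t - a)^d (t - b), and the
   maximum principle for the cofactor would bound |phi sg| by
   (2 sg)^(d+1) K0 / (r0 / 4)^(d+1). *)
Lemma cofactor_nonvanishing (phi Q : C -> C) (d : nat) (a : C) (r0 sg K0 : R) :
    0 < r0 -> 0 < sg <= r0 / 8 -> nrm a < sg ->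
    (forall t, nrm t < 2 * r0 -> derivable Q t 1) ->
    (forall t, phi t = (t - a) ^+ d * Q t) ->
    (forall t, nrm t <= r0 -> nrm (phi t) <= K0) ->
    (2 * sg) ^+ d.+1 * (K0 / (r0 / 4) ^+ d.+1) < nrm (phi sg%:C) ->
  forall b, nrm b < sg -> Q b != 0.
Proof.
move=> r00 /andP[sg0 sgr] asg dQ phiE K Hbig b bsg; apply/eqP => Qb.
have nsg : nrm (sg%:C : C) = sg by rewrite nrmR gtr0_norm.
pose Q3 := dq Q b.
have QE t : Q t = (t - b) * Q3 t by rewrite (dqE Q b t) Qb add0r.
have dQ0 t : nrm (t - 0) < 2 * r0 -> derivable Q t 1 by rewrite subr0; apply: dQ.
have dQ3 t : nrm t < 2 * r0 -> derivable Q3 t 1.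
  by rewrite -{1}[t]subr0 => Ht; apply: (@dq_derivable _ Q b t (open_disc_near dQ0 Ht)).
have r20 : 0 < r0 / 2 by rewrite divr_gt0.
have r40 : 0 < r0 / 4 by rewrite divr_gt0.
have in_r t : nrm (t - sg%:C) <= r0 / 2 -> nrm t <= r0.
  by move=> Ht; have := nrm_sub t sg%:C; rewrite nsg; move: Ht sgr r00; clear; lra.
have dmean t : nrm (t - sg%:C) <= r0 / 2 -> derivable Q3 t 1.
  by move=> /in_r Ht; apply: dQ3; apply: le_lt_trans Ht _; move: r00; clear; lra.
have far c t : nrm c < sg -> nrm (t - sg%:C) = r0 / 2 -> r0 / 4 <= nrm (t - c).
  move=> cs Ht; have := nrm_sub (t - sg%:C) (c - sg%:C).
  have -> : t - sg%:C - (c - sg%:C) = t - c by ring.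
  by have := nrmB c sg%:C; rewrite Ht nsg; move: cs sgr r00; clear; lra.
have K00 : 0 <= K0 by apply: le_trans (nrm_ge0 _) (K 0 _); rewrite nrm0 ltW.
have bnd : nrm (Q3 sg%:C) <= K0 / (r0 / 4) ^+ d.+1.
  rewrite -(cmean_center r20 dmean); apply: cmean_bound; [exact: ltW| |] => t Ht.
    by apply/derivable_ctn/dmean; rewrite Ht.
  rewrite ler_pdivlMr ?exprn_gt0 //; have tr : nrm t <= r0 by apply: in_r; rewrite Ht.
  apply: le_trans (K _ tr); rewrite phiE QE !nrmM nrmX mulrA mulrC ler_wpM2r ?nrm_ge0 //.
  rewrite exprSr; apply: ler_pM; rewrite ?exprn_ge0 ?(ltW r40) //; last exact: far.
  by apply: lerXn2r; rewrite ?nnegrE ?nrm_ge0 ?(ltW r40) //; exact: far.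
have close c : nrm c < sg -> nrm (sg%:C - c) <= 2 * sg.
  by move=> cs; apply: le_trans (nrmB _ _) _; rewrite nsg; move: cs; clear; lra.
move: Hbig; rewrite ltNge phiE QE !nrmM nrmX mulrA => /negP; apply.
apply: ler_pM; rewrite ?mulr_ge0 ?exprn_ge0 ?nrm_ge0 //.
rewrite exprSr; apply: ler_pM; rewrite ?exprn_ge0 ?nrm_ge0 //; last exact: close.
by apply: lerXn2r; rewrite ?nnegrE ?nrm_ge0 ?mulr_ge0 ?(ltW sg0) //; exact: close.
Qed.

(* On each nearby line [q] has exactly [d] small zeros. By [excess_nearby] and
   minimality they coincide, at a point where [p] vanishes to higher order, so
   p / q extends over them and is recovered from its mean over a circle. *)
Lemma excess_minimal_extends v p q y (d : nat) (delta : R) : 0 < delta ->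
    (forall x, nrm (x - y) < delta -> differentiable p x /\ differentiable q x) ->
    excess v p q d y ->
    (forall x (d' : nat), nrm (x - y) < delta -> excess v p q d' x -> (d <= d')%N) ->
  exists h : V -> C, [/\ \forall w \near y, differentiable h w,
    \forall w \near y, h w * q w = p w & h y = 0].
Proof.
move=> del0 dpq exy dmin.
have v0 : 0 < nrm v + 1 by rewrite ltr_wpDl ?nrm_ge0.
have [e [P [Q [[de pE qE] P0 Q0 dP dQ]]]] := exy.
have nP := ctn_neq0 (derivable_ctn dP) P0.
have [d1 d10 D1] := (near_nrmP (0 : C) _).1 nP.
pose m := nrm (Q 0) / 2.
have m0 : 0 < m by rewrite divr_gt0 // nrm_gt0.
have mQ : m < nrm (Q 0) by move: m0; rewrite /m; clear -V; lra.
have [d2 d20 D2] := rctn_lt (@rctn_cst R m 0) (rctn_nrm (derivable_ctn dQ)) mQ.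
pose r0 := Num.min (Num.min d1 d2 / 2) (delta / (4 * (nrm v + 1))).
have d120 : 0 < Num.min d1 d2 by rewrite lt_min d10.
have r00 : 0 < r0 by rewrite lt_min !divr_gt0 // mulr_gt0.
have r0d1 t : nrm t <= r0 -> P t != 0.
  move=> Ht; apply: D1; rewrite subr0; apply: le_lt_trans Ht _.
  apply: (@le_lt_trans _ _ (Num.min d1 d2 / 2)); first by rewrite ge_min lexx.
  apply: (@lt_le_trans _ _ (Num.min d1 d2)); last by rewrite ge_min lexx.
  by move: d120; clear -V; lra.
have r0d2 t : nrm t <= r0 -> m < nrm (Q t).
  move=> Ht; rewrite -[t]add0r; apply: D2; apply: le_lt_trans Ht _.
  apply: (@le_lt_trans _ _ (Num.min d1 d2 / 2)); first by rewrite ge_min lexx.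
  apply: (@lt_le_trans _ _ (Num.min d1 d2)); last by rewrite ge_min lexx orbT.
  by move: d120; clear -V; lra.
have r0del : r0 * (4 * (nrm v + 1)) <= delta.
  by rewrite -ler_pdivlMr ?mulr_gt0 // ge_min lexx orbT.
clearbody r0.
have in_ball w t : nrm (w - y) < delta / 2 -> nrm t < 2 * r0 -> nrm (w + t *: v - y) < delta.
  move=> wy tr; have -> : delta = 2 * (delta / 2) by clear -V; lra.
  apply: line_in_ball wy; apply: (@lt_le_trans _ _ (2 * r0 * (nrm v + 1))); first by rewrite ltr_pM2r.
  by move: r0del; clear -V; lra.
have yy : nrm (y - y) < delta / 2 by rewrite subrr nrm0 divr_gt0.
have [rho0 rho00 Hrho0] : exists2 d, 0 < d & forall w, nrm (w - y) < d ->
    forall t, nrm t <= r0 -> nrm (q (w + t *: v)) <= d^-1.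
  apply: (@tube_near R V v y (fun t => nrm t <= r0) r0 (fun B x => nrm (q x) <= B^-1) r00).
  - by [].
  - move=> t /negP; rewrite -ltNge => tr; exists (nrm t - r0); first by rewrite subr_gt0.
    move=> s Hs sr; have := nrm_sub t s; rewrite [nrm (t - s)]nrmBC; move: Hs sr; clear -V; lra.
  - move=> B B' x /andP[B'0 B'B] /le_trans; apply.
    by rewrite lef_pV2 // posrE (lt_le_trans B'0).
  move=> t tr; have [_ dq'] : differentiable p (y + t *: v) /\ differentiable q (y + t *: v).
    by apply: dpq; apply: in_ball yy _; move: tr r00; clear -V; lra.
  have [B B0 HB] := differentiable_ctn dq' ltr01.
  set qq := q (y + _) in HB; have qq0 : 0 < nrm qq + 1 by rewrite ltr_wpDl ?nrm_ge0.
  exists (Num.min B (nrm qq + 1)^-1); first by rewrite lt_min B0 invr_gt0.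
  move=> x; rewrite lt_min => /andP[/HB xB _].
  apply: (@le_trans _ _ (nrm qq + 1)).
    by rewrite -[q x](subrK qq) addrC (le_trans (nrmD _ _)) // lerD2l.
  rewrite -[X in X <= _]invrK lef_pV2 ?posrE ?lt_min ?B0 ?invr_gt0 //.
  by rewrite ge_min lexx orbT.
set K0 := rho0^-1 in Hrho0; have K00 : 0 < K0 by rewrite invr_gt0.
pose M := 2 ^+ d.+1 * (K0 / (r0 / 4) ^+ d.+1).
have M0 : 0 < M.
  apply: mulr_gt0; first exact: exprn_gt0.
  by apply: divr_gt0 => //; apply: exprn_gt0; apply: divr_gt0.
(* The bound required by [cofactor_nonvanishing] is sg^d (sg M). Since sg M < m, it lies below sg^d
   m, hence below the modulus of [q] at parameter [sg] on the line through [y]. *)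
pose sg := Num.min (r0 / 8) (m / (2 * M)).
have sg0 : 0 < sg.
  rewrite lt_min; apply/andP; split; first exact: divr_gt0.
  by apply: divr_gt0 => //; apply: mulr_gt0.
have sgr : sg <= r0 / 8 by rewrite ge_min lexx.
have sgM : sg * M < m.
  have M2 : 0 < 2 * M by apply: mulr_gt0.
  have : sg * (2 * M) <= m by rewrite -(ler_pdivlMr _ _ M2) ge_min lexx orbT.
  by have := mulr_gt0 sg0 M0; clear -V; lra.
clearbody sg.
have nsg : nrm (sg%:C : C) = sg by rewrite nrmR gtr0_norm.
pose Lam := (2 * sg) ^+ d.+1 * (K0 / (r0 / 4) ^+ d.+1).
have LamE : Lam = sg ^+ d * (sg * M).
  by rewrite /Lam /M exprMn [sg ^+ d.+1]exprSr; ring.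
have Lq : Lam < nrm (q (y + sg%:C *: v)).
  rewrite qE nrmM nrmX nsg LamE ltr_pM2l ?exprn_gt0 //; apply: lt_trans sgM _.
  by apply: r0d2; rewrite nsg; move: sgr r00; clear -V; lra.
have ysg : nrm (sg%:C : C) < 2 * r0 by rewrite nsg; move: sgr r00; clear -V; lra.
have [_ dqs] := dpq _ (in_ball y sg%:C yy ysg).
have gap0 : 0 < (nrm (q (y + sg%:C *: v)) - Lam) / 2 by rewrite divr_gt0 // subr_gt0.
have [d3 d30 D3] := differentiable_ctn dqs gap0.
have sg40 : 0 < sg / 4 by rewrite divr_gt0.
(* The radius sg / 4 places the excess point [a] of each nearby line strictly inside the circle of
   radius sg / 2 that defines [h]. *)
have [rho rho_gt0 Hrho] : exists2 rho, 0 < rho & forall w, nrm (w - y) < rho ->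
    exists (t : C) (d' : nat), nrm t <= sg / 4 /\ excess v p q d' (w + t *: v).
  apply: (excess_nearby sg40 exy).
    exists (delta / 2); first by rewrite divr_gt0.
    move=> w wy t Ht; apply: dpq; apply: in_ball wy _.
    by move: Ht sgr r00; clear -V; lra.
  move=> t /andP[t0 tsg]; rewrite pE mulf_neq0 // ?expf_neq0 -?nrm_gt0 //.
  by rewrite nrm_gt0; apply: r0d1; move: tsg sgr r00; clear -V; lra.
have sg20 : 0 < sg / 2 by rewrite divr_gt0.
pose h w := cmean 0 (sg / 2) (fun s => p (w + s *: v) / q (w + s *: v)).
exists h; split.
- apply: (@holomorphic_cmean R V (fun x => p x / q x) y v (sg / 2) sg20) => s Hs.
  have sr : nrm s < 2 * r0 by rewrite Hs; move: sgr sg0; clear -V; lra.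
  have nb : \forall w \near (y + s *: v), nrm (w - y) < delta.
    have bs := in_ball y s yy sr.
    apply/near_nrmP; exists (delta - nrm (y + s *: v - y)); first by rewrite subr_gt0.
    by move=> w Hw; apply: le_lt_trans (nrm_triangle _ (y + s *: v) _) _; rewrite -ltrBrDr.
  apply: near_differentiable_div.
  + by apply: filterS nb => w /dpq[].
  + by apply: filterS nb => w /dpq[].
  rewrite qE mulf_neq0 //; first by rewrite expf_neq0 // -nrm_gt0 Hs.
  rewrite -nrm_gt0; apply: lt_trans m0 _; apply: r0d2; rewrite Hs; move: sgr sg0; clear -V; lra.
- apply/near_nrmP; exists (Num.min (delta / 2) (Num.min rho0 (Num.min d3 rho))).
    by rewrite !lt_min rho00 d30 rho_gt0 divr_gt0.
  move=> w; rewrite !lt_min => /andP[w1 /andP[w2 /andP[w3 w4]]].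
  have [a [d' [a4 exw]]] := Hrho _ w4.
  have asg : nrm a < sg by move: a4 sg0; clear -V; lra.
  have a2r : nrm a < 2 * r0 by move: asg sgr r00; clear -V; lra.
  have dd' := dmin _ _ (in_ball w a w1 a2r) exw.
  have [e' [P' [Q' [[de' pE' qE'] P'0 Q'0 dP' dQ']]]] := exw.
  have lineE t : w + t *: v = w + a *: v + (t - a) *: v by rewrite line_add (addrC a) subrK.
  (* Minimality gives d <= d', so [q] has the factor (t - a)^d on this line, and e' > d' gives [p]
     one factor more. Once [Qw] is shown not to vanish, p / q is (t - a) Pw / Qw inside the disc. *)
  pose Qw t := (t - a) ^+ (d' - d) * Q' (t - a).
  pose Pw t := (t - a) ^+ (e' - d.+1) * P' (t - a).
  have qw t : q (w + t *: v) = (t - a) ^+ d * Qw t.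
    by rewrite lineE qE' /Qw mulrA -exprD subnKC.
  have pw t : p (w + t *: v) = (t - a) ^+ d.+1 * Pw t.
    by rewrite lineE pE' /Pw mulrA -exprD subnKC // (leq_ltn_trans dd').
  have dline f F n t : (forall x, nrm (x - y) < delta -> differentiable f x) ->
      (forall t, f (w + a *: v + t *: v) = t ^+ n * F t) -> derivable F 0 1 ->
      nrm t < 2 * r0 -> derivable (fun t => F (t - a)) t 1.
    move=> df FE dF tr; apply: (@derivable_shiftC R F (- a) t).
    apply: (derivable_cofactor FE dF).
    apply: is_derive_derivable; apply: differentiable_line; apply: df.
    by rewrite -lineE; apply: in_ball.
  have dpow n t : derivable (fun t => (t - a) ^+ n) t 1.
    exact: (@derivable_expC R (fun t => t - a) n t (@derivable_subC R a t)).
  have dQw t : nrm t < 2 * r0 -> derivable Qw t 1.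
    move=> tr; have h1 := dline q Q' d' t (fun x Hx => (dpq x Hx).2) qE' dQ' tr.
    exact: derivableMC (dpow _ t) h1.
  have dPw t : nrm t < 2 * r0 -> derivable Pw t 1.
    move=> tr; have h1 := dline p P' e' t (fun x Hx => (dpq x Hx).1) pE' dP' tr.
    exact: derivableMC (dpow _ t) h1.
  have big : Lam < nrm (q (w + sg%:C *: v)).
    have := D3 (w + sg%:C *: v); rewrite opprD addrACA subrr addr0 => /(_ w3).
    have := nrm_sub (q (y + sg%:C *: v)) (q (w + sg%:C *: v)).
    by rewrite nrmBC; move: Lq; clear -V; lra.
  have sgr' : 0 < sg <= r0 / 8 by rewrite sg0.
  have Qw0 b : nrm b < sg -> Qw b != 0.
    exact: (@cofactor_nonvanishing (fun t => q (w + t *: v)) Qw d a r0 sg K0 r00 sgr' asg dQw qw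
      (Hrho0 w w2) big).
  pose chi t := (t - a) * (Pw t / Qw t).
  have dchi t : nrm (t - 0) <= sg / 2 -> derivable chi t 1.
    rewrite subr0 => ts; have t1 : nrm t < sg by move: ts sg0; clear -V; lra.
    have t2 : nrm t < 2 * r0 by move: t1 sgr r00; clear -V; lra.
    exact: (derivableMC (@derivable_subC R a t) (derivable_divC (Qw0 t t1) (dPw t t2) (dQw t t2))).
  have -> : h w = chi 0.
    rewrite -(cmean_center sg20 dchi); apply: eq_cmean => [|s]; first exact: ltW.
    rewrite subr0 => Hs; rewrite pw qw /chi.
    have s1 : nrm s < sg by rewrite Hs; move: sg0; clear -V; lra.
    have sa : s - a != 0.
      rewrite subr_eq0; apply/eqP => E; move: a4; rewrite -E Hs; move: sg0; clear -V; lra.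
    have := Qw0 s s1; move: (Pw s) (Qw s) => A B B0.
    by rewrite exprSr; field; rewrite B0 expf_neq0.
  rewrite -[w in q w]addr0 -[w in p w]addr0 -(scale0r v) pw qw /chi.
  have := Qw0 0 (ltac:(by rewrite nrm0)); move: (Pw 0) (Qw 0) => A B B0.
  by rewrite exprSr; field.
(* On the line through [y] itself p / q is t^(e - d) P / Q with e > d, so its mean, the value at 0,
   is 0. *)
rewrite /h; pose chi t := t ^+ (e - d) * (P t / Q t).
have Q0' t : nrm t <= sg / 2 -> Q t != 0.
  move=> ts; rewrite -nrm_gt0; apply: lt_trans m0 _; apply: r0d2.
  by move: ts sgr sg0; clear -V; lra.
have t2r t : nrm t <= sg / 2 -> nrm t < 2 * r0 by move: sgr sg0; clear -V; lra.
have dchi t : nrm (t - 0) <= sg / 2 -> derivable chi t 1.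
  rewrite subr0 => ts.
  have [dp1 dq1] := dpq _ (in_ball y t yy (t2r t ts)).
  have hP := derivable_cofactor pE dP (is_derive_derivable (differentiable_line dp1)).
  have hQ := derivable_cofactor qE dQ (is_derive_derivable (differentiable_line dq1)).
  have hn := @derivable_expC R (fun t => t) (e - d) t (is_derive_derivable (is_derive_idC t)).
  exact: derivableMC hn (derivable_divC (Q0' t ts) hP hQ).
rewrite (@eq_cmean _ _ chi) ?(ltW sg20) //.
  by rewrite (cmean_center sg20 dchi) /chi expr0n subn_eq0 leqNgt de mul0r.
move=> s; rewrite subr0 => Hs; rewrite pE qE /chi -{1}(subnKC (ltnW de)) exprD.
have sd : s ^+ d != 0 by rewrite expf_neq0 // -nrm_gt0 Hs.
have := Q0' s; rewrite Hs => /(_ (lexx _)); move: (s ^+ (e - d)) (s ^+ d) sd (P s) (Q s) => A B B0 X Y Y0.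
by field; rewrite Y0 B0.
Qed.

(** Each line near the one through [z] carries a quotient, and its value at the centre is its mean
    over the circle of radius [r], where [p] does not vanish; this mean is holomorphic in the base
    point. The 64 is the 32 of [quotient_of_no_excess] doubled by [line_in_ball]. *)
Lemma no_excess_quotient v p q z (r delta : R) : 0 < r -> 64 * r * (nrm v + 1) <= delta ->
    (forall x, nrm (x - z) < delta -> differentiable p x /\ differentiable q x) ->
    (forall t, nrm t = r -> p (z + t *: v) != 0) ->
    (forall x (d : nat), nrm (x - z) < delta -> ~ excess v p q d x) ->
  exists E : V -> C, (\forall w \near z, differentiable E w) /\
    (\forall w \near z, E w * p w = q w).
Proof.
move=> r0 rdel dpq pnz nex.
have v0 : 0 < nrm v + 1 by rewrite ltr_wpDl ?nrm_ge0.
have del0 : 0 < delta by apply: lt_le_trans rdel; rewrite !mulr_gt0 // ltr0n.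
have in_ball w t : nrm (w - z) < delta / 2 -> nrm t < 32 * r -> nrm (w + t *: v - z) < delta.
  move=> wz tr; have -> : delta = 2 * (delta / 2) by clear -V; lra.
  apply: line_in_ball wz; apply: (@lt_le_trans _ _ (32 * r * (nrm v + 1))); first by rewrite ltr_pM2r.
  by move: rdel; clear -V; lra.
have zz : nrm (z - z) < delta / 2 by rewrite subrr nrm0 divr_gt0.
have r32 t : nrm t <= r -> nrm t < 32 * r by move: r0; clear -V; lra.
have [rho rho0 Hrho] : exists2 d, 0 < d & forall w, nrm (w - z) < d ->
    forall t, nrm t = r -> p (w + t *: v) != 0.
  apply: (@tube_near R V v z (fun t => nrm t = r) r (fun=> fun x => p x != 0) r0).
  - by move=> t ->.
  - move=> t /eqP tr; exists `|nrm t - r|; first by rewrite normr_gt0 subr_eq0.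
    move=> s Hs sr; have h1 := nrm_sub t s; have h2 := nrm_sub s t.
    move: Hs h1 h2; rewrite sr [nrm (t - s)]nrmBC => Hs h1 h2.
    by move: Hs; rewrite ltNge ler_norml => /negP; apply; apply/andP; split; move: h1 h2; clear -V; lra.
  - by [].
  move=> t tr; have [dp _] := dpq _ (in_ball z t zz (r32 t (ltac:(by rewrite tr)))).
  have p0 := pnz t tr; have [d d0 Hd] := differentiable_neq0 dp p0.
  exists d => // x /Hd Hx; rewrite -nrm_gt0; apply: lt_le_trans Hx.
  by rewrite divr_gt0 // nrm_gt0.
exists (fun w => cmean 0 r (fun s => q (w + s *: v) / p (w + s *: v))); split.
  apply: (@holomorphic_cmean R V (fun x => q x / p x) z v r r0) => s Hs.
  have nb : \forall w \near (z + s *: v), nrm (w - z) < delta.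
    have bs := in_ball z s zz (r32 s (ltac:(by rewrite Hs))).
    apply/near_nrmP; exists (delta - nrm (z + s *: v - z)); first by rewrite subr_gt0.
    by move=> w Hw; apply: le_lt_trans (nrm_triangle _ (z + s *: v) _) _; rewrite -ltrBrDr.
  apply: near_differentiable_div.
  - by apply: filterS nb => w /dpq[].
  - by apply: filterS nb => w /dpq[].
  exact: pnz.
apply/near_nrmP; exists (Num.min (delta / 2) rho); first by rewrite lt_min rho0 divr_gt0.
move=> w; rewrite lt_min => /andP[w1 w2].
have dw t : nrm t < 32 * r -> differentiable p (w + t *: v) /\ differentiable q (w + t *: v).
  by move=> tr; apply: dpq; apply: in_ball.
have nr : nrm (r%:C : C) = r by rewrite nrmR gtr0_norm.
have ex1 : exists2 t1 : C, nrm t1 <= r & p (w + t1 *: v) != 0.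
  by exists r%:C; [rewrite nr|apply: Hrho].
have nexw (t0 : C) (d : nat) : nrm t0 <= r -> ~ excess v p q d (w + t0 *: v).
  by move=> tr; apply: nex; apply: in_ball => //; apply: r32.
have [chi Hchi] := quotient_of_no_excess r0 dw ex1 nexw.
have dchi t : nrm (t - 0) <= r -> derivable chi t 1 by rewrite subr0 => /Hchi[].
rewrite (@eq_cmean _ _ chi) ?(ltW r0) //.
  rewrite (cmean_center r0 dchi).
  have [|_] := Hchi 0; first by rewrite nrm0 ltW.
  by rewrite scale0r addr0 mulrC => ->.
move=> s; rewrite subr0 => Hs; have [|_ ->] := Hchi s; first by rewrite Hs.
by rewrite mulrC mulKf // Hrho.
Qed.

End Indeterminacy.

(** * Reciprocals of meromorphic functions without zeros *)

Section Density.
Variable R : realType.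
Local Notation C := (Cplx R).
Variable V : normedModType C.
Implicit Types (x y z : V) (f g u p q : V -> C) (D : V -> Prop) (d e : R).

Lemma near_differentiable f g x : (\forall w \near x, f w = g w) ->
  differentiable f x -> differentiable g x.
Proof.
move=> fg /diff_locallyP[dc H].
have Ho : g \o shift x = cst (g x) + 'd f x +o_ (0 : V) id.
  apply/eqaddoP => e e0; have /eqaddoP/(_ e e0)/near0_nrmP[d1 d10 H1] := H.
  have [d2 d20 H2] := (near_nrmP x _).1 fg.
  apply/near0_nrmP; exists (Num.min d1 d2); first by rewrite lt_min d10.
  move=> h; rewrite lt_min add0r => /andP[h1 h2]; have := H1 h h1; rewrite add0r.
  rewrite -[X in _ -> `|X| <= _]/(g (h + x) - (g x + 'd f x h)).
  rewrite -[X in `|X| <= _ -> _]/(f (h + x) - (f x + 'd f x h)).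
  have -> : g (h + x) = f (h + x) by rewrite H2 // addrK.
  by have -> : g x = f x by rewrite H2 // subrr nrm0.
have E := diff_unique dc Ho.
by apply/diff_locallyP; rewrite E; exact: (conj dc Ho).
Qed.

Definition adherent D x := forall e, 0 < e -> exists2 y, nrm (y - x) < e & D y.

Lemma adherent_near D x (P : V -> Prop) : adherent D x -> (\forall y \near x, P y) ->
  exists2 y, P y & D y.
Proof. by move=> aD /near_nrmP[d d0 Hd]; have [y /Hd Py Dy] := aD d d0; exists y. Qed.

Lemma adherent_sub D D' x : (\forall y \near x, D y -> D' y) -> adherent D x -> adherent D' x.
Proof.
move=> /near_nrmP[d d0 Hd] aD e e0.
have [|y] := aD (Num.min d e); first by rewrite lt_min d0.
by rewrite lt_min => /andP[/Hd H ye] /H; exists y.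
Qed.

(** Openness of [D] leaves room around a nearby point of [D] for a point of the dense [D']. *)
Lemma adherent_and D D' x : (forall y, D y -> \forall w \near y, D w) ->
  adherent D x -> (forall y, adherent D' y) -> adherent (fun y => D y /\ D' y) x.
Proof.
move=> oD aD aD' e e0.
have [y ye /oD/near_nrmP[d d0 Hd]] := aD e e0.
have [|w] := aD' y (Num.min d (e - nrm (y - x))); first by rewrite lt_min d0 subr_gt0.
rewrite lt_min => /andP[/Hd Dw we] D'w; exists w => //.
by apply: le_lt_trans (nrm_triangle _ y _) _; rewrite -ltrBrDr.
Qed.

(** The device that carries an identity known only where the representatives are holomorphic over to
    every point, once both sides have been replaced by differentiable functions. *)
Lemma adherent_eq0 D u x : differentiable u x -> (\forall y \near x, D y -> u y = 0) ->
  adherent D x -> u x = 0.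
Proof.
move=> du nu aD; apply/eqP; apply: contrapT => /negP u0.
have [d d0 Hd] := differentiable_neq0 du u0.
have nz : \forall y \near x, nrm (u x) / 2 <= nrm (u y) by apply/near_nrmP; exists d.
have [y [/= H uy] Dy] := adherent_near aD (filterI nz nu).
by move: H; rewrite uy // nrm0 leNgt divr_gt0 // nrm_gt0.
Qed.

(** Some [y0] in the small ball has [q y0] nonzero. On the line from [x] to [y0] the order of [q] at
    [x] is then finite, so [q] is nonzero at points arbitrarily close to [x]. The direction has norm
    below e / 10, so parameters of modulus below 9 stay in the ball of radius [e], and 9 / 8 > 1
    lets [zero_order] reach [y0]. *)
Lemma identity_theorem q z e : 0 < e -> (forall x, nrm (x - z) < e -> differentiable q x) ->
    ~ (\forall x \near z, q x = 0) ->
  forall x, nrm (x - z) < e / 20 -> adherent (fun y => q y != 0) x.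
Proof.
move=> e0 dq' nq x xz d d0; apply: contrapT => Hno.
have Hq y : nrm (y - x) < d -> q y = 0.
  by move=> yx; apply/eqP; apply: contrapT => /negP qy; apply: Hno; exists y.
have [y0 y0z qy0] : exists2 y0, nrm (y0 - z) < e / 20 & q y0 != 0.
  apply: contrapT => H; apply: nq; apply/near_nrmP; exists (e / 20); first by rewrite divr_gt0 // ltr0n.
  by move=> y yz; apply/eqP; apply: contrapT => /negP qy; apply: H; exists y.
pose v := y0 - x.
have nv : nrm v < e / 10.
  have := nrm_triangle y0 z x; rewrite [nrm (z - x)]nrmBC -/v.
  by move: xz y0z; clear -V; lra.
have v0 : 0 < nrm v + 1 by rewrite ltr_wpDl ?nrm_ge0.
have dphi (t : C) : nrm (t - 0) < 9 -> derivable (fun s : C => q (x + s *: v)) t 1.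
  rewrite subr0 => t9; apply: is_derive_derivable; apply: differentiable_line; apply: dq'.
  rewrite addrAC; apply: le_lt_trans (nrmD _ _) _; rewrite nrmZ.
  have : nrm t * nrm v <= 9 * nrm v by rewrite ler_wpM2r ?nrm_ge0 // ltW.
  by move: nv xz e0; clear -V; lra.
have r9 : 0 < (9 : R) by rewrite ltr0n.
have [[n [P [PE P0 dP]]]|Z] := zero_order r9 dphi; last first.
  move: qy0; have := Z 1; rewrite subr0 nrm1 scale1r /v [x + _]addrC subrK => ->; first by rewrite eqxx.
  by clear -V; lra.
have dP0 : derivable P 0 1 by apply: dP; rewrite subr0 nrm0.
have [rho rho0 Hrho] := (near_nrmP (0 : C) _).1 (ctn_neq0 (derivable_ctn dP0) P0).
pose s := Num.min (rho / 2) (d / (2 * (nrm v + 1))).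
have s0 : 0 < s.
  rewrite lt_min; apply/andP; split; first exact: divr_gt0.
  by apply: divr_gt0 => //; apply: mulr_gt0.
have s1 : s <= rho / 2 by rewrite ge_min lexx.
have s2 : s * (2 * (nrm v + 1)) <= d.
  by rewrite -ler_pdivlMr ?mulr_gt0 // ge_min lexx orbT.
clearbody s; have ns : nrm (s%:C : C) = s by rewrite nrmR gtr0_norm.
have := PE s%:C; rewrite Hq.
  move=> /esym/eqP; apply/negP; rewrite mulf_neq0 //.
    by rewrite subr0 expf_neq0 // -nrm_gt0 ns.
  by apply: Hrho; rewrite subr0 ns; move: s1 rho0; clear -V; lra.
rewrite [x + _]addrC addrK nrmZ ns; apply: lt_le_trans s2.
by rewrite ltr_pM2l //; have := nrm_ge0 v; clear -V; lra.
Qed.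

End Density.

Section EntireReciprocal.
Variables (R : realType) (k : nat).
Local Notation C := (Cplx R).
Local Notation V := 'rV[C]_k.
Implicit Types (x y z w : V) (f g h F : V -> C) (d e : R).

Lemma holomorphic_near f z : holomorphic_at f z -> \forall w \near z, holomorphic_at f w.
Proof. by move=> /near_join. Qed.

Lemma holomorphic_differentiable f z : holomorphic_at f z -> differentiable f z.
Proof. exact: nbhs_singleton. Qed.

(** The definition says that the germ of [q] is nonzero at [z] only; the identity theorem spreads
    this to all points of a ball, so that one pair [p], [q] serves for density arguments throughout
    it. *)
Lemma meromorphic_repr f z : meromorphic f -> exists p q : V -> C, exists2 e, 0 < e &
  forall x, nrm (x - z) < e -> [/\ differentiable p x, differentiable q x,
    q x != 0 -> holomorphic_at f x /\ f x = p x / q x & adherent (fun y => q y != 0) x].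
Proof.
move=> mf; have [p [q [hp hq nq fE]]] := mf z; exists p, q.
have [e1 e10 H1] := (near_nrmP z _).1 hp.
have [e2 e20 H2] := (near_nrmP z _).1 hq.
have [e3 e30 H3] := (near_nrmP z _).1 fE.
pose e := Num.min e1 (Num.min e2 e3).
have e0 : 0 < e by rewrite !lt_min e10 e20.
have He x : nrm (x - z) < e -> [/\ differentiable p x, differentiable q x & q x != 0 -> f x = p x / q x].
  by rewrite !lt_min => /andP[/H1 h1 /andP[/H2 h2 /H3 h3]].
clearbody e.
have e200 : 0 < e / 20 by rewrite divr_gt0 // ltr0n.
exists (e / 20) => // x xz; have xe : nrm (x - z) < e by apply: lt_trans xz _; move: e0; clear; lra.
have [dp dq' _] := He x xe; split=> //.
  have nb : \forall w \near x, nrm (w - z) < e.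
    apply/near_nrmP; exists (e - nrm (x - z)); first by rewrite subr_gt0.
    by move=> w Hw; apply: le_lt_trans (nrm_triangle _ x _) _; rewrite -ltrBrDr.
  move=> q0; have ndp : \forall w \near x, differentiable p w by apply: filterS nb => w /He[].
  have ndq : \forall w \near x, differentiable q w by apply: filterS nb => w /He[].
  have nz : \forall w \near x, q w != 0.
    have [d d0 Hd] := differentiable_neq0 dq' q0.
    apply/near_nrmP; exists d => // w /Hd H; rewrite -nrm_gt0.
    by apply: lt_le_trans H; rewrite divr_gt0 // nrm_gt0.
  split; last by have [_ _] := He x xe; apply.
  have nd := near_differentiable_div ndp ndq q0.
  have nE : \forall w \near x, p w / q w = f w.
    by apply: filterS2 nb nz => w /He[_ _ E] /E.
  by apply: filterS2 (near_join nE) nd => w; apply: near_differentiable.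
have dqz y : nrm (y - z) < e -> differentiable q y by move=> /He[_ h _]; exact: h.
exact: (identity_theorem e0 dqz nq xz).
Qed.

Lemma holomorphic_dense f x : meromorphic f -> adherent (holomorphic_at f) x.
Proof.
move=> mf; have [p [q [e e0 H]]] := meromorphic_repr x mf.
have xx : nrm (x - x) < e by rewrite subrr nrm0.
have [_ _ _ aq] := H x xx; apply: adherent_sub aq.
by apply/near_nrmP; exists e => // y /H[_ _ h _] /h[].
Qed.

Lemma holomorphic_dense2 f g x : meromorphic f -> meromorphic g ->
  adherent (fun y => holomorphic_at f y /\ holomorphic_at g y) x.
Proof.
move=> mf mg; apply: adherent_and => [y||y]; [exact: holomorphic_near|exact: holomorphic_dense..].
Qed.

Lemma reciprocal_local f z : meromorphic f -> zero_set f = set0 ->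
  exists E : V -> C, \forall w \near z,
    differentiable E w /\ (holomorphic_at f w -> E w * f w = 1).
Proof.
move=> mf Zf; have [p [q [e e0 H]]] := meromorphic_repr z mf.
have dpq x : nrm (x - z) < e -> differentiable p x /\ differentiable q x by move=> /H[].
have nb x : nrm (x - z) < e -> \forall w \near x, nrm (w - z) < e.
  move=> xz; apply/near_nrmP; exists (e - nrm (x - z)); first by rewrite subr_gt0.
  by move=> w Hw; apply: le_lt_trans (nrm_triangle _ x _) _; rewrite -ltrBrDr.
have zz : nrm (z - z) < e by rewrite subrr nrm0.
(* A holomorphic [h] with h q = p near [y] extends [f] there, by density of the points with [q]
   nonzero; so [h] cannot vanish at [y]. *)
have noZ y h : nrm (y - z) < e -> (\forall w \near y, differentiable h w) ->
    (\forall w \near y, h w * q w = p w) -> h y <> 0.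
  move=> yz dh hE h0; suff : zero_set f y by rewrite Zf.
  exists h; split=> //.
  apply: filterS3 (nb _ yz) dh (near_join hE) => w wz dhw hEw /holomorphic_differentiable dfw.
  have [_ _ _ aq] := H w wz; apply/eqP; rewrite -subr_eq0; apply/eqP.
  apply: (adherent_eq0 (u := fun x => f x - h x) (differentiableB dfw dhw) _ aq).
  apply: filterS2 (nb _ wz) hEw => x /H[_ _ fE _] hx qx.
  by have [_ ->] := fE qx; rewrite -hx mulfK // subrr.
(* If [p] vanished near [z], the zero function would extend [f] there. *)
have [y0 y0z py0] : exists2 y0, nrm (y0 - z) < e / 20 & p y0 != 0.
  apply: contrapT => Hno.
  have pz y : nrm (y - z) < e / 20 -> p y = 0.
    by move=> yz; apply/eqP; apply: contrapT => /negP qy; apply: Hno; exists y.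
  apply: (@noZ z (fun=> 0) zz); [|apply/near_nrmP; exists (e / 20)|by []].
  - by apply/near_nrmP; exists 1; [exact: ltr01|move=> w _; exact: differentiable_cst].
  - by rewrite divr_gt0 // ltr0n.
  by move=> w /pz ->; rewrite mul0r.
pose v := y0 - z.
have nv : nrm v < e / 20 by [].
have dphi (t : C) : nrm (t - 0) < 9 -> derivable (fun s : C => p (z + s *: v)) t 1.
  rewrite subr0 => t9; apply: is_derive_derivable; apply: differentiable_line.
  apply: (dpq _ _).1; rewrite [z + _]addrC addrK nrmZ.
  have : nrm t * nrm v <= 9 * nrm v by rewrite ler_wpM2r ?nrm_ge0 // ltW.
  by move: nv e0; clear -v; lra.
have r9 : 0 < (9 : R) by rewrite ltr0n.
have [[n [P [PE P0 dP]]]|Z] := zero_order r9 dphi; last first.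
  exfalso; move: py0; have := Z 1; rewrite subr0 nrm1 scale1r /v [z + _]addrC subrK => ->; first by rewrite eqxx.
  by clear; lra.
have dP0 : derivable P 0 1 by apply: dP; rewrite subr0 nrm0.
have [rho rho0 Hrho] := (near_nrmP (0 : C) _).1 (ctn_neq0 (derivable_ctn dP0) P0).
have v0 : 0 < nrm v + 1 by rewrite ltr_wpDl ?nrm_ge0.
pose r := Num.min (rho / 2) (e / 2 / (64 * (nrm v + 1))).
have v64 : 0 < 64 * (nrm v + 1) by rewrite mulr_gt0 // ltr0n.
have r0 : 0 < r.
  rewrite lt_min; apply/andP; split; first exact: divr_gt0.
  by apply: divr_gt0 => //; apply: divr_gt0.
have r1 : r <= rho / 2 by rewrite ge_min lexx.
have r2 : 64 * r * (nrm v + 1) <= e / 2.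
  rewrite [64 * r]mulrC -mulrA -(ler_pdivlMr _ _ v64).
  by rewrite ge_min lexx orbT.
clearbody r.
have pnz (t : C) : nrm t = r -> p (z + t *: v) != 0.
  move=> tr; rewrite PE subr0 mulf_neq0 //.
    by rewrite expf_neq0 // -nrm_gt0 tr.
  by apply: Hrho; rewrite subr0 tr; move: r1 rho0; clear -v; lra.
have e2e x : nrm (x - z) < e / 2 -> nrm (x - z) < e by move: e0; clear -v; lra.
have nex x (d : nat) : nrm (x - z) < e / 2 -> ~ excess v p q d x.
  move=> xz ex.
  (* The order is minimised over a whole open ball, so that at a point [y] where the minimum is
     attained it is also minimal in a neighbourhood of [y], as [excess_minimal_extends] requires. *)
  pose A (d : nat) := `[< exists2 y, nrm (y - z) < e / 2 & excess v p q d y >].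
  have exA : exists d : nat, A d by exists d; apply/asboolP; exists x.
  case: (ex_minnP exA) => d1 /asboolP[y yz exy] dmin.
  have gap : 0 < e / 2 - nrm (y - z) by rewrite subr_gt0.
  have sub w : nrm (w - y) < e / 2 - nrm (y - z) -> nrm (w - z) < e / 2.
    by move=> Hw; apply: le_lt_trans (nrm_triangle _ y _) _; rewrite -ltrBrDr.
  have [||h [h1 h2 h3]] := @excess_minimal_extends R V v p q y d1 _ gap _ exy.
  - by move=> w /sub/e2e/dpq.
  - by move=> w d2 /sub wz exw; apply: dmin; apply/asboolP; exists w.
  exact: (noZ y h (e2e _ yz) h1 h2 h3).
have [|E [dE EE]] := no_excess_quotient r0 r2 _ pnz nex.
  by move=> x /e2e/dpq.
exists E; apply: filterS3 (nb _ zz) dE (near_join EE) => w wz dEw EEw; split=> //.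
move=> /holomorphic_differentiable dfw; have [_ _ _ aq] := H w wz.
apply/eqP; rewrite -subr_eq0; apply/eqP.
apply: (adherent_eq0 (u := fun x => E x * f x - 1) _ _ aq).
  exact: differentiableB (differentiableM dEw dfw) (differentiable_cst _ _).
apply: filterS2 (nb _ wz) EEw => x /H[_ _ fE _] hx qx.
by have [_ ->] := fE qx; rewrite mulrA hx divff // subrr.
Qed.

(** Local reciprocals agree with each other where both are defined, because they invert [f] on a
    dense set; taking at z the value of the one attached to z therefore glues them. *)
Lemma entire_reciprocal f : meromorphic f -> zero_set f = set0 ->
  exists F : V -> C, (forall z, differentiable F z) /\
    forall z, holomorphic_at f z -> F z * f z = 1.
Proof.
move=> mf Zf; have [E HE] := choice (fun z => reciprocal_local z mf Zf).
exists (fun z => E z z); split=> z; last by have [_] := nbhs_singleton (HE z).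
have nE : \forall w \near z, E z w = E w w.
  have := near_join (HE z); apply: filterS => w Hz.
  apply/eqP; rewrite -subr_eq0; apply/eqP.
  have [dz _] := nbhs_singleton Hz; have [dw _] := nbhs_singleton (HE w).
  apply: (adherent_eq0 (u := fun x => E z x - E w x) (differentiableB dz dw) _ (holomorphic_dense w mf)).
  apply: filterS2 Hz (HE w) => x [_ Hzx] [_ Hwx] hx.
  have fx : f x != 0 by apply/eqP => fx; have := Hzx hx; rewrite fx mulr0 => /esym/eqP; rewrite oner_eq0.
  by apply: (mulIf fx); rewrite mulrBl mul0r Hzx // Hwx // subrr.
by apply: near_differentiable nE _; have [] := nbhs_singleton (HE z).
Qed.

Lemma entire_omits_two_constant F (c1 c2 : C) : (forall z, differentiable F z) -> c1 != c2 ->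
  (forall z, F z != c1) -> (forall z, F z != c2) -> forall z, F z = F 0.
Proof.
move=> dF c12 F1 F2 z.
have dl (t : C) : derivable (fun s : C => F (0 + s *: z)) t 1.
  exact: is_derive_derivable (differentiable_line (dF _)).
have := little_picard dl c12 (fun t => F1 _) (fun t => F2 _) 1.
by rewrite scale1r scale0r addr0 add0r.
Qed.

End EntireReciprocal.

(** * The Fermat equation *)

(** In characteristic 0 the polynomial X^n - 1 is separable, so its n roots in the closed field are
    distinct. *)
Lemma three_roots_of_unity (F : numClosedFieldType) (n : nat) : (3 <= n)%N ->
  exists a b c : F, [/\ [/\ a ^+ n = 1, b ^+ n = 1 & c ^+ n = 1], a != b, a != c & b != c].
Proof.
move=> n3; have n0 : (0 < n)%N by apply: leq_trans n3.
have nF : n%:R != 0 :> F by rewrite pnatr_eq0 -lt0n.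
have [rs E] := closed_field_poly_normal ('X^n - 1 : {poly F}).
have monE : lead_coef ('X^n - 1 : {poly F}) = 1 by apply/monicP; rewrite monicXnsubC.
rewrite monE scale1r in E.
have := cyclotomic.separable_Xn_sub_1 nF; rewrite E separable.separable_prod_XsubC.
have rsn : size rs = n by apply: succn_inj; rewrite -(size_prod_XsubC rs id) -E size_XnsubC.
have root1 a : a \in rs -> a ^+ n = 1.
  move=> ars; have : root ('X^n - 1) a by rewrite E root_prod_XsubC.
  by rewrite rootE !hornerE subr_eq0 => /eqP.
move: rs rsn root1 {E} => [|a [|b [|c rs]]] rsn root1; try by rewrite -rsn in n3.
rewrite /= !inE !negb_or => /andP[/and3P[ab ac _] /andP[/andP[bc _] _]].
by exists a, b, c; split=> //; split; apply: root1; rewrite !inE eqxx ?orbT.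
Qed.

Section Fermat.
Variables (R : realType) (k : nat).
Local Notation C := (Cplx R).
Local Notation V := 'rV[C]_k.
Implicit Types (x y z w : V) (f g h F : V -> C) (m n : nat).

Lemma differentiable_exp f n z : differentiable f z -> differentiable (fun w => f w ^+ n) z.
Proof.
move=> df; elim: n => [|n IH]; first exact: differentiable_cst.
have -> : (fun w => f w ^+ n.+1) = f * (fun w => f w ^+ n) by apply/funext => w; rewrite exprS.
exact: differentiableM df IH.
Qed.

Lemma adherent_eq (D : V -> Prop) f g z : adherent D z ->
    differentiable f z -> differentiable g z ->
    (\forall w \near z, D w -> f w = g w) -> f z = g z.
Proof.
move=> aD df dg fg; apply/eqP; rewrite -subr_eq0; apply/eqP.
apply: (adherent_eq0 (u := fun w => f w - g w) (differentiableB df dg) _ aD).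
by move: fg; apply: filterS => w H /H ->; rewrite subrr.
Qed.

Lemma entire_eq (D : V -> Prop) f g : (forall z, adherent D z) ->
    (forall z, differentiable f z) -> (forall z, differentiable g z) ->
    (forall w, D w -> f w = g w) -> forall z, f z = g z.
Proof.
move=> aD df dg fg z; apply: (adherent_eq (aD z) (df z) (dg z)).
by apply/near_nrmP; exists 1; [exact: ltr01|move=> w _; exact: fg].
Qed.

Lemma zero_set_cst f (c : C) : meromorphic f -> mero_eq_cst f c -> c != 0 -> zero_set f = set0.
Proof.
move=> mf fc c0; apply/seteqP; split=> // z [h [hh hE h0]].
have : h z = c.
  apply: (adherent_eq (g := fun=> c) (holomorphic_dense z mf)).
  - exact: holomorphic_differentiable.
  - exact: differentiable_cst.
  by move: hE; apply: filterS => w E hw; rewrite -E // fc.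
by rewrite h0 => /eqP; rewrite eq_sym (negPf c0).
Qed.

Lemma zero_set_constant f : meromorphic f -> mero_constant f -> ~ mero_eq_cst f 0 -> zero_set f = set0.
Proof.
move=> mf [c fc] f0; apply: (zero_set_cst mf fc).
by apply/eqP => c0; apply: f0; rewrite -c0.
Qed.

Lemma fermat_solutionC m n f g : fermat_solution m n f g -> fermat_solution n m g f.
Proof. by move=> fg z hg hf; rewrite addrC fg. Qed.

(** At a point of a [zero_set] the representative itself need not be holomorphic. The equation is
    therefore transferred by density to the local extensions [h1] and [h2], and evaluated there. *)
Lemma fermat_zeros_disjoint m n f g z : (0 < m)%N -> (0 < n)%N -> meromorphic f -> meromorphic g ->
  fermat_solution m n f g -> zero_set f z -> zero_set g z -> False.
Proof.
move=> m0 n0 mf mg fg [h1 [hh1 E1 Z1]] [h2 [hh2 E2 Z2]].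
have : h1 z ^+ m + h2 z ^+ n = 1.
  apply: (adherent_eq (f := fun w => h1 w ^+ m + h2 w ^+ n) (g := fun=> 1) (holomorphic_dense2 z mf mg)).
  - by apply: differentiableD; apply: differentiable_exp; apply: holomorphic_differentiable.
  - exact: differentiable_cst.
  by apply: filterS2 E1 E2 => w H1 H2 [hf hg]; rewrite -H1 // -H2 // fg.
by rewrite Z1 Z2 !expr0n !gtn_eqF // addr0 => /esym/eqP; rewrite oner_eq0.
Qed.

Lemma meromorphic_subC f (c : C) : meromorphic f -> meromorphic (fun z => f z - c).
Proof.
move=> mf z; have [p [q [hp hq nq E]]] := mf z.
exists (fun w => p w - c * q w), q; split=> //.
  apply: filterS2 hp hq => w dp dq'; apply: differentiableB dp _.
  exact: differentiableM (differentiable_cst _ _) dq'.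
by apply: filterS E => w H q0; rewrite H // mulrBl mulfK.
Qed.

Lemma holomorphic_subC f (c : C) z : holomorphic_at f z <-> holomorphic_at (fun w => f w - c) z.
Proof.
split=> H; move: H; apply: filterS => w dw.
  exact: differentiableB dw (differentiable_cst _ _).
have -> : f = (fun w => f w - c) + cst c by apply/funext => y; rewrite /= fctE subrK.
exact: differentiableD dw (differentiable_cst _ _).
Qed.

Lemma reciprocal_constant f F : (forall z, holomorphic_at f z -> F z * f z = 1) ->
  (forall z, F z = F 0) -> mero_constant f.
Proof.
move=> Ff FE; exists (F 0)^-1 => z /Ff; rewrite FE => H.
have F0 : F 0 != 0 by apply/eqP => F0; move: H; rewrite F0 mul0r => /esym/eqP; rewrite oner_eq0.
by apply: (mulfI F0); rewrite H divff.
Qed.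

Lemma fermat_zero_free m n f g : (0 < m)%N -> (3 <= n)%N -> meromorphic f -> meromorphic g ->
  fermat_solution m n f g -> zero_set f = set0 -> mero_constant f /\ mero_constant g.
Proof.
move=> m0 n3 mf mg fg Zf; have [F [dF Ff]] := entire_reciprocal mf Zf.
have [a [b [c [[an bn cn] ab ac bc]]]] := three_roots_of_unity C n3.
have Fm w : holomorphic_at f w -> holomorphic_at g w -> F w ^+ m * (1 - g w ^+ n) = 1.
  move=> hf hg; have <- : f w ^+ m = 1 - g w ^+ n by rewrite -(fg w hf hg) addrK.
  by rewrite -exprMn Ff // expr1n.
have recip (s : C) : s ^+ n = 1 -> exists G : V -> C, (forall z, differentiable G z) /\
    forall z, holomorphic_at g z -> G z * (g z - s) = 1.
  move=> sn; have ms := meromorphic_subC s mg.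
  have [|G [dG HG]] := entire_reciprocal ms.
    apply/seteqP; split=> // z [h [hh hE h0]].
    have : F z ^+ m * (1 - (h z + s) ^+ n) = 1.
      apply: (adherent_eq (f := fun w => F w ^+ m * (1 - (h w + s) ^+ n)) (g := fun=> 1) (holomorphic_dense2 z mf mg)).
      - have dh := holomorphic_differentiable hh.
        apply: (differentiableM (differentiable_exp _ (dF z))).
        apply: (differentiableB (differentiable_cst _ _)); apply: differentiable_exp.
        exact: differentiableD dh (differentiable_cst _ _).
      - exact: differentiable_cst.
      apply: filterS hE => w H [hf hg]; rewrite -H ?subrK ?Fm //.
      exact: (holomorphic_subC g s w).1 hg.
    by rewrite h0 add0r sn subrr mulr0 => /esym/eqP; rewrite oner_eq0.
  by exists G; split=> // z hz; apply: HG; exact: (holomorphic_subC g s z).1 hz.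
have [G1 [dG1 HG1]] := recip a an.
have G1_neq0 z : holomorphic_at g z -> G1 z != 0.
  by move=> /HG1 H; apply/eqP => E; move: H; rewrite E mul0r => /esym/eqP; rewrite oner_eq0.
(* Writing g - s = (g - a) + (a - s) and multiplying by both reciprocals gives G (1 + (a - s) G1) =
   G1. If [G1] took the value 1 / (s - a), the bracket would vanish and force that value to be 0. *)
have omits s : s ^+ n = 1 -> s != a -> forall z, G1 z != (s - a)^-1.
  move=> sn sa z; have [G [dG HG]] := recip s sn.
  have E : G z * (1 + (a - s) * G1 z) = G1 z.
    apply: (entire_eq (f := fun z => G z * (1 + (a - s) * G1 z)) (fun z => holomorphic_dense z mg)) => [y|//|w hg].
      apply: (differentiableM (dG y)); apply: (differentiableD (differentiable_cst _ _)).
      exact: differentiableM (differentiable_cst _ _) (dG1 y).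
    have H1 := HG1 w hg; have H2 := HG w hg.
    have -> : G w * (1 + (a - s) * G1 w) = G w * (G1 w * (g w - a) + (a - s) * G1 w) by rewrite H1.
    have -> : G1 w * (g w - a) + (a - s) * G1 w = G1 w * (g w - s) by ring.
    by rewrite mulrCA H2 mulr1.
  apply/eqP => E1; move: E; rewrite E1 -opprB mulNr divff ?subrr ?mulr0; last by rewrite subr_eq0.
  by move=> /esym/eqP; rewrite invr_eq0 subr_eq0 (negPf sa).
have G1E : forall z, G1 z = G1 0.
  apply: (@entire_omits_two_constant R k G1 (b - a)^-1 (c - a)^-1 dG1).
  - by rewrite (inj_eq invr_inj) (inj_eq (addIr _)).
  - by apply: omits; rewrite // eq_sym.
  by apply: omits; rewrite // eq_sym.
pose c' := (G1 0)^-1 + a.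
have gc : mero_eq_cst g c'.
  move=> z hz; have H := HG1 z hz; have := G1_neq0 z hz; rewrite G1E in H *.
  by move=> G0; rewrite -[g z](subrK a); congr (_ + _); apply: (mulfI G0); rewrite H divff.
split; last by exists c'.
have FmE z : F z ^+ m * (1 - c' ^+ n) = 1.
  apply: (entire_eq (f := fun z => F z ^+ m * (1 - c' ^+ n)) (g := fun=> 1)
    (fun z => holomorphic_dense2 z mf mg)) => [y|y|w [hf hg]].
  - exact: (differentiableM (differentiable_exp _ (dF y)) (differentiable_cst _ _)).
  - exact: differentiable_cst.
  by have := Fm w hf hg; rewrite (gc w hg).
have F0 z : F z != 0.
  by apply/eqP => E; have := FmE z; rewrite E expr0n gtn_eqF // mul0r => /esym/eqP; rewrite oner_eq0.
apply: (reciprocal_constant Ff).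
(* F^m is a nonzero constant, so [F] omits 0; it also omits 2 F(0), whose m-th power is 2^m times
   that constant. Picard's theorem thus replaces a connectedness argument on the finite set of
   values. *)
apply: (@entire_omits_two_constant R k F 0 (2 * F 0) dF) => // [|z].
  by rewrite eq_sym mulf_neq0 // pnatr_eq0.
apply/eqP => E; have := FmE z; rewrite E exprMn -mulrA FmE mulr1 -natrX => /eqP.
by rewrite -[1]/(1%:R) eqr_nat -{2}(expn0 2) eqn_exp2l // gtn_eqF.
Qed.

Lemma fermat_quadratic_zero_free f g : meromorphic f -> meromorphic g ->
    fermat_solution 2 2 f g -> zero_set f = set0 -> zero_set g = set0 ->
  mero_constant f /\ mero_constant g.
Proof.
move=> mf mg fg Zf Zg.
have [F [dF Ff]] := entire_reciprocal mf Zf; have [G [dG Gg]] := entire_reciprocal mg Zg.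
have E z : F z ^+ 2 + G z ^+ 2 = F z ^+ 2 * G z ^+ 2.
  apply: (entire_eq (f := fun z => F z ^+ 2 + G z ^+ 2) (g := fun z => F z ^+ 2 * G z ^+ 2)
    (fun z => holomorphic_dense2 z mf mg)) => [y|y|w [hf hg]].
  - exact: differentiableD (differentiable_exp _ (dF y)) (differentiable_exp _ (dG y)).
  - exact: differentiableM (differentiable_exp _ (dF y)) (differentiable_exp _ (dG y)).
  have A1 : F w ^+ 2 * f w ^+ 2 = 1 by rewrite -exprMn Ff // expr1n.
  have B1 : G w ^+ 2 * g w ^+ 2 = 1 by rewrite -exprMn Gg // expr1n.
  by rewrite -[RHS]mulr1 -(fg w hf hg) mulrDr mulrAC A1 mul1r -mulrA B1 mulr1 addrC.
have omits (H K : V -> C) (s : C) : (forall z, H z ^+ 2 + K z ^+ 2 = H z ^+ 2 * K z ^+ 2) ->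
    s ^+ 2 = 1 -> forall z, H z != s.
  move=> HK s1 z; apply/eqP => Hz; have := HK z; rewrite Hz s1 mul1r => /eqP.
  by rewrite -subr_eq0 addrK oner_eq0.
have constant (H K : V -> C) : (forall z, differentiable H z) ->
    (forall z, H z ^+ 2 + K z ^+ 2 = H z ^+ 2 * K z ^+ 2) -> forall z, H z = H 0.
  move=> dH HK; apply: (@entire_omits_two_constant R k H 1 (-1) dH).
  - by rewrite -subr_eq0 opprK -[1 + 1]/(2%:R) pnatr_eq0.
  - by apply: (omits H K) => //; rewrite expr1n.
  by apply: (omits H K) => //; rewrite sqrrN expr1n.
split; first exact: reciprocal_constant Ff (constant F G dF E).
by apply: reciprocal_constant Gg (constant G F dG _) => z; rewrite addrC E mulrC.
Qed.

End Fermat.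

(* The zero set of the zero function is all of C^k, so e.g. (f, g) = (0, 1)
   must be kept out of the "only if" parts; the "if" parts need no exclusion. *)
Theorem theorem2 (R : realType) (k m n : nat)
    (hk : (1 <= k)%N) (hm : (2 <= m)%N) (hn : (2 <= n)%N)
    (f g : 'rV[Cplx R]_k -> Cplx R)
    (hf : meromorphic f) (hg : meromorphic g)
    (hfg : fermat_solution m n f g) :
  [/\ maxn m n = 2%N ->
        (zero_set f = zero_set g -> mero_constant f /\ mero_constant g) /\
        (~ mero_eq_cst f 0 -> ~ mero_eq_cst g 0 ->
          mero_constant f /\ mero_constant g -> zero_set f = zero_set g),
      (3 <= n)%N ->
        (zero_set f `<=` zero_set g -> mero_constant f /\ mero_constant g) /\
        (~ mero_eq_cst f 0 ->
          mero_constant f /\ mero_constant g -> zero_set f `<=` zero_set g) &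
      (3 <= m)%N ->
        (zero_set g `<=` zero_set f -> mero_constant f /\ mero_constant g) /\
        (~ mero_eq_cst g 0 ->
          mero_constant f /\ mero_constant g -> zero_set g `<=` zero_set f)].
Proof.
have m0 : (0 < m)%N by apply: leq_trans hm.
have n0 : (0 < n)%N by apply: leq_trans hn.
have Z z : zero_set f z -> zero_set g z -> False by apply: fermat_zeros_disjoint hfg.
split=> [mn2|n3|m3].
- have [m2 n2] : m = 2%N /\ n = 2%N.
    split; apply/eqP; rewrite eqn_leq ?hm ?hn andbT -mn2 ?leq_maxl ?leq_maxr //.
  subst m n; split=> [Zfg|f0 g0 [cf cg]].
    apply: (fermat_quadratic_zero_free hf hg hfg); apply/seteqP; split=> // z Hz.
      by apply: (Z z Hz); rewrite -Zfg.
    by apply: (Z z) => //; rewrite Zfg.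
  by rewrite (zero_set_constant hf cf f0) (zero_set_constant hg cg g0).
- split=> [Zfg|f0 [cf cg]].
    apply: (fermat_zero_free m0 n3 hf hg hfg); apply/seteqP; split=> // z Hz.
    exact: Z z Hz (Zfg _ Hz).
  by rewrite (zero_set_constant hf cf f0).
split=> [Zgf|g0 [cf cg]].
  have [] : mero_constant g /\ mero_constant f; last by split.
  apply: (fermat_zero_free n0 m3 hg hf (fermat_solutionC hfg)).
  apply/seteqP; split=> // z Hz; exact: Z z (Zgf _ Hz) Hz.
by rewrite (zero_set_constant hg cg g0).
Qed.
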